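(* Let $\widetilde f:\mathbb R^2\to\mathbb R^2$ be a lift of $f:\mathbb T^2\to\mathbb T^2$. If $f\in \mathrm{Diff}_0^{1+\epsilon}(\mathbb T^2)$ and $(0,0)\in \mathrm{int}(\rho(\widetilde f))$, then $\omega(B_\theta^\infty)=\emptyset$ for all $\theta\in[0,2\pi]$. If $f\in \mathrm{Diff}_k^{1+\epsilon}(\mathbb T^2)$ for some integer $k\neq0$ and $0\in \mathrm{int}(\rho_V(\widetilde f))$, then $\omega(B_S^\infty)=\omega(B_N^\infty)=\emptyset$.
   Context: $\mathbb T^2=\mathbb R^2/\mathbb Z^2$; $p_2(\tilde x,\tilde y)=\tilde y$. $\mathrm{Diff}_0^{1+\epsilon}(\mathbb T^2)$ is the set of area-preserving diffeomorphisms of $\mathbb T^2$ of class $C^{1+\epsilon}$ (for some $\epsilon>0$) homotopic to the identity; $\mathrm{Diff}_k^{1+\epsilon}(\mathbb T^2)$ ($k\ne0$ an integer) is the set of area-preserving $C^{1+\epsilon}$ diffeomorphisms (some $\epsilon>0$) homotopic to the Dehn twist $(x,y)\mapsto(x+ky \bmod 1,\ y \bmod 1)$. Rotation sets: for $f$ homotopic to the identity, $\rho(\widetilde f)=\bigcap_{i\ge1}\overline{\bigcup_{n\ge i}\{(\widetilde f^n(\widetilde z)-\widetilde z)/n:\widetilde z\in\mathbb R^2\}}\subset\mathbb R^2$; for $f$ homotopic to a Dehn twist, $\rho_V(\widetilde f)=\bigcap_{i\ge1}\overline{\bigcup_{n\ge i}\{(p_2\circ\widetilde f^n(\widetilde z)-p_2(\widetilde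 z))/n:\widetilde z\in\mathbb R^2\}}\subset\mathbb R$. Interiors are taken in $\mathbb R^2$ and $\mathbb R$ respectively. In the homotopic to the identity case, $B_\theta=\{\widetilde z\in\mathbb R^2:\langle\widetilde f^n(\widetilde z),(\cos\theta,\sin\theta)\rangle\ge0\text{ for all integers }n\ge0\}$ and $B_\theta^\infty$ is the union of all unbounded connected components of $B_\theta$. In the Dehn twist case, $B_S=\{\widetilde z\in\mathbb R^2:p_2\circ\widetilde f^n(\widetilde z)\le0\text{ for all integers }n\ge0\}$, $B_N=\{\widetilde z\in\mathbb R^2:p_2\circ\widetilde f^n(\widetilde z)\ge0\text{ for all integers }n\ge0\}$, and $B_S^\infty$, $B_N^\infty$ are the unions of all unbounded connected components of $B_S$, $B_N$ respectively. These sets satisfy $\widetilde f(B^\infty)\subset B^\infty$, and $\omega(B^\infty)=\bigcap_{i\ge0}\widetilde f^i(B^\infty)$ for $B^\infty\in\{B_\theta^\infty,B_S^\infty,B_N^\infty\}$. *)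

(* Defs.v *)
From HB Require Import structures.
From mathcomp Require Import all_boot all_order all_algebra.
From mathcomp Require Import generic_quotient archimedean.
From mathcomp Require Import all_classical all_reals all_analysis.
Import Order.TTheory GRing.Theory Num.Theory.
Import numFieldNormedType.Exports.

Set Implicit Arguments.
Unset Strict Implicit.
Unset Printing Implicit Defensive.

Local Open Scope classical_set_scope.
Local Open Scope ring_scope.
Local Open Scope quotient_scope.

Section Torus.
Context {R : realType}.

Definition int_translate (x y : R * R) : bool :=
  (x.1 - y.1 \is a Num.int) && (x.2 - y.2 \is a Num.int).

Lemma int_translate_refl : reflexive int_translate.
Proof. by move=> x; rewrite /int_translate !subrr !rpred0. Qed.

Lemma int_translate_sym : symmetric int_translate.
Proof.
move=> x y; rewrite /int_translate.
by rewrite -[x.1 - _]opprB rpredN -[x.2 - _]opprB rpredN.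
Qed.

Lemma int_translate_trans : transitive int_translate.
Proof.
move=> y x z /andP[h1 h2] /andP[k1 k2]; apply/andP; split.
  by rewrite -[x.1](subrK y.1) -addrA; apply: rpredD.
by rewrite -[x.2](subrK y.2) -addrA; apply: rpredD.
Qed.

Canonical int_translate_equiv :=
  EquivRel int_translate int_translate_refl int_translate_sym
    int_translate_trans.

End Torus.

Definition torus (R : realType) : topologicalType :=
  quotient_topology {eq_quot (@int_translate R)}.

Section Maps.
Context {R : realType}.
Local Notation T2 := (torus R).

Definition torus_pi : R * R -> T2 :=
  \pi_(quotient_topology {eq_quot (@int_translate R)}).

Definition torus_repr : T2 -> R * R :=
  @repr _ (quotient_topology {eq_quot (@int_translate R)}).

Lemma torus_reprK : cancel torus_repr torus_pi.
Proof. exact: reprK. Qed.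

Lemma torus_piP (x y : R * R) :
  reflect (torus_pi x = torus_pi y) (int_translate x y).
Proof. exact: (@eqquotP _ int_translate_equiv {eq_quot int_translate}). Qed.

Definition is_lift (F : R * R -> R * R) (f : T2 -> T2) : Prop :=
  continuous F /\ forall z, torus_pi (F z) = f (torus_pi z).

(* The shear is computed on a representative; [dehn_twist_pi] shows that the
   choice is irrelevant. *)
Definition dehn_twist (k : int) (p : T2) : T2 :=
  torus_pi ((torus_repr p).1 + k%:~R * (torus_repr p).2, (torus_repr p).2).

Lemma dehn_twist_pi (k : int) (x y : R) :
  dehn_twist k (torus_pi (x, y)) = torus_pi (x + k%:~R * y, y).
Proof.
have /torus_piP := torus_reprK (torus_pi (x, y)).
rewrite /dehn_twist; case: (torus_repr _) => a b /andP[/= h1 h2].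
apply/torus_piP/andP; split=> //=.
by rewrite opprD addrACA -mulrBr; apply/rpredD/rpredM => //; exact: intr_int.
Qed.

Definition homotopic (f g : T2 -> T2) : Prop :=
  exists H : R * T2 -> T2,
    [/\ {within `[0, 1]%classic `*` [set: T2], continuous H},
        forall p, H (0, p) = f p & forall p, H (1, p) = g p].

(* Regularity is read in the charts of the torus given by the local inverses
   of the covering map, that is, on a lift. The derivative of a lift of a
   differentiable torus map is periodic, so a Hoelder bound over the whole
   plane is the same as one over the torus. *)
Definition C1holder (e : R) (f : T2 -> T2) : Prop :=
  exists F : R * R -> R * R,
    [/\ is_lift F f,
        forall z, differentiable F z &
        exists C : R, forall x y v : R * R,
          `|'d F x v - 'd F y v| <= C * `|x - y| `^ e * `|v|].

(* For e > 1 the Hoelder condition would leave only affine maps; since e is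
   existentially quantified below, restricting it to ]0, 1] loses nothing. *)
Definition C1eps_diffeo (f : T2 -> T2) : Prop :=
  exists g : T2 -> T2,
    [/\ cancel f g, cancel g f &
        exists e : R, [/\ 0 < e <= 1, C1holder e f & C1holder e g]].

Definition torus_borel : set (set T2) := <<s [set U : set T2 | open U] >>.

Definition torus_area (A : set T2) : \bar R :=
  ((@lebesgue_measure R) \x (@lebesgue_measure R))%E
    (torus_pi @^-1` A `&` `[0, 1[%classic `*` `[0, 1[%classic).

Definition area_preserving (f : T2 -> T2) : Prop :=
  forall A, torus_borel A -> torus_area (f @^-1` A) = torus_area A.

Definition Diff_0 : set (T2 -> T2) :=
  [set f | [/\ C1eps_diffeo f, area_preserving f & homotopic f id]].

Definition Diff_ (k : int) : set (T2 -> T2) :=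
  [set f | [/\ C1eps_diffeo f, area_preserving f &
               homotopic f (dehn_twist k)]].

Definition rotation_set (F : R * R -> R * R) : set (R * R) :=
  \bigcap_(i in [set i | (1 <= i)%N])
    closure (\bigcup_(n in [set n | (i <= n)%N])
      [set n%:R^-1 *: (iter n F z - z) | z in [set: R * R]]).

Definition vertical_rotation_set (F : R * R -> R * R) : set R :=
  \bigcap_(i in [set i | (1 <= i)%N])
    closure (\bigcup_(n in [set n | (i <= n)%N])
      [set ((iter n F z).2 - z.2) / n%:R | z in [set: R * R]]).

Definition unbounded_components (B : set (R * R)) : set (R * R) :=
  \bigcup_(C in [set connected_component B z | z in B] `&`
                ~` [set C : set (R * R) | bounded_set C]) C.

Definition B_theta (F : R * R -> R * R) (theta : R) : set (R * R) :=
  [set z | forall n : nat,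
     0 <= (iter n F z).1 * cos theta + (iter n F z).2 * sin theta].

Definition B_S (F : R * R -> R * R) : set (R * R) :=
  [set z | forall n : nat, (iter n F z).2 <= 0].

Definition B_N (F : R * R -> R * R) : set (R * R) :=
  [set z | forall n : nat, 0 <= (iter n F z).2].

Definition omega (F : R * R -> R * R) (B : set (R * R)) : set (R * R) :=
  \bigcap_(i in [set: nat]) (iter i F @` B).

End Maps.

(* Main.v *)
Require Import Defs.
From mathcomp Require Import all_boot all_order all_algebra.
From mathcomp Require Import all_classical all_reals all_analysis.
From mathcomp Require Import ring lra.
Import Order.TTheory GRing.Theory Num.Theory.
Import numFieldNormedType.Exports.

(** The lift F is injective, continuous, and at bounded distance from the linear map A
    (the identity or a shear) with F (z + u) = F z + A u for integer vectors u.

    To two distinct points k, p attach the angle by which p - k turns on its way to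
    F p - F k, measured along a canonical path of nonzero vectors that is trivial when
    p is far from k. For an orbit g and a vector u with F (z + u) = F z + u (a "gate"),
    the sum along the orbit of k of the angles of the pairs (k, g + u) minus those of the
    pairs (k, g), closed up by the visual angles of the segment [g, g + u], is a multiple of
    2 pi. It does not change in time while k is far from the segment, and it is locally
    constant in k as long as k is far from the segment at both end times.

    A point z of omega has, for every i, an i-th preimage b in an unbounded connected set
    C whose forward orbits all stay in a half-plane. Interior points of the rotation set
    provide orbits that climb, respectively descend, at a linear rate. Shifting them by
    lattice vectors and using the angle count on a whole row of gates produces a gate x
    that passes b from below before time i and a gate y that passes b from above after
    time i. Along a chain in C from b to a point far away, the sum of the winding of y
    against the increments of the winding of x does not depend on time as long as the
    segments of x and y stay apart; it is nonzero at time i, and zero at the end, where y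
    has left the half-plane. For a Dehn twist the shear separates x and y horizontally. In the
    other case the climbing direction is chosen so that the growth rate is almost
    differentiable there; all extremal orbits then have the same transverse drift, and
    a third orbit with maximal transverse drift, cutting the chain between b and x, gives
    the gate that replaces x. *)

(** The obstacle is separation: the pairing is invariant only while the two gates stay [sep_rad]
    apart, and nothing prevents a climbing and a descending orbit from meeting. All estimates are
    made at one scale N, with i of order N and errors that are small multiples of N. For a Dehn
    twist, staying above b by order N during order N steps moves a gate sideways by order N^2, which
    beats every error. Without shear only separations of order N are available. There a small second
    difference of the growth rate, at [ev] and at [- ev], pins down the drift along p of every
    almost extremal orbit, to one rate c1 for rising orbits and another rate - c2 for falling ones;
    measuring the drift along p - s ev instead, with a suitable s, makes the two rates equal. Then
    either x and y have well separated transverse coordinates and cross, or the orbits of C near z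
    have the common drift as well. In that case, the common drift being at most 0 after a change of
    sign, an orbit of positive transverse drift overtakes them all and supplies a gate separated
    from y. *)

Set Implicit Arguments.
Unset Strict Implicit.
Unset Printing Implicit Defensive.

Local Open Scope classical_set_scope.
Local Open Scope ring_scope.

(** * Angles between plane vectors *)

Section Angles.
Context {R : realType}.
Implicit Types (x y z : R * R) (s t : R).

Definition dotp x y : R := x.1 * y.1 + x.2 * y.2.
Definition crsp x y : R := x.1 * y.2 - x.2 * y.1.

(* [y] is a positive multiple of [x] rotated by the angle [t]. *)
Definition turns x y t := exists2 r : R, 0 < r &
  y = (r * (x.1 * cos t - x.2 * sin t), r * (x.1 * sin t + x.2 * cos t)).

(** The signed angle from x to y as long as it is acute; elsewhere the value carries no meaning,
    hence the many hypotheses [0 < dotp x y]. *)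
Definition rot x y : R := atan (crsp x y / dotp x y).

Lemma turns_add x y z s t : turns x y s -> turns y z t -> turns x z (s + t).
Proof.
move=> [r r0 ->] [q q0 ->]; exists (q * r); first exact: mulr_gt0.
by rewrite /= cosD sinD; congr pair; ring.
Qed.

Lemma turns_refl x : turns x x 0.
Proof.
exists 1 => //; rewrite cos0 sin0; case: x => a b /=.
by congr pair; ring.
Qed.

Lemma turns_sym x y t : turns x y t -> turns y x (- t).
Proof.
move=> [r r0 ->]; exists r^-1; rewrite ?invr_gt0 //= cosN sinN.
have r1 : r^-1 * r = 1 by rewrite mulVf // gt_eqF.
have h := cos2Dsin2 t; case: x => a b /=; congr pair.
  transitivity ((r^-1 * r) * a * (cos t ^+ 2 + sin t ^+ 2)); last by ring.
  by rewrite h r1; ring.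
transitivity ((r^-1 * r) * b * (cos t ^+ 2 + sin t ^+ 2)); last by ring.
by rewrite h r1; ring.
Qed.

Lemma dotp_gt0 x : x != 0 -> 0 < dotp x x.
Proof.
case: x => a b; rewrite /dotp /= -!expr2 => x0.
have : a ^+ 2 + b ^+ 2 != 0.
  apply: contra_neq x0 => /eqP; rewrite paddr_eq0 ?sqr_ge0 // !sqrf_eq0.
  by move=> /andP[/eqP -> /eqP ->].
by rewrite lt0r => ->/=; rewrite addr_ge0 ?sqr_ge0.
Qed.

Lemma turns_id x t : x != 0 -> turns x x t -> cos t = 1.
Proof.
move=> /dotp_gt0 x0 [r r0 xE].
have d1 : dotp x x = r * cos t * dotp x x.
  by rewrite {2}xE /dotp /=; ring.
have d2 : 0 = r * sin t * dotp x x.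
  have : crsp x x = 0 by rewrite /crsp; ring.
  by rewrite {2}xE /crsp /dotp /= => <-; ring.
have s0 : sin t = 0.
  have /eqP := d2; rewrite eq_sym !mulf_eq0 (gt_eqF r0) (gt_eqF x0) /= orbF.
  by move/eqP.
have h := cos2Dsin2 t; rewrite s0 expr0n addr0 in h.
have c0 : 0 < cos t.
  rewrite -(pmulr_rgt0 _ r0) -(pmulr_lgt0 _ x0).
  by rewrite -d1.
apply/eqP; rewrite -[_ == _](@eqrXn2 R 2 (cos t) 1) //; last exact: ltW.
by rewrite h expr1n.
Qed.

Lemma turns_uniq x y s t : x != 0 -> turns x y s -> turns x y t ->
  cos (s - t) = 1.
Proof.
move=> x0 h1 h2; apply: (turns_id x0).
exact: turns_add h1 (turns_sym h2).
Qed.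

Lemma dotp_neq0l x y : 0 < dotp x y -> x != 0.
Proof.
by move=> h; apply: contraTneq h => ->; rewrite /dotp /= !mul0r addr0 ltxx.
Qed.

Lemma dotpC x y : dotp x y = dotp y x.
Proof. by rewrite /dotp; ring. Qed.

Lemma dotp_neq0r x y : 0 < dotp x y -> y != 0.
Proof. by rewrite dotpC; exact: dotp_neq0l. Qed.

Lemma rot_bound x y : `|rot x y| < pi / 2.
Proof. by rewrite ltr_norml atan_gtNpi2 atan_ltpi2. Qed.

Lemma turns_rot x y : 0 < dotp x y -> turns x y (rot x y).
Proof.
move=> h; have x0 := dotp_gt0 (dotp_neq0l h).
set t := rot x y.
have c0 : 0 < cos t by apply: cos_gt0_pihalf; rewrite atan_gtNpi2 atan_ltpi2.
have tE : sin t / cos t = crsp x y / dotp x y by rewrite -/(tan t) atanK.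
have sE : sin t = crsp x y / dotp x y * cos t by rewrite -tE mulfVK ?gt_eqF.
exists (dotp x y / (dotp x x * cos t)).
  by rewrite divr_gt0 // mulr_gt0.
case: x y h x0 @t c0 tE sE => [a b] [c d] h x0 t c0 tE sE.
rewrite /= sE; move: h x0; rewrite /crsp /dotp /= => h x0.
have n1 := lt0r_neq0 h; have n2 := lt0r_neq0 x0; have n3 := lt0r_neq0 c0.
by congr pair; field; rewrite n1 n2 n3.
Qed.

Lemma rotxx x : rot x x = 0.
Proof. by rewrite /rot (_ : crsp x x = 0) ?mul0r ?atan0 // /crsp; ring. Qed.

Lemma cos_eq1_small t : cos t = 1 -> `|t| < 2 * pi -> t = 0.
Proof.
rewrite -cos_norm => h.
have pi0 := @pi_gt0 R; move: (normr_ge0 t) h.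
move nE : `|t| => n n0 h nlt.
suff : n = 0 by move=> n00; apply/normr0_eq0; rewrite nE.
have [npi|npi] := leP n pi.
  by apply: (@cos_inj R); rewrite ?in_itv /= ?cos0 // ?n0 ?lexx //= ltW.
have : cos (pi *+ 2 - n) = 1.
  by rewrite cosB cos2pi sin2pi h; ring.
have e1 : pi *+ 2 = 2 * (pi : R) by ring.
rewrite e1 => h1; have : 2 * pi - n = 0; last by lra.
by apply: (@cos_inj R); rewrite ?in_itv /= ?cos0 //; lra.
Qed.

Lemma cos_eq1B s t : cos s = 1 -> cos t = 1 -> cos (s - t) = 1.
Proof.
move=> hs ht; rewrite cosB hs ht.
have h := cos2Dsin2 s; rewrite hs expr1n in h.
have /eqP : sin s ^+ 2 = 0 by lra.
by rewrite sqrf_eq0 => /eqP ->; ring.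
Qed.

Lemma turns_eq x y s t : x != 0 -> turns x y s -> turns x y t ->
  `|s - t| < 2 * pi -> s = t.
Proof.
move=> x0 h1 h2 h; apply/eqP; rewrite -subr_eq0; apply/eqP.
by apply: cos_eq1_small => //; exact: turns_uniq h1 h2.
Qed.

Lemma rot_add x y z : 0 < dotp x y -> 0 < dotp y z -> 0 < dotp x z ->
  rot x y + rot y z = rot x z.
Proof.
move=> h1 h2 h3; apply: (@turns_eq x z).
- exact: dotp_neq0l h1.
- exact: turns_add (turns_rot h1) (turns_rot h2).
- exact: turns_rot.
have := rot_bound x y; have := rot_bound y z; have := rot_bound x z.
by rewrite !ltr_norml; have := @pi_gt0 R; lra.
Qed.

End Angles.

(** * Total turning of a path of nonzero vectors *)

Section Turning.
Context {R : realType}.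
Implicit Types (c : R -> R * R) (N M : nat).

(* The sampling step [1/N] is fine enough for [rot], which is exact only on acute angles,
   to see every turn of [c]; [turning c] is junk when no step is. *)
Definition fine c N := (0 < N)%N /\ forall s t : R,
  0 <= s <= 1 -> 0 <= t <= 1 -> `|s - t| * N%:R <= 1 -> 0 < dotp (c s) (c t).

Definition psum c N : R :=
  \sum_(0 <= i < N) rot (c (i%:R / N%:R)) (c (i.+1%:R / N%:R)).

Definition turning c := psum c (xget 0%N [set N | fine c N]).

Lemma sum_nat_mul (a : nat -> R) N M :
  \sum_(0 <= i < N * M) a i =
  \sum_(0 <= j < N) \sum_(0 <= l < M) a (j * M + l)%N.
Proof.
elim: N => [|N IH]; first by rewrite mul0n !big_nil.
rewrite mulSn addnC (@big_cat_nat _ _ _ (N * M)) ?leq_addr //= IH.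
rewrite big_nat_recr //=; congr +%R.
rewrite -{1}[(N * M)%N]add0n big_addn addKn.
by apply: eq_bigr => i _; rewrite addnC.
Qed.

Lemma rot_sum (p : nat -> R * R) m :
  (forall i j, (i <= m)%N -> (j <= m)%N -> 0 < dotp (p i) (p j)) ->
  \sum_(0 <= i < m) rot (p i) (p i.+1) = rot (p 0%N) (p m).
Proof.
elim: m => [|m IH] h; first by rewrite big_nil rotxx.
rewrite big_nat_recr //= IH; last first.
  by move=> i j im jm; apply: h; exact: leqW.
by apply: rot_add; apply: h => //; exact: leqW.
Qed.

Lemma frac01 i N : (0 < N)%N -> (i <= N)%N -> 0 <= (i%:R / N%:R : R) <= 1.
Proof.
move=> N0 iN; rewrite divr_ge0 //= ler_pdivrMr ?ltr0n // mul1r ler_nat //.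
Qed.

(** Inside one step of a fine subdivision the sampled vectors are pairwise at acute angles, so the
    angles of the smaller steps add up to that of the step. *)
Lemma psum_refine c N M : fine c N -> (0 < M)%N -> psum c (N * M) = psum c N.
Proof.
move=> [N0 cN] M0; rewrite /psum sum_nat_mul; apply: eq_big_nat => j /andP[_ jN].
pose p l := c ((j * M + l)%:R / (N * M)%:R : R).
have Nn : N%:R != 0 :> R by rewrite pnatr_eq0 -lt0n.
have Mn : M%:R != 0 :> R by rewrite pnatr_eq0 -lt0n.
have M0' : 0 < M%:R :> R by rewrite ltr0n.
have -> : c (j%:R / N%:R) = p 0%N.
  by rewrite /p addn0 !natrM; congr c; field; rewrite Nn Mn.
have -> : c (j.+1%:R / N%:R) = p M.
  by rewrite /p -mulSnr !natrM; congr c; field; rewrite Nn Mn.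
rewrite -rot_sum; first by apply: eq_bigr => l _; rewrite /p addnS.
have lem l : (l <= M)%N -> 0 <= ((j * M + l)%:R / (N * M)%:R : R) <= 1.
  move=> lM; apply: frac01; first by rewrite muln_gt0 N0.
  by rewrite (@leq_trans (j * M + M)) ?leq_add2l // -mulSnr leq_mul2r jN orbT.
move=> i l iM lM; apply: cN; rewrite ?lem //.
have -> : (j * M + i)%:R / (N * M)%:R - (j * M + l)%:R / (N * M)%:R =
   (i%:R - l%:R) / M%:R / N%:R :> R.
  by rewrite !natrD !natrM; field; rewrite Nn Mn.
rewrite normrM [ `|N%:R^-1|]gtr0_norm ?invr_gt0 ?ltr0n // mulfVK //.
rewrite normrM [ `|M%:R^-1|]gtr0_norm ?invr_gt0 // ler_pdivrMr // mul1r.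
have := ler_nat R i M; rewrite iM; have := ler_nat R l M; rewrite lM.
have : 0 <= i%:R :> R by []. have : 0 <= l%:R :> R by [].
by rewrite ler_norml; lra.
Qed.

(** Two fine step counts have their product as a common refinement, so the count picked by [turning]
    is immaterial. *)
Lemma turningE c N : fine c N -> turning c = psum c N.
Proof.
move=> cN; rewrite /turning.
have cg : fine c (xget 0%N [set N | fine c N]) by exact: (xgetI _ cN).
set M := xget _ _ in cg *.
by rewrite -(psum_refine cg (proj1 cN)) mulnC psum_refine //; case: cg.
Qed.

Lemma turns_turning c N : fine c N -> turns (c 0) (c 1) (turning c).
Proof.
move=> cN; rewrite (turningE cN) /psum; case: cN => N0 cN.
have Nn : N%:R != 0 :> R by rewrite pnatr_eq0 -lt0n.
suff h m : (m <= N)%N -> turns (c 0) (c (m%:R / N%:R))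
    (\sum_(0 <= i < m) rot (c (i%:R / N%:R)) (c (i.+1%:R / N%:R))).
  by have := h N (leqnn N); rewrite divff.
elim: m => [|m IH] mN; first by rewrite big_nil mul0r; exact: turns_refl.
rewrite big_nat_recr //=; apply: turns_add; first by apply: IH; exact: ltnW.
apply: turns_rot; apply: cN; rewrite ?frac01 //; first exact: ltnW.
rewrite -mulrBl normrM mulrC [ `|N%:R^-1|]gtr0_norm ?invr_gt0 ?ltr0n //.
rewrite mulrCA divff // mulr1 -natr1 opprD addNKr normrN normr1 //.
Qed.

Lemma turning_dot c :
  (forall s t, 0 <= s <= 1 -> 0 <= t <= 1 -> 0 < dotp (c s) (c t)) ->
  turning c = rot (c 0) (c 1).
Proof.
move=> h; have c1 : fine c 1 by split => // s t *; exact: h.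
by rewrite (turningE c1) /psum big_nat1 mul0r divr1.
Qed.

Lemma cvg_proj1 (X Y : topologicalType) (T : Type) (G : set_system T) {GF : Filter G}
  (x : T -> X * Y) (a : X * Y) :
  x @ G --> a -> (x t).1 @[t --> G] --> a.1.
Proof.
by move=> xa; exact: (@cvg_comp _ _ _ x fst G (nbhs a) _ xa cvg_fst).
Qed.

Lemma cvg_proj2 (X Y : topologicalType) (T : Type) (G : set_system T) {GF : Filter G}
  (x : T -> X * Y) (a : X * Y) :
  x @ G --> a -> (x t).2 @[t --> G] --> a.2.
Proof.
by move=> xa; exact: (@cvg_comp _ _ _ x snd G (nbhs a) _ xa cvg_snd).
Qed.

Lemma cvg_app (X Y : topologicalType) (h : X -> Y) (T : Type) (G : set_system T)
    {GF : Filter G} (x : T -> X) (a : X) :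
  {for a, continuous h} -> x @ G --> a -> h (x t) @[t --> G] --> h a.
Proof. by move=> ha xa; exact: (@cvg_comp _ _ _ x h G (nbhs a) (nbhs (h a)) xa ha). Qed.

Lemma cvg_minr (T : Type) (G : set_system T) {GF : Filter G} (x y : T -> R) (a b : R) :
  x @ G --> a -> y @ G --> b -> Num.min (x t) (y t) @[t --> G] --> Num.min a b.
Proof.
move=> xa yb; exact: (cvg_comp2 xa yb (@min_continuous _ R (a, b))).
Qed.

Lemma cvg_maxr (T : Type) (G : set_system T) {GF : Filter G} (x y : T -> R) (a b : R) :
  x @ G --> a -> y @ G --> b -> Num.max (x t) (y t) @[t --> G] --> Num.max a b.
Proof.
move=> xa yb; exact: (cvg_comp2 xa yb (@max_continuous _ R (a, b))).
Qed.

Lemma dotp_near (T : Type) (G : set_system T) {GF : Filter G} (x y : T -> R * R) (a b : R * R) :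
  x @ G --> a -> y @ G --> b -> 0 < dotp a b ->
  \forall t \near G, 0 < dotp (x t) (y t).
Proof.
move=> xa yb ab.
have h : dotp (x t) (y t) @[t --> G] --> dotp a b.
  rewrite /dotp; apply: cvgD; apply: cvgM;
    by [exact: cvg_proj1|exact: cvg_proj2].
by apply: (h [set r | 0 < r]); exact: lt_nbhsr.
Qed.

(** Acuteness holds near each (x0, s) by continuity; compactness of the unit interval turns this
    into one step count valid for all s and all nearby x. *)
Lemma near_fine (X : topologicalType) (x0 : X) (c : X -> R -> R * R) :
  (forall t, 0 <= t <= 1 -> c x0 t != 0) ->
  (forall t, 0 <= t <= 1 -> {for (x0, t), continuous (fun p : X * R => c p.1 p.2)}) ->
  exists N, \forall x \near x0, fine (c x) N.
Proof.
move=> c0 cc.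
pose P (i : X * nat) (s : R) :=
  (0 < i.2)%N /\ forall t, `|s - t| * i.2%:R <= 1 -> 0 < dotp (c i.1 s) (c i.1 t).
have /compact_near_coveringP cov := @segment_compact R 0 1.
have : \forall i \near (filter_prod (nbhs x0) (@nbhs nat _ \oo)), `[0, 1]%classic `<=` P i.
  apply: cov => s; rewrite /= in_itv /= => s01.
  have cs : (fun p : X * R => c p.1 p.2) @ (x0, s) --> c x0 s by exact: cc.
  have c1 : (fun q : (X * R) * (X * R) => c q.1.1 q.1.2) @ ((x0, s), (x0, s))
      --> c x0 s.
    apply: (@cvg_comp _ _ _ (fst : (X * R) * (X * R) -> _)
       (fun p : X * R => c p.1 p.2) _ (nbhs (x0, s)) _ _ cs); exact: cvg_fst.
  have c2 : (fun q : (X * R) * (X * R) => c q.2.1 q.2.2) @ ((x0, s), (x0, s))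
      --> c x0 s.
    apply: (@cvg_comp _ _ _ (snd : (X * R) * (X * R) -> _)
       (fun p : X * R => c p.1 p.2) _ (nbhs (x0, s)) _ _ cs); exact: cvg_snd.
  have := dotp_near c1 c2 (dotp_gt0 (c0 _ s01)).
  case=> -[A B] /= [[[A1 A2] /= [A1n A2n] hA] [[B1 B2] /= [B1n B2n] hB]] AB.
  have /nbhs_ballP[d /= d0 hd] : nbhs s (A2 `&` B2) by exact: filterI.
  (* With 2 < d n a step 1 / n is shorter than d / 2, so a point within d / 2 of s and any point one
     step away both lie in the ball of radius d. *)
  exists (ball s (d / 2), [set i | (A1 `&` B1) i.1 /\ (0 < i.2)%N /\ 2 < d * i.2%:R]).
    split; first by apply: nbhsx_ballx; lra.
    exists (A1 `&` B1, [set n | (0 < n)%N /\ 2 < d * n%:R]).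
      split => /=; first exact: filterI.
      exists (Num.truncn (2 / d)).+1 => // n /= nn; split; first exact: leq_ltn_trans nn.
      rewrite mulrC -ltr_pdivrMr //; apply: (@lt_le_trans _ _ (Num.truncn (2 / d)).+1%:R).
        exact: truncnS_gt.
      by rewrite ler_nat.
    by move=> [x n] /= [[? ?] [? ?]].
  move=> [s' [x n]] /= [+ [[xA xB] [n0 dn]]] => ss.
  split => // t /= st.
  have n0' : 0 < n%:R :> R by rewrite ltr0n.
  have st' : `|s' - t| < d / 2.
    rewrite -(@ltr_pM2r _ n%:R) //; apply: le_lt_trans st _; lra.
  have [hs1 hs2] : (A2 `&` B2) s'.
    by apply: hd; apply: le_ball ss; lra.
  have [ht1 ht2] : (A2 `&` B2) t.
    apply: hd; rewrite /ball /= in ss *.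
    rewrite (_ : s - t = (s - s') + (s' - t)); last by ring.
    by apply: le_lt_trans (ler_normD _ _) _; lra.
  apply: (AB ((x, s'), (x, t))); split => /=.
    exact: (hA (x, s')).
  exact: (hB (x, t)).
case=> -[A B] /= [An [n0 _ Bn]] AB; exists (maxn n0 1).
have Bm : B (maxn n0 1) by apply: Bn => /=; rewrite leq_maxl.
near=> x; have xA : A x by near: x.
have h := AB (x, maxn n0 1) (conj xA Bm).
split; first by rewrite leq_max orbT.
move=> s t s01 t01 st.
by have [_ /(_ t st)] := h s s01.
Unshelve. all: by end_near. Qed.

Lemma rot_cvg (T : Type) (G : set_system T) {GF : Filter G} (x y : T -> R * R) (a b : R * R) :
  x @ G --> a -> y @ G --> b -> 0 < dotp a b ->
  rot (x t) (y t) @[t --> G] --> rot a b.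
Proof.
move=> xa yb ab; rewrite /rot.
apply: (@cvg_comp _ _ _ (fun t => crsp (x t) (y t) / dotp (x t) (y t)) atan _
  (nbhs (crsp a b / dotp a b))); last exact: continuous_atan.
rewrite /crsp /dotp.
pose proof (cvg_proj1 xa) as x1; pose proof (cvg_proj2 xa) as x2.
pose proof (cvg_proj1 yb) as y1; pose proof (cvg_proj2 yb) as y2.
apply: cvgM; first by apply: cvgB; apply: cvgM.
apply: cvgV; first by rewrite gt_eqF.
by apply: cvgD; apply: cvgM.
Qed.

Lemma cvg_sum_nat (T : Type) (G : set_system T) {GF : Filter G} m n (f : nat -> T -> R) l :
  (forall i, (m <= i < n)%N -> f i @ G --> (l i : R)) ->
  \sum_(m <= i < n) f i t @[t --> G] --> \sum_(m <= i < n) l i.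
Proof.
have [mn|nm] := leqP m n; last first.
  move=> _; under eq_fun do rewrite big_geq ?(ltnW nm) //.
  by rewrite big_geq ?(ltnW nm) //; exact: cvg_cst.
elim: n mn => [|n IH] mn fl.
  move: mn; rewrite leqn0 => /eqP ->.
  by under eq_fun do rewrite big_geq //; rewrite big_geq //; exact: cvg_cst.
move: mn; rewrite leq_eqVlt => /predU1P[->|mn].
  by under eq_fun do rewrite big_geq //; rewrite big_geq //; exact: cvg_cst.
under eq_fun do rewrite big_nat_recr //=; rewrite big_nat_recr //=.
apply: cvgD; last by apply: fl; rewrite leqnn andbT.
by apply: IH => // i /andP[mi iN]; apply: fl; rewrite mi leqW.
Qed.

Lemma turning_continuous (X : topologicalType) (x0 : X) (c : X -> R -> R * R) :
  (forall t, 0 <= t <= 1 -> c x0 t != 0) ->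
  (forall t, 0 <= t <= 1 -> {for (x0, t), continuous (fun p : X * R => c p.1 p.2)}) ->
  {for x0, continuous (fun x => turning (c x))}.
Proof.
move=> c0 cc; have [N nN] := near_fine c0 cc.
rewrite /prop_for /continuous_at (turningE (nbhs_singleton nN)).
have e : {near x0, (fun x => turning (c x)) =1 (fun x => psum (c x) N)}.
  by near=> x; apply: turningE; near: x.
apply: cvg_trans; first by apply: near_eq_cvg; near=> x; symmetry; near: x; exact: e.
have [N0 hN] := nbhs_singleton nN.
have cx t : 0 <= t <= 1 -> c x t @[x --> x0] --> c x0 t.
  move=> t01.
  exact: (@cvg_comp2 _ _ _ _ (nbhs x0) (nbhs x0) (nbhs t) (nbhs (c x0 t)) _ _ _
    id (fun=> t) c cvg_id (cvg_cst t) (cc t t01)).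
apply: (@cvg_sum_nat X (nbhs x0) _ 0 N
  (fun i x => rot (c x (i%:R / N%:R)) (c x (i.+1%:R / N%:R)))
  (fun i => rot (c x0 (i%:R / N%:R)) (c x0 (i.+1%:R / N%:R)))) => i /andP[_ iN]; apply: rot_cvg.
- by apply: cx; apply: frac01 => //; exact: ltnW.
- by apply: cx; apply: frac01.
apply: hN; rewrite ?frac01 //; first exact: ltnW.
rewrite -mulrBl normrM mulrC [ `|N%:R^-1|]gtr0_norm ?invr_gt0 ?ltr0n //.
rewrite mulrCA divff ?pnatr_eq0 -?lt0n // mulr1 -natr1 opprD addNKr normrN normr1 //.
Unshelve. all: by end_near. Qed.

End Turning.

(** * The angle of a pair of points *)

Section Theta.
Context {R : realType}.
Implicit Types (k p d : R * R).

Definition shear (ka : R) (z : R * R) : R * R := (z.1 + ka * z.2, z.2).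

Record near_shear (ka M : R) (F : R * R -> R * R) : Prop := NearShear {
  ns_cont : continuous F;
  ns_inj : injective F;
  ns_bound1 : forall z, `|(F z - shear ka z).1| <= M;
  ns_bound2 : forall z, `|(F z - shear ka z).2| <= M }.

Variables (ka M : R) (F : R * R -> R * R).
Hypothesis FF : near_shear ka M F.

Definition displ z := F z - shear ka z.

(* First shear [d = p - k] for [s <= 1/2]; then, for [t = 2 s - 1], take
   [(F (k + d / t) - F k) * t], which stays nonzero by injectivity and extends
   continuously to the sheared vector at [t = 0] because the displacement is bounded.
   Division by [t = 0] is harmless: that term has coefficient [t]. *)
Definition tpath (kp : (R * R) * (R * R)) (s : R) : R * R :=
  let k := kp.1 in let d := kp.2 - kp.1 in
  let a := Num.min (2 * s) 1 in let t := Num.max (2 * s - 1) 0 in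
  (d.1 + a * ka * d.2, d.2) + t *: (displ (k + t^-1 *: d) - displ k).

Lemma shear_continuous : continuous (shear ka).
Proof.
move=> z; rewrite /shear.
have z0 : id @ z --> z by exact: cvg_id.
pose proof (cvg_proj1 z0) as z1; pose proof (cvg_proj2 z0) as z2.
apply: (@cvg_pair _ _ _ (nbhs z) (nbhs (z.1 + ka * z.2)) (nbhs z.2)
   _ _ _ (fun z => z.1 + ka * z.2) snd) => //.
by apply: cvgD => //; exact: (cvgM (cvg_cst ka) z2).
Qed.

Lemma displ_continuous : continuous displ.
Proof.
move=> z; rewrite /displ; apply: cvgB; first exact: (ns_cont FF).
exact: shear_continuous.
Qed.

Lemma displ_bound1 z : `|(displ z).1| <= M. Proof. exact: (ns_bound1 FF). Qed.
Lemma displ_bound2 z : `|(displ z).2| <= M. Proof. exact: (ns_bound2 FF). Qed.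

Lemma displ_norm z : `|displ z| <= M.
Proof. by rewrite prod_normE ge_max displ_bound1 displ_bound2. Qed.

Lemma shear_inj0 a d : (d.1 + a * ka * d.2, d.2) = 0 :> R * R -> d = 0.
Proof. by case: d => x y /= [+ y0]; rewrite y0 mulr0 addr0 => ->. Qed.

Lemma tpath_large k p s : 1 < 2 * s ->
  tpath (k, p) s = (2 * s - 1) *: (F (k + (2 * s - 1)^-1 *: (p - k)) - F k).
Proof.
move=> s1; rewrite /tpath /=.
have -> : Num.min (2 * s) 1 = 1 by apply/min_idPr; exact: ltW.
have -> : Num.max (2 * s - 1) 0 = 2 * s - 1 by apply/max_idPl; lra.
set t := 2 * s - 1; have t0 : t != 0 by rewrite /t; lra.
set q := k + t^-1 *: (p - k); rewrite mul1r /displ /shear.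
have -> : q.1 = k.1 + t^-1 * (p.1 - k.1) by [].
have -> : q.2 = k.2 + t^-1 * (p.2 - k.2) by [].
move: (F q) (F k) => [h1 h2] [g1 g2] {q}; case: k p => [k1 k2] [p1 p2] /=.
apply: (@pair_equal_spec R R _ _ _ _).2; split => /=.
  change ((p1 - k1 + ka * (p2 - k2)) + t * ((h1 - (k1 + t^-1 * (p1 - k1) + ka * (k2 + t^-1 * (p2 - k2)))) - (g1 - (k1 + ka * k2))) = t * (h1 - g1)).
  by field.
change ((p2 - k2) + t * ((h2 - (k2 + t^-1 * (p2 - k2))) - (g2 - k2)) = t * (h2 - g2)).
by field.
Qed.

Lemma tpath0 k p : tpath (k, p) 0 = p - k.
Proof.
rewrite /tpath mulr0 /=.
have -> : Num.min 0 1 = 0 :> R by apply/min_idPl; lra.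
have -> : Num.max (0 - 1) 0 = 0 :> R by apply/max_idPr; lra.
by rewrite scale0r addr0 !mul0r addr0; case: p k => [? ?] [? ?].
Qed.

Lemma tpath1 k p : tpath (k, p) 1 = F p - F k.
Proof.
rewrite tpath_large; last by lra.
have -> : 2 * 1 - 1 = 1 :> R by lra.
by rewrite invr1 !scale1r addrCA subrr addr0.
Qed.

Lemma tpath_neq0 k p s : k != p -> tpath (k, p) s != 0.
Proof.
move=> kp; apply/negP => /eqP; have [s1|s1] := ltP 1 (2 * s).
  rewrite tpath_large // => /eqP; rewrite scaler_eq0.
  have -> : (2 * s - 1 == 0) = false by apply/negbTE; lra.
  rewrite /= subr_eq0 => /eqP/(ns_inj FF)/eqP.
  rewrite -subr_eq0 addrC addKr scaler_eq0 invr_eq0.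
  have -> : (2 * s - 1 == 0) = false by apply/negbTE; lra.
  by rewrite /= subr_eq0 eq_sym (negbTE kp).
rewrite /tpath /=.
have -> : Num.max (2 * s - 1) 0 = 0 by apply/max_idPr; lra.
rewrite scale0r addr0 => h; have /eqP := @shear_inj0 _ (p - k) h.
by rewrite subr_eq0 eq_sym (negbTE kp).
Qed.

(** The case t = 0 rests on the boundedness of [displ]: the factor t sends the term to 0 whatever
    the argument of [displ] does. *)
Lemma displ_tail_continuous k p t :
  {for ((k, p), t), continuous (fun q : ((R * R) * (R * R)) * R =>
     q.2 *: (displ (q.1.1 + q.2^-1 *: (q.1.2 - q.1.1)) - displ q.1.1))}.
Proof.
have q0 : (fun q : ((R * R) * (R * R)) * R => q.1) @ ((k, p), t) --> (k, p).
  exact: cvg_fst.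
have qt : (fun q : ((R * R) * (R * R)) * R => q.2) @ ((k, p), t) --> t.
  exact: cvg_snd.
have qk : (fun q : ((R * R) * (R * R)) * R => q.1.1) @ ((k, p), t) --> k.
  exact: (cvg_proj1 q0).
have qp : (fun q : ((R * R) * (R * R)) * R => q.1.2) @ ((k, p), t) --> p.
  exact: (cvg_proj2 q0).
have [->|t0] := eqVneq t 0; last first.
  apply: cvgZ => //; apply: cvgB; last exact: (@cvg_app _ _ displ _ _ _ (fun q : ((R * R) * (R * R)) * R => q.1.1) _ (@displ_continuous k) qk).
  apply: (@cvg_comp _ _ _ (fun q : ((R * R) * (R * R)) * R =>
      q.1.1 + q.2^-1 *: (q.1.2 - q.1.1)) displ _ (nbhs (k + t^-1 *: (p - k)))).
    by apply: cvgD => //; apply: cvgZ; [apply: cvgV|apply: cvgB].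
  exact: displ_continuous.
rewrite /prop_for /continuous_at /= scale0r; apply/cvgr0Pnorm_le => e e0.
have M0 : 0 <= M by apply: le_trans (displ_norm 0).
have : \forall q \near ((k, p), 0 : R), `|q.2| * (2 * M + 1) <= e.
  have h : `|q.2| * (2 * M + 1) @[q --> ((k, p), 0 : R)] --> `|0 : R| * (2 * M + 1).
    by apply: cvgM; [apply: cvg_norm; exact: cvg_snd|exact: cvg_cst].
  rewrite normr0 mul0r in h.
  have h2 : \forall q \near ((k, p), 0 : R), `|q.2| * (2 * M + 1) < e.
    exact: (h [set r | r < e] (lt_nbhsl e0)).
  by apply: filterS h2 => q /ltW.
apply: filterS => q; apply: le_trans.
rewrite normrZ ler_wpM2l //; apply: le_trans (ler_normB _ _) _.
have := displ_norm (q.1.1 + q.2^-1 *: (q.1.2 - q.1.1)); have := displ_norm q.1.1.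
by lra.
Qed.

Lemma tpath_continuous k p s :
  {for ((k, p), s), continuous (fun q : ((R * R) * (R * R)) * R => tpath q.1 q.2)}.
Proof.
have q0 : (fun q : ((R * R) * (R * R)) * R => q.1) @ ((k, p), s) --> (k, p).
  exact: cvg_fst.
have qs : (fun q : ((R * R) * (R * R)) * R => q.2) @ ((k, p), s) --> s.
  exact: cvg_snd.
have q2s : 2 * q.2 @[q --> ((k, p), s)] --> 2 * s by exact: (cvgM (cvg_cst (2:R)) qs).
have qk : (fun q : ((R * R) * (R * R)) * R => q.1.1) @ ((k, p), s) --> k.
  exact: (cvg_proj1 q0).
have qp : (fun q : ((R * R) * (R * R)) * R => q.1.2) @ ((k, p), s) --> p.
  exact: (cvg_proj2 q0).
have qd : q.1.2 - q.1.1 @[q --> ((k, p), s)] --> p - k by exact: cvgB.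
apply: cvgD.
  apply: (@cvg_pair _ _ _ _ (nbhs ((p - k).1 + Num.min (2 * s) 1 * ka * (p - k).2))
    (nbhs (p - k).2)); last exact: cvg_proj2 qd.
  apply: cvgD; first exact: cvg_proj1 qd.
  apply: cvgM; last exact: cvg_proj2 qd.
  apply: cvgM; last exact: cvg_cst.
  by apply: cvg_minr => //; exact: cvg_cst.
set t := Num.max (2 * s - 1) 0.
apply: (@cvg_comp _ _ _ (fun q : ((R * R) * (R * R)) * R => (q.1, Num.max (2 * q.2 - 1) 0))
  _ _ (nbhs ((k, p), t)) _ _ (@displ_tail_continuous k p t)).
apply: (@cvg_pair _ _ _ _ (nbhs (k, p)) (nbhs t)) => //.
apply: cvg_maxr; last exact: cvg_cst.
by apply: cvgB => //; exact: cvg_cst.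
Qed.

Definition theta k p : R := turning (tpath (k, p)).

Lemma tpath_fine k p : k != p -> exists N, fine (tpath (k, p)) N.
Proof.
move=> kp; have [|t _|N h] := @near_fine R _ (k, p) tpath.
- by move=> t _; exact: tpath_neq0.
- exact: tpath_continuous.
by exists N; exact: nbhs_singleton h.
Qed.

Lemma theta_turns k p : k != p -> turns (p - k) (F p - F k) (theta k p).
Proof.
move=> /tpath_fine[N h]; have := turns_turning h.
by rewrite tpath0 tpath1.
Qed.

Lemma theta_continuous k p : k != p ->
  {for (k, p), continuous (fun q : (R * R) * (R * R) => theta q.1 q.2)}.
Proof.
move=> kp; have := @turning_continuous R _ (k, p) tpath
  (fun t _ => tpath_neq0 t kp) (fun t _ => @tpath_continuous k p t).
suff -> : (fun q : (R * R) * (R * R) => theta q.1 q.2) = (fun q => turning (tpath q)) by [].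
by apply/funext => -[].
Qed.

Lemma theta_cvg (T : Type) (G : set_system T) {GF : Filter G} (x y : T -> R * R) k p :
  x @ G --> k -> y @ G --> p -> k != p ->
  theta (x t) (y t) @[t --> G] --> theta k p.
Proof.
move=> xk yp kp.
exact: (@cvg_comp2 _ _ _ _ G (nbhs k) (nbhs p) (nbhs (theta k p)) _ _ _ x y
   theta xk yp (theta_continuous kp)).
Qed.

Lemma tpath_err k p s : exists a (w : R * R),
  [/\ a <= 1, 0 <= s -> 0 <= a, s <= 1 -> `|w.1| <= 2 * M,  s <= 1 -> `|w.2| <= 2 * M &
   tpath (k, p) s = ((p - k).1 + a * ka * (p - k).2 + w.1, (p - k).2 + w.2)].
Proof.
pose t := Num.max (2 * s - 1) 0.
exists (Num.min (2 * s) 1), (t *: (displ (k + t^-1 *: (p - k)) - displ k)).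
have t0 : 0 <= t by rewrite le_max lexx orbT.
have t1 : s <= 1 -> t <= 1 by move=> s1; rewrite ge_max ler01 andbT; lra.
have bd (a b : R) : `|a| <= M -> `|b| <= M -> s <= 1 -> `|t * (a - b)| <= 2 * M.
  move=> aM bM s1; rewrite normrM (ger0_norm t0).
  have h : `|a - b| <= 2 * M by apply: le_trans (ler_normB _ _) _; lra.
  by rewrite -[2 * M]mul1r ler_pM // t1.
split => //.
- by rewrite ge_min lexx orbT.
- by move=> s0; rewrite le_min ler01 andbT; lra.
- by apply: bd; exact: displ_bound1.
- by apply: bd; exact: displ_bound2.
Qed.

(** From 4 y1 y2 = (y1 + y2)^2 - (y1 - y2)^2. *)
Lemma mul_ge_near (y1 y2 m : R) : `|y1 - y2| <= 2 * m -> - m ^+ 2 <= y1 * y2.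
Proof.
move=> h; have m0 : 0 <= 2 * m := le_trans (normr_ge0 _) h.
have : (y1 - y2) ^+ 2 <= (2 * m) ^+ 2.
  by rewrite -[X in X <= _]real_normK ?num_real // ler_sqr ?nnegrE.
by have := sqr_ge0 (y1 + y2); rewrite !expr2; lra.
Qed.

Lemma mul_gt_far (x1 x2 c m : R) : 0 <= m ->
  `|x1 - c| < `|c| - m -> `|x2 - c| < `|c| - m -> m ^+ 2 < x1 * x2.
Proof.
move=> m0; wlog c0 : c x1 x2 / 0 <= c.
  move=> H h1 h2; have [c0|c0] := leP 0 c; first exact: H h1 h2.
  rewrite -mulrNN; apply: (H (- c)); first by lra.
    by rewrite -opprD !normrN.
  by rewrite -opprD !normrN.
rewrite (ger0_norm c0) !ltr_norml => /andP[a1 _] /andP[b1 _].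
have x1m : m < x1 by lra. have x2m : m < x2 by lra.
rewrite expr2; apply: le_lt_trans (ler_wpM2l m0 (ltW x2m)) _.
by rewrite ltr_pM2r //; apply: le_lt_trans x2m.
Qed.

(** The horizontal parts keep their sign and contribute more than (2 M)^2 to the product; the
    vertical parts differ by at most 4 M and contribute at least - (2 M)^2. *)
Lemma tpath_dot_far k p s t : `|ka * (p - k).2| + 4 * M < `|(p - k).1| ->
  0 <= s <= 1 -> 0 <= t <= 1 -> 0 < dotp (tpath (k, p) s) (tpath (k, p) t).
Proof.
move=> far /andP[s0 s1] /andP[t0 t1].
have M0 : 0 <= M := le_trans (normr_ge0 _) (displ_norm 0).
have [a [w [a1 /(_ s0) a0 /(_ s1) w1 /(_ s1) w2 ->]]] := tpath_err k p s.
have [b [v [b1 /(_ t0) b0 /(_ t1) v1 /(_ t1) v2 ->]]] := tpath_err k p t.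
rewrite /dotp /=; set d1 := (p - k).1 in far *; set d2 := (p - k).2 in far *.
have h1 : - (2 * M) ^+ 2 <= ((p - k).2 + w.2) * ((p - k).2 + v.2).
  apply: mul_ge_near; rewrite opprD addrACA subrr add0r.
  by apply: le_trans (ler_normB _ _) _; lra.
suff h2 : (2 * M) ^+ 2 < ((p - k).1 + a * ka * (p - k).2 + w.1) *
    ((p - k).1 + b * ka * (p - k).2 + v.1) by rewrite /= in h1 h2; lra.
have aux c (u : R * R) : 0 <= c -> c <= 1 -> `|u.1| <= 2 * M ->
    `|(p - k).1 + c * ka * (p - k).2 + u.1 - d1| < `|d1| - 2 * M.
  move=> c0 c1 u1; have -> : (p - k).1 + c * ka * (p - k).2 + u.1 - d1 = c * ka * d2 + u.1.
    by rewrite /d1 /d2; ring.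
  apply: le_lt_trans (ler_normD _ _) _; rewrite -mulrA normrM (ger0_norm c0).
  have : c * `|ka * d2| <= `|ka * d2| by rewrite ler_piMl.
  by lra.
by apply: (@mul_gt_far _ _ d1); [lra|exact: aux|exact: aux].
Qed.

Lemma theta_far k p : `|ka * (p - k).2| + 4 * M < `|(p - k).1| ->
  theta k p = rot (p - k) (F p - F k).
Proof.
move=> far; rewrite /theta turning_dot ?tpath0 ?tpath1 //.
by move=> s t; exact: tpath_dot_far.
Qed.

(** Without shear either coordinate can be the dominant one. *)
Lemma tpath_dot_far0 k p s t : ka = 0 ->
  4 * M < `|(p - k).1| \/ 4 * M < `|(p - k).2| ->
  0 <= s <= 1 -> 0 <= t <= 1 -> 0 < dotp (tpath (k, p) s) (tpath (k, p) t).
Proof.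
move=> ka0 [far|far]; first by apply: tpath_dot_far; rewrite ka0 mul0r normr0 add0r.
move=> /andP[s0 s1] /andP[t0 t1].
have M0 : 0 <= M := le_trans (normr_ge0 _) (displ_norm 0).
have [a [w [a1 /(_ s0) a0 /(_ s1) w1 /(_ s1) w2 ->]]] := tpath_err k p s.
have [b [v [b1 /(_ t0) b0 /(_ t1) v1 /(_ t1) v2 ->]]] := tpath_err k p t.
rewrite /dotp ka0 !mulr0 !mul0r !addr0.
have h1 : - (2 * M) ^+ 2 <= ((p - k).1 + w.1) * ((p - k).1 + v.1).
  apply: mul_ge_near; rewrite opprD addrACA subrr add0r.
  by apply: le_trans (ler_normB _ _) _; lra.
suff h2 : (2 * M) ^+ 2 < ((p - k).2 + w.2) * ((p - k).2 + v.2).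
  by rewrite /= in h1 h2 *; lra.
have aux (u : R) : `|u| <= 2 * M -> `|(p - k).2 + u - (p - k).2| < `|(p - k).2| - 2 * M.
  by move=> uM; rewrite addrAC subrr add0r; apply: le_lt_trans uM _; lra.
by apply: (@mul_gt_far _ _ (p - k).2); [lra|exact: aux|exact: aux].
Qed.

Lemma theta_far0 k p : ka = 0 -> 4 * M < `|(p - k).1| \/ 4 * M < `|(p - k).2| ->
  theta k p = rot (p - k) (F p - F k).
Proof.
move=> ka0 far; rewrite /theta turning_dot ?tpath0 ?tpath1 //.
by move=> s t; exact: tpath_dot_far0.
Qed.

End Theta.

(** * Gates and their winding *)

Section Gates.
Context {R : realType}.
Implicit Types (k p d u : R * R).

(** The values are multiples of 2 pi; a nonzero end value would, by the intermediate value theorem,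
    force a nonzero value of modulus at most 1. *)
Lemma cos_eq1_path (f : R -> R) :
  (forall s, 0 <= s <= 1 -> {for s, continuous f}) ->
  (forall s, 0 <= s <= 1 -> cos (f s) = 1) -> f 0 = 0 -> f 1 = 0.
Proof.
move=> fc f1 f0; apply/eqP; apply: contraT => n0.
have fc' : {within `[0, 1], continuous f}.
  by apply: continuous_in_subspaceT => s; rewrite inE /= in_itv /=; exact: fc.
have pi2 := @pi_ge2 R.
have key v : v != 0 -> `|v| <= 1 -> Num.min (f 0) (f 1) <= v <= Num.max (f 0) (f 1) -> false.
  move=> v0 v1 /(IVT ler01 fc')[c]; rewrite in_itv /= => /f1 cv fv.
  rewrite fv in cv; move: v0; rewrite (cos_eq1_small cv) ?eqxx //.
  by apply: le_lt_trans v1 _; lra.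
rewrite f0 in key; have [h|h|h] := ltgtP (f 1) 0; last by rewrite h eqxx in n0.
  apply: (key (Num.max (f 1) (-1))).
  - by rewrite lt_eqF // gt_max h /=; lra.
  - by rewrite ler_norml le_max lexx orbT ge_max /=; lra.
  - by rewrite ge_max le_max !ge_min !le_max lexx (ltW h) !orbT /=; lra.
apply: (key (Num.min (f 1) 1)).
- by rewrite gt_eqF // lt_min h /=; lra.
- by rewrite ler_norml le_min ge_min lexx orbT /= andbT; lra.
- by rewrite le_min !ge_min !le_max lexx (ltW h) !orbT /=; lra.
Qed.

Lemma cos_eq1_near (T : Type) (G : set_system T) {GF : Filter G} (f : T -> R) a :
  f @ G --> a -> cos a = 1 -> (\forall t \near G, cos (f t) = 1) ->
  \forall t \near G, f t = a.
Proof.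
move=> fa ca cf; have pi2 := @pi_ge2 R.
have /cvgr_dist_lt /(_ 1 ltr01) h : f @ G --> a by [].
near=> t; apply/esym/eqP; rewrite -subr_eq0; apply/eqP/cos_eq1_small.
  by apply: cos_eq1B => //; near: t.
have : `|a - f t| < 1 by near: t.
by lra.
Unshelve. all: by end_near. Qed.

Variables (ka M : R) (F : R * R -> R * R).
Hypothesis FF : near_shear ka M F.

Local Notation thetaF := (theta ka F).

Definition shift_inv u := forall z, F (z + u) = F z + u.

Definition clears (rho : R) u := forall p k s, 0 <= s <= 1 -> rho <= `|p - k| ->
  0 < dotp (p - k) (p + s *: u - k) /\ 0 < dotp (F p - F k) (F (p + s *: u) - F k).

(** The image of the segment has length at most (1 + |ka|) |u| + 2 M, which must stay below half of
    |F p - F k| for the angle to be acute; [F_diff_ge] costs a further 2 M and the outer factor. *)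
Definition gate_rad u : R := (1 + `|ka|) * (2 * (1 + `|ka|) * `|u| + 6 * M + 1).

Lemma norm1_le u : `|u.1| <= `|u|.
Proof. by rewrite prod_normE le_max lexx. Qed.

Lemma norm2_le u : `|u.2| <= `|u|.
Proof. by rewrite prod_normE le_max lexx orbT. Qed.

Lemma norm_le u (B : R) : `|u.1| <= B -> `|u.2| <= B -> `|u| <= B.
Proof. by move=> h1 h2; rewrite prod_normE ge_max h1. Qed.

Lemma dotp_ge d : `|d| ^+ 2 <= dotp d d.
Proof.
rewrite prod_normE /dotp -!expr2; have := sqr_ge0 d.1; have := sqr_ge0 d.2.
by rewrite /Num.max; case: ifP => _; rewrite real_normK ?num_real //; lra.
Qed.

Lemma dotp_le d u : `|dotp d u| <= 2 * `|d| * `|u|.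
Proof.
apply: le_trans (ler_normD _ _) _; rewrite !normrM.
have : `|d.1| * `|u.1| <= `|d| * `|u| by rewrite ler_pM ?norm1_le.
have : `|d.2| * `|u.2| <= `|d| * `|u| by rewrite ler_pM ?norm2_le.
by lra.
Qed.

Lemma dotp_perturb d u : 2 * `|u| < `|d| -> 0 < dotp d (d + u).
Proof.
move=> ud; have d0 : 0 < `|d| by apply: le_lt_trans ud; rewrite mulr_ge0.
have -> : dotp d (d + u) = dotp d d + dotp d u by rewrite /dotp /=; ring.
have := dotp_ge d; have := dotp_le d u; rewrite ler_norml => /andP[h _].
have : 2 * `|u| * `|d| < `|d| * `|d| by rewrite ltr_pM2r.
by rewrite expr2; lra.
Qed.

Lemma shear_norm z : `|shear ka z| <= (1 + `|ka|) * `|z|.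
Proof.
apply: norm_le => /=; last first.
  apply: le_trans (norm2_le z) _; rewrite ler_peMl //.
  by have := normr_ge0 ka; lra.
apply: le_trans (ler_normD _ _) _; rewrite normrM mulrDl mul1r.
by apply: lerD; [exact: norm1_le|rewrite ler_wpM2l ?norm2_le].
Qed.

Lemma shearK z : (z = shear (- ka) (shear ka z)).
Proof. by case: z => a b; rewrite /shear /=; congr pair; ring. Qed.

Lemma M_ge0 : 0 <= M.
Proof. exact: le_trans (normr_ge0 _) (ns_bound1 FF 0). Qed.

Lemma F_diff p k : exists2 w, `|w| <= 2 * M & F p - F k = shear ka (p - k) + w.
Proof.
exists (displ ka F p - displ ka F k).
  apply: le_trans (ler_normB _ _) _.
  by have := displ_norm FF p; have := displ_norm FF k; lra.
rewrite /displ /shear; case: p k (F p) (F k) => [a b] [c d] [e f] [g h].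
apply: (@pair_equal_spec R R _ _ _ _).2; split => /=.
  change (e - g = (a - c + ka * (b - d)) + (e - (a + ka * b) - (g - (c + ka * d)))).
  by ring.
change (f - h = (b - d) + (f - b - (h - d))); ring.
Qed.

Lemma F_diff_le p k : `|F p - F k| <= (1 + `|ka|) * `|p - k| + 2 * M.
Proof.
have [w w2 ->] := F_diff p k; apply: le_trans (ler_normD _ _) _.
by have := shear_norm (p - k); lra.
Qed.

Lemma shearN_norm z : `|shear (- ka) z| <= (1 + `|ka|) * `|z|.
Proof.
apply: norm_le => /=; last first.
  apply: le_trans (norm2_le z) _; rewrite ler_peMl //.
  by have := normr_ge0 ka; lra.
apply: le_trans (ler_normD _ _) _; rewrite normrM normrN mulrDl mul1r.
by apply: lerD; [exact: norm1_le|rewrite ler_wpM2l ?norm2_le].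
Qed.

Lemma F_diff_ge p k : `|p - k| <= (1 + `|ka|) * (`|F p - F k| + 2 * M).
Proof.
have [w w2 h] := F_diff p k; rewrite (shearK (p - k)).
have -> : shear ka (p - k) = F p - F k - w by rewrite h addrK.
apply: le_trans (shearN_norm _) _; apply: ler_wpM2l.
  by have := normr_ge0 ka; lra.
by apply: le_trans (ler_normB _ _) _; lra.
Qed.

Lemma gate_rad_clears u : clears (gate_rad u) u.
Proof.
move=> p k s /andP[s0 s1]; rewrite /gate_rad => far.
have K1 : 1 <= 1 + `|ka| by have := normr_ge0 ka; lra.
have K0 : 0 < 1 + `|ka| by lra.
have M0 := M_ge0; have u0 := normr_ge0 u.
have su : `|s *: u| <= `|u| by rewrite normrZ (ger0_norm s0) ler_piMl.
have Ku : `|u| <= (1 + `|ka|) * `|u| by rewrite ler_peMl.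
set B := 2 * (1 + `|ka|) * `|u| + 6 * M + 1 in far.
have B0 : 0 <= B by rewrite /B -mulrA; lra.
have BK : B <= (1 + `|ka|) * B by rewrite ler_peMl.
split.
  by rewrite addrAC; apply: dotp_perturb; rewrite /B -mulrA in BK far; lra.
have -> : F (p + s *: u) - F k = (F p - F k) + (F (p + s *: u) - F p).
  by rewrite [RHS]addrC addrA subrK.
apply: dotp_perturb.
have := F_diff_le (p + s *: u) p; rewrite [p + s *: u - p]addrC addKr => h1.
have h2 : (1 + `|ka|) * `|s *: u| <= (1 + `|ka|) * `|u| by rewrite ler_pM2l.
have h3 : B <= `|F p - F k| + 2 * M.
  rewrite -(ler_pM2l K0); exact: le_trans far (F_diff_ge p k).
rewrite /B -mulrA in h3; lra.
Qed.

Lemma gate_rad_gt0 u : 0 < gate_rad u.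
Proof.
have K0 : 0 < 1 + `|ka| by have := normr_ge0 ka; lra.
apply: mulr_gt0 => //; have := M_ge0.
have : 0 <= 2 * (1 + `|ka|) * `|u| by rewrite !mulr_ge0 // ltW.
by lra.
Qed.

Definition is_orbit (g : nat -> R * R) := forall m, g m.+1 = F (g m).

Definition far_gate (g : nat -> R * R) u k m := gate_rad u <= `|g m - iter m F k|.

Definition wind (g : nat -> R * R) u s n k : R :=
  \sum_(s <= m < n) (thetaF (iter m F k) (g m + u) - thetaF (iter m F k) (g m))
  + rot (g s - iter s F k) (g s + u - iter s F k)
  - rot (g n - iter n F k) (g n + u - iter n F k).

Lemma far_gate_dot g u k m : far_gate g u k m ->
  0 < dotp (g m - iter m F k) (g m + u - iter m F k).
Proof.
move=> /(gate_rad_clears (s := 1))[]; first by rewrite ler01 lexx.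
by rewrite scale1r.
Qed.

Lemma wind_cat g u s n t k : (s <= n <= t)%N ->
  wind g u s n k + wind g u n t k = wind g u s t k.
Proof.
move=> /andP[sn nt]; rewrite /wind [X in _ = X + _ - _](big_cat_nat sn nt) /=.
by ring.
Qed.

Lemma wind_nil g u s k : wind g u s s k = 0.
Proof. by rewrite /wind big_geq // add0r subrr. Qed.

(** Let the second end of the segment slide from p to p + u: the expression is continuous and a
    multiple of 2 pi throughout, and it vanishes for the degenerate segment. *)
Lemma theta_far_square p k u : shift_inv u -> gate_rad u <= `|p - k| ->
  thetaF k (p + u) - thetaF k p + rot (p - k) (p + u - k)
  - rot (F p - F k) (F p + u - F k) = 0.
Proof.
move=> uF far; have cl := gate_rad_clears _ far.
pose f s := thetaF k (p + s *: u) - thetaF k p + rot (p - k) (p + s *: u - k)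
  - rot (F p - F k) (F (p + s *: u) - F k).
have <- : f 1 = thetaF k (p + u) - thetaF k p + rot (p - k) (p + u - k)
  - rot (F p - F k) (F p + u - F k) by rewrite /f scale1r uF.
apply: cos_eq1_path; last first.
- by rewrite /f scale0r addr0 !rotxx subrr addr0 subr0.
- move=> s /cl[d1 d2]; have kp := dotp_neq0l d1.
  have kp' : k != p by rewrite eq_sym -subr_eq0.
  have kq : k != p + s *: u by rewrite eq_sym -subr_eq0 (dotp_neq0r d1).
  have t1 := turns_add (turns_rot d1) (theta_turns FF kq).
  have t2 := turns_add (theta_turns FF kp') (turns_rot d2).
  rewrite -(turns_uniq kp t1 t2); congr cos; rewrite /f /theta; ring.
move=> s /cl[d1 d2].
have kq : k != p + s *: u by rewrite eq_sym -subr_eq0 (dotp_neq0r d1).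
have qc : p + t *: u @[t --> s] --> p + s *: u.
  apply: cvgD; first exact: cvg_cst.
  by apply: cvgZr_tmp; exact: cvg_id.
have Fq : F (p + t *: u) @[t --> s] --> F (p + s *: u).
  exact: (cvg_app (ns_cont FF (x := p + s *: u)) qc).
apply: cvgB; first apply: cvgD; first apply: cvgB.
- exact: (theta_cvg FF (cvg_cst k) qc kq).
- exact: cvg_cst.
- by apply: rot_cvg => //; [exact: cvg_cst|apply: cvgB => //; exact: cvg_cst].
- by apply: rot_cvg => //; [exact: cvg_cst|apply: cvgB => //; exact: cvg_cst].
Qed.

Lemma wind_step g u s n k : is_orbit g -> shift_inv u -> (s <= n)%N ->
  far_gate g u k n -> wind g u s n.+1 k = wind g u s n k.
Proof.
move=> og uF sn /(theta_far_square uF) h.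
rewrite /wind big_nat_recr //= og; lra.
Qed.

Lemma wind_far g u s n k : is_orbit g -> shift_inv u -> (s <= n)%N ->
  (forall m, (s <= m < n)%N -> far_gate g u k m) -> wind g u s n k = 0.
Proof.
move=> og uF; elim: n => [|n IH] sn h.
  by move: sn; rewrite leqn0 => /eqP ->; exact: wind_nil.
move: sn; rewrite leq_eqVlt => /predU1P[<-|sn]; first exact: wind_nil.
rewrite wind_step // ?IH //; last by apply: h; rewrite ltnSn andbT.
by move=> m /andP[sm mn]; apply: h; rewrite sm ltnW.
Qed.

Lemma orbit_neq g k s m : is_orbit g -> (s <= m)%N ->
  iter s F k != g s -> iter m F k != g m.
Proof.
move=> og; elim: m => [|m IH]; first by rewrite leqn0 => /eqP ->.
rewrite leq_eqVlt => /predU1P[<- //|sm] /(IH sm).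
by rewrite og /= (inj_eq (ns_inj FF)).
Qed.

Lemma orbit_shift g u : is_orbit g -> shift_inv u -> is_orbit (fun m => g m + u).
Proof. by move=> og uF m; rewrite og uF. Qed.

Lemma far_gate_neq g u k s m : is_orbit g -> shift_inv u -> (s <= m)%N ->
  far_gate g u k s -> iter m F k != g m /\ iter m F k != g m + u.
Proof.
move=> og uF sm /far_gate_dot h; split.
  by apply: orbit_neq sm _ => //; rewrite eq_sym -subr_eq0 (dotp_neq0l h).
apply: (orbit_neq (orbit_shift og uF) sm).
by rewrite eq_sym -subr_eq0 (dotp_neq0r h).
Qed.

Lemma theta_sum_turns g k s n : is_orbit g -> (s <= n)%N -> iter s F k != g s ->
  turns (g s - iter s F k) (g n - iter n F k)
    (\sum_(s <= m < n) thetaF (iter m F k) (g m)).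
Proof.
move=> og; elim: n => [|n IH] sn k0.
  by move: sn k0; rewrite leqn0 => /eqP -> _; rewrite big_geq //; exact: turns_refl.
move: sn; rewrite leq_eqVlt => /predU1P[<-|sn].
  by rewrite big_geq //; exact: turns_refl.
rewrite big_nat_recr //=; apply: turns_add; first exact: IH.
rewrite og; apply: (theta_turns FF); rewrite ltnS in sn; exact: (orbit_neq og sn k0).
Qed.

(** The direction to g at time s is carried to the direction to g + u at time n in two ways, across
    the segment and then along the orbit, or in the other order. The two total angles agree modulo 2
    pi. *)
Lemma wind_dot_cos1 g u s n k : is_orbit g -> shift_inv u -> (s <= n)%N ->
  0 < dotp (g s - iter s F k) (g s + u - iter s F k) ->
  0 < dotp (g n - iter n F k) (g n + u - iter n F k) -> cos (wind g u s n k) = 1.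
Proof.
move=> og uF sn ds dn.
have n1 : iter s F k != g s by rewrite eq_sym -subr_eq0 (dotp_neq0l ds).
have n2 : iter s F k != g s + u by rewrite eq_sym -subr_eq0 (dotp_neq0r ds).
have t1 := turns_add (turns_rot ds) (theta_sum_turns (orbit_shift og uF) sn n2).
have t2 := turns_add (theta_sum_turns og sn n1) (turns_rot dn).
rewrite -(turns_uniq (dotp_neq0l ds) t1 t2); congr cos.
rewrite /wind sumrB; ring.
Qed.

Lemma wind_cos1 g u s n k : is_orbit g -> shift_inv u -> (s <= n)%N ->
  far_gate g u k s -> far_gate g u k n -> cos (wind g u s n k) = 1.
Proof.
by move=> og uF sn /far_gate_dot ds /far_gate_dot dn; exact: wind_dot_cos1.
Qed.

Lemma iter_continuous m : continuous (iter m F).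
Proof.
elim: m => [|m IH] z; first exact: cvg_id.
exact: (cvg_app (ns_cont FF (x := iter m F z)) (IH z)).
Qed.

(** The winding depends continuously on k near such a point and takes values in the multiples of 2
    pi. *)
Lemma wind_local g u s n k : is_orbit g -> shift_inv u -> (s <= n)%N ->
  far_gate g u k s -> far_gate g u k n ->
  \forall k' \near k, wind g u s n k' = wind g u s n k.
Proof.
move=> og uF sn fs fn.
have ds := far_gate_dot fs; have dn := far_gate_dot fn.
have itc m : iter m F k' @[k' --> k] --> iter m F k by exact: iter_continuous.
have dc m p : p - iter m F k' @[k' --> k] --> p - iter m F k.
  by apply: cvgB => //; exact: cvg_cst.
apply: (@cos_eq1_near _ (nbhs k) _ (fun k' => wind g u s n k') (wind g u s n k)); last 1 first.
- near=> k'; apply: wind_dot_cos1 => //; near: k'.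
    exact: (dotp_near (dc s _) (dc s _) ds).
  exact: (dotp_near (dc n _) (dc n _) dn).
- apply: cvgB; last exact: (rot_cvg (dc n _) (dc n _) dn).
  apply: cvgD; last exact: (rot_cvg (dc s _) (dc s _) ds).
  apply: (@cvg_sum_nat _ _ _ _ s n (fun m k' => thetaF (iter m F k') (g m + u) -
     thetaF (iter m F k') (g m))) => m /andP[sm _].
  have [h1 h2] := far_gate_neq og uF sm fs.
  by apply: cvgB; apply: (theta_cvg FF) => //; exact: cvg_cst.
- exact: wind_cos1.
Unshelve. all: by end_near. Qed.

End Gates.

(** * Chains and the invariant pairing of two gates *)

Section Chains.

(** The reachable points form a subset of C that is open, by applying the neighbourhood hypothesis
    at a reachable point, and closed, by applying it at a limit point. The second use reverses the
    link, which is why links of both orientations are allowed. *)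
Lemma connected_chain (X : topologicalType) (C : set X) (Q : X -> X -> Prop) b l :
  connected C -> C b -> C l ->
  (forall k, C k -> \forall k' \near k, Q k k') ->
  exists L (c : nat -> X), [/\ c 0%N = b, c L = l,
    forall i, (i <= L)%N -> C (c i) &
    forall i, (i < L)%N -> Q (c i) (c i.+1) \/ Q (c i.+1) (c i)].
Proof.
move=> Cc Cb Cl nQ.
pose reach x := exists L (c : nat -> X), [/\ c 0%N = b, c L = x,
    forall i, (i <= L)%N -> C (c i) &
    forall i, (i < L)%N -> Q (c i) (c i.+1) \/ Q (c i.+1) (c i)].
have step x y : reach x -> C y -> Q x y \/ Q y x -> reach y.
  move=> [L [c [c0 cL cC cQ]]] Cy xy.
  exists L.+1, (fun i => if (i <= L)%N then c i else y); split => //.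
  - by rewrite ltnn.
  - by move=> i _; case: ifP => // /cC.
  move=> i; rewrite ltnS => iL; rewrite iL.
  move: iL; rewrite leq_eqVlt => /predU1P[->|iL]; first by rewrite ltnn cL.
  by rewrite iL; exact: cQ.
pose B := [set x | C x /\ reach x].
suff BC : B = C by have [] : B l by rewrite BC.
apply: Cc.
- exists b; split => //; exists 0%N, (fun=> b); split => //.
- exists (interior [set x | C x -> B x]); first exact: open_interior.
  rewrite eqEsubset; split => x.
    move=> [Cx rx]; split => //; rewrite /interior /=.
    near=> y => Cy; split => //; apply: step rx Cy _; left; near: y; exact: nQ.
  by move=> [Cx /nbhs_singleton]; exact.
- exists (closure B); first exact: closed_closure.
  rewrite eqEsubset; split => x; first by move=> Bx; split; [case: Bx|exact: subset_closure].
  move=> [Cx clx]; split => //.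
  have [y [[Cy ry] xy]] := clx _ (nQ _ Cx).
  by apply: step ry Cx _; right.
Unshelve. all: by end_near. Qed.

Context {R : realType}.

Lemma abel_sum (a v : nat -> R) L :
  \sum_(0 <= i < L) a i * (v i.+1 - v i) =
  a L * v L - a 0%N * v 0%N - \sum_(0 <= i < L) (a i.+1 - a i) * v i.+1.
Proof.
elim: L => [|L IH]; first by rewrite !big_nil subr0 subrr.
by rewrite !big_nat_recr //= IH; ring.
Qed.

(* [w n i] and [w' n i] are the windings of the two gates around the [i]-th point of a
   chain on the time intervals before and after [n], [nx] and [ny] mean being close to
   the gate at time [n]. By summation by parts the pairing changes from [n] to [n + 1]
   only where both windings do. *)
Lemma pairing_invariant (w w' : nat -> nat -> R) (nx ny : nat -> nat -> Prop) L n1 T :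
  (n1 <= T)%N ->
  (forall n i, (n1 <= n <= T)%N -> (i < L)%N -> w n i != w n i.+1 -> nx n i /\ nx n i.+1) ->
  (forall n i, (n1 <= n <= T)%N -> (i < L)%N -> w' n i != w' n i.+1 -> ny n i /\ ny n i.+1) ->
  (forall n i, (n1 <= n < T)%N -> (i <= L)%N -> ~ nx n i -> w n.+1 i = w n i) ->
  (forall n i, (n1 <= n < T)%N -> (i <= L)%N -> ~ ny n i -> w' n.+1 i = w' n i) ->
  (forall n i, (n1 <= n < T)%N -> (i <= L)%N -> ny n i -> ~ nx n i /\ ~ nx n.+1 i) ->
  (forall n, (n1 <= n < T)%N -> ~ nx n 0%N /\ ~ nx n L) ->
  (forall i, (i <= L)%N -> w' T i = 0) -> w n1 L = 0 ->
  (forall i, (i <= L)%N -> ny n1 i -> w n1 i = 0) ->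
  w' n1 0%N * w n1 0%N = 0.
Proof.
move=> n1T wc wc' wt wt' dis ends w'T wL wy.
pose I n := \sum_(0 <= i < L) w' n i * (w n i.+1 - w n i).
have IT : I T = 0.
  by rewrite /I big_nat big1 // => i /andP[_ iL]; rewrite w'T ?mul0r // ltnW.
have Istep n : (n1 <= n < T)%N -> I n.+1 = I n.
  move=> nn; have nn1 : (n1 <= n <= T)%N by case/andP: nn => -> /ltnW.
  have nn2 : (n1 <= n.+1 <= T)%N by case/andP: nn => /leqW -> ->.
  pose v i := w n.+1 i - w n i.
  (* Where [w n.+1] jumps the chain is close to the first gate at time n + 1, hence by [dis] not
     close to the second at time n, and [w'] keeps its value there. *)
  have -> : I n.+1 = I n + \sum_(0 <= i < L) w' n i * (v i.+1 - v i).
    rewrite /I -big_split /=; apply: eq_big_nat => i /andP[_ iL].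
    have [h|/eqP h] := pselect (w n.+1 i = w n.+1 i.+1).
      by rewrite /v h subrr; ring.
    have [h1 h2] := wc _ _ nn2 iL h.
    have -> : w' n.+1 i = w' n i.
      by apply: wt' => // [|ny1]; [exact: ltnW|have [] := dis _ _ nn (ltnW iL) ny1].
    by rewrite /v; ring.
  (* Now the increments of [w'] appear. Where one is nonzero the chain is close to the second gate,
     so away from the first, and [v] vanishes. *)
  rewrite abel_sum; have [e0 eL] := ends _ nn.
  rewrite {1 2}/v (wt n L) // (wt n 0%N) // !subrr !mulr0 subrr sub0r.
  rewrite big_nat big1 ?oppr0 ?addr0 // => i /andP[_ iL].
  have [h|/eqP h] := pselect (w' n i = w' n i.+1); first by rewrite h subrr mul0r.
  have [h1 h2] := wc' _ _ nn1 iL h.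
  have [h3 h4] := dis _ _ nn iL h2.
  by rewrite /v wt // subrr mulr0.
have I0 : I n1 = 0.
  suff h m : (n1 <= m <= T)%N -> I m = I n1 by rewrite -(h T) ?n1T ?leqnn.
  elim: m => [|m IH]; first by rewrite leqn0 => /andP[/eqP ->].
  move=> /andP[]; rewrite leq_eqVlt => /predU1P[-> //|nm mT].
  rewrite Istep; first by apply: IH; rewrite -ltnS nm ltnW.
  by rewrite -ltnS nm mT.
(* Only the boundary term at index 0 survives: [w] vanishes at L, and by [wy] at every point where
   [w'] has just jumped. *)
rewrite /I abel_sum wL mulr0 sub0r in I0.
rewrite big_nat big1 ?subr0 in I0; first by apply/eqP; rewrite -oppr_eq0 I0.
move=> i /andP[_ iL].
have [h|/eqP h] := pselect (w' n1 i = w' n1 i.+1); first by rewrite h subrr mul0r.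
have nn : (n1 <= n1 <= T)%N by rewrite leqnn.
by have [_ h2] := wc' _ _ nn iL h; rewrite wy ?mulr0.
Qed.

Lemma near_forall_leq (X : Type) (G : set_system X) {GF : Filter G}
  (P : nat -> X -> Prop) T :
  (forall n, (n <= T)%N -> \forall x \near G, P n x) ->
  \forall x \near G, forall n, (n <= T)%N -> P n x.
Proof.
elim: T => [|T IH] h.
  by near=> x => n; rewrite leqn0 => /eqP ->; near: x; exact: h.
have h1 : \forall x \near G, forall n, (n <= T)%N -> P n x.
  by apply: IH => n nT; apply: h; exact: leqW.
have h2 := h T.+1 (leqnn _).
near=> x => n; rewrite leq_eqVlt => /predU1P[->|]; first by near: x.
by rewrite ltnS; move: n; near: x.
Unshelve. all: by end_near. Qed.

Lemma near_imp (X : Type) (G : set_system X) {GF : Filter G} (A : Prop) (B : X -> Prop) :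
  (A -> \forall x \near G, B x) -> \forall x \near G, A -> B x.
Proof.
by move=> h; have [a|a] := pselect A; [apply: filterS (h a)|near=> x].
Unshelve. all: by end_near. Qed.

Variables (ka M : R) (F : R * R -> R * R).
Hypothesis FF : near_shear ka M F.

Local Notation windF := (wind ka F).
Local Notation farF := (far_gate ka M F).
Local Notation gradF := (gate_rad ka M).
Let iterc m z := @iter_continuous R ka M F FF m z.

(* What nearby points [k'] of [k] satisfy with respect to the gate: the second and third
   clauses say that the far condition is closed. *)
Definition gate_tame g u s n k k' :=
  [/\ farF g u k s -> farF g u k n -> windF g u s n k' = windF g u s n k,
      ~ farF g u k s -> ~ farF g u k' s &
      ~ farF g u k n -> ~ farF g u k' n].

Lemma near_not_far g u n k : ~ farF g u k n ->
  \forall k' \near k, ~ farF g u k' n.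
Proof.
move=> nf; have : `|g n - iter n F k| < gradF u by rewrite ltNge; apply/negP.
move=> lt; have c : `|g n - iter n F k'| @[k' --> k] --> `|g n - iter n F k|.
  by apply: cvg_norm; apply: cvgB; [exact: cvg_cst|exact: iterc].
have h : \forall k' \near k, `|g n - iter n F k'| < gradF u.
  exact: (c [set r | r < gradF u] (lt_nbhsl lt)).
by apply: filterS h => k'; rewrite ltNge => /negP.
Qed.

Lemma near_gate_tame g u s n k : is_orbit F g -> shift_inv F u -> (s <= n)%N ->
  \forall k' \near k, gate_tame g u s n k k'.
Proof.
move=> og uF sn.
have h1 : \forall k' \near k, farF g u k s -> farF g u k n ->
    windF g u s n k' = windF g u s n k.
  apply: (@near_imp _ (nbhs k) _ _ (fun k' => farF g u k n ->
    windF g u s n k' = windF g u s n k)) => f1.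
  apply: (@near_imp _ (nbhs k) _ _ (fun k' => windF g u s n k' = windF g u s n k)) => f2.
  exact: (wind_local FF).
pose proof (near_imp (B := fun k' => ~ farF g u k' s) (@near_not_far g u s k)) as h2.
pose proof (near_imp (B := fun k' => ~ farF g u k' n) (@near_not_far g u n k)) as h3.
by near=> k'; split; [near: k'|near: k'|near: k'].
Unshelve. all: by end_near. Qed.

(** A point closer than [gate_rad] to the second gate is, one step later, within (1 + |ka|) times
    that radius plus 2 M of it. This separation then keeps it away from the first gate at both
    times. *)
Definition sep_rad u u' : R := gradF u + ((1 + `|ka|) * gradF u' + 2 * M).

(** The pairing is applied to the winding of gx on [s, n] and that of gy on [n, T], with n running
    from n1 to T: the second one is void at the end, so only the values at n1 matter. *)
Lemma gate_obstruction gx ux s gy uy T n1 L (c : nat -> R * R) :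
  is_orbit F gx -> is_orbit F gy -> shift_inv F ux -> shift_inv F uy ->
  (s <= n1 <= T)%N ->
  (forall i, (i <= L)%N -> farF gx ux (c i) s) ->
  (forall i, (i <= L)%N -> farF gy uy (c i) T) ->
  (forall i, (i < L)%N ->
    (forall n, (n1 <= n <= T)%N -> gate_tame gx ux s n (c i) (c i.+1) /\
                                   gate_tame gy uy n T (c i) (c i.+1)) \/
    (forall n, (n1 <= n <= T)%N -> gate_tame gx ux s n (c i.+1) (c i) /\
                                   gate_tame gy uy n T (c i.+1) (c i))) ->
  (forall n, (n1 <= n <= T)%N -> sep_rad ux uy <= `|gx n - gy n|) ->
  (forall n, (n1 <= n < T)%N -> farF gx ux (c 0%N) n /\ farF gx ux (c L) n) ->
  windF gx ux s n1 (c L) = 0 ->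
  (forall i, (i <= L)%N -> ~ farF gy uy (c i) n1 -> windF gx ux s n1 (c i) = 0) ->
  windF gy uy n1 T (c 0%N) * windF gx ux s n1 (c 0%N) = 0.
Proof.
move=> ox oy uxF uyF /andP[sn1 n1T] fs fT ch sep ends wL wy.
apply: (@pairing_invariant (fun n i => windF gx ux s n (c i))
  (fun n i => windF gy uy n T (c i))
  (fun n i => ~ farF gx ux (c i) n) (fun n i => ~ farF gy uy (c i) n)
  L n1 T) => //.
- move=> n i nn iL; apply: contra_neqP => /not_andP nf.
  have [/(_ n nn)[[t1 t2 t3] _]|/(_ n nn)[[t1 t2 t3] _]] := ch i iL.
    apply/esym/t1; first by apply: fs; exact: ltnW.
    by apply: contrapT => f; case: nf => nf; apply: nf => //; exact: t3.
  apply: t1; first exact: fs.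
  by apply: contrapT => f; case: nf => nf; apply: nf => //; exact: t3.
- move=> n i nn iL; apply: contra_neqP => /not_andP nf.
  have [/(_ n nn)[_ [t1 t2 t3]]|/(_ n nn)[_ [t1 t2 t3]]] := ch i iL.
    apply/esym/t1; last by apply: fT; exact: ltnW.
    by apply: contrapT => f; case: nf => nf; apply: nf => //; exact: t2.
  apply: t1; last exact: fT.
  by apply: contrapT => f; case: nf => nf; apply: nf => //; exact: t2.
- move=> n i /andP[n1n nT] iL /contrapT f.
  by apply: (wind_step FF ox uxF _ f); exact: leq_trans n1n.
- move=> n i /andP[n1n nT] iL /contrapT f.
  have h := wind_step FF oy uyF (leqnn n) f; rewrite wind_nil in h.
  by rewrite /wind -[RHS](@wind_cat _ _ _ _ _ n n.+1 T) ?leqnSn // h add0r.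
- move=> n i /andP[n1n nT] iL nf.
  have nr : `|gy n - iter n F (c i)| < gradF uy by rewrite ltNge; apply/negP.
  have K1 : 1 <= 1 + `|ka| by have := normr_ge0 ka; lra.
  have M0 := M_ge0 FF; have r0 := gate_rad_gt0 FF uy.
  have Kr : gradF uy <= (1 + `|ka|) * gradF uy by rewrite ler_peMl // ltW.
  split=> nfx; apply: nfx; rewrite /far_gate.
    have := sep n; rewrite n1n (ltnW nT) => /(_ isT); rewrite /sep_rad => h.
    have h2 := ler_distD (iter n F (c i)) (gx n) (gy n).
    by rewrite [ `|iter _ _ _ - gy n|]distrC in h2; lra.
  have := sep n.+1; rewrite leqW //= => /(_ nT); rewrite /sep_rad => h.
  have h2 := ler_distD (iter n.+1 F (c i)) (gx n.+1) (gy n.+1).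
  have h3 := F_diff_le FF (gy n) (iter n F (c i)).
  rewrite -oy in h3; change (F (iter n F (c i))) with (iter n.+1 F (c i)) in h3.
  rewrite [ `|iter _ _ _ - gy n.+1|]distrC in h2.
  have h4 : (1 + `|ka|) * `|gy n - iter n F (c i)| <= (1 + `|ka|) * gradF uy.
    by rewrite ler_wpM2l ?(ltW nr) //; lra.
  by lra.
- by move=> n nn; have [f1 f2] := ends n nn; split => nf; apply: nf.
- by move=> i iL; exact: wind_nil.
Qed.

End Chains.

(** * Rows of gates *)

Section Rows.
Context {R : realType}.
Implicit Types (x d n k : R * R).

Definition quarter x : R * R := (- x.2, x.1).

Lemma rot_quarter x d : 0 < dotp x d -> 0 < dotp (quarter x) d ->
  rot x d = rot (quarter x) d + pi / 2.
Proof.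
move=> h1 h2.
have tq : turns x (quarter x) (pi / 2).
  exists 1 => //; rewrite cos_pihalf sin_pihalf /quarter.
  by congr pair; ring.
apply: (turns_eq (dotp_neq0l h1) (turns_rot h1)).
  by rewrite addrC; exact: turns_add tq (turns_rot h2).
have := rot_bound x d; have := rot_bound (quarter x) d; have := @pi_gt0 R.
by rewrite !ltr_norml; lra.
Qed.

Lemma turns_half_plane v d d' (t : R) : 0 < dotp v d -> 0 < dotp v d' ->
  turns d d' t -> `|t| < pi -> t = rot v d' - rot v d.
Proof.
move=> h1 h2 tt tpi.
apply: (turns_eq (dotp_neq0r h1) tt).
  by rewrite addrC; exact: turns_add (turns_sym (turns_rot h1)) (turns_rot h2).
have := rot_bound v d; have := rot_bound v d'; have := @pi_gt0 R.
by move: tpi; rewrite !ltr_norml; lra.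
Qed.

Lemma rot_sum_half_plane v (p : nat -> R * R) J :
  (forall j, (j <= J)%N -> 0 < dotp v (p j)) ->
  (forall j, (j < J)%N -> 0 < dotp (p j) (p j.+1)) ->
  \sum_(0 <= j < J) rot (p j) (p j.+1) = rot v (p J) - rot v (p 0%N).
Proof.
move=> hv hp; have <- : \sum_(0 <= j < J) (rot v (p j.+1) - rot v (p j)) =
    rot v (p J) - rot v (p 0%N) by rewrite telescope_sumr.
apply: eq_big_nat => j /andP[_ jJ].
by rewrite -(@rot_add _ v (p j) (p j.+1)) ?hv ?hp //; [ring|exact: ltnW].
Qed.

Variables (ka M : R) (F : R * R -> R * R).
Hypothesis FF : near_shear ka M F.

Local Notation thetaF := (theta ka F).
Local Notation windF := (wind ka F).

Lemma theta_sum_half_plane v (p : nat -> R * R) k s e : (s <= e)%N ->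
  is_orbit F p ->
  (forall m, (s <= m <= e)%N -> 0 < dotp v (p m - iter m F k)) ->
  (forall m, (s <= m < e)%N -> `|thetaF (iter m F k) (p m)| < pi) ->
  \sum_(s <= m < e) thetaF (iter m F k) (p m) =
    rot v (p e - iter e F k) - rot v (p s - iter s F k).
Proof.
move=> se op hv ht.
rewrite -(telescope_sumr (fun m => rot v (p m - iter m F k)) se).
apply: eq_big_nat => m /andP[sm me].
have v1 : 0 < dotp v (p m - iter m F k) by apply: hv; rewrite sm ltnW.
have v2 : 0 < dotp v (p m.+1 - iter m.+1 F k) by apply: hv; rewrite leqW.
apply: turns_half_plane => //; last by apply: ht; rewrite sm.
rewrite op /=; apply: (theta_turns FF).
by rewrite eq_sym -subr_eq0 (dotp_neq0r v1).
Qed.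

(* The orbit of [k] sees the whole row on one side at time [s] and on the other at time
   [e], while the two ends stay on the left and on the right: the windings add up to a
   full turn. *)
Lemma row_wind n (p : nat -> nat -> R * R) (u : nat -> R * R) J k s e : (s <= e)%N ->
  (forall j, (j <= J)%N -> is_orbit F (p j)) ->
  (forall j m, (j < J)%N -> p j.+1 m = p j m + u j) ->
  (forall j, (j < J)%N -> far_gate ka M F (p j) (u j) k s) ->
  (forall j, (j < J)%N -> far_gate ka M F (p j) (u j) k e) ->
  (forall j, (j <= J)%N -> 0 < dotp (- n) (p j s - iter s F k)) ->
  (forall j, (j <= J)%N -> 0 < dotp n (p j e - iter e F k)) ->
  (forall m, (s <= m <= e)%N -> 0 < dotp (quarter n) (p 0%N m - iter m F k)) ->
  (forall m, (s <= m <= e)%N -> 0 < dotp (- quarter n) (p J m - iter m F k)) ->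
  (forall m, (s <= m < e)%N -> `|thetaF (iter m F k) (p 0%N m)| < pi) ->
  (forall m, (s <= m < e)%N -> `|thetaF (iter m F k) (p J m)| < pi) ->
  \sum_(0 <= j < J) windF (p j) (u j) s e k = 2 * pi.
Proof.
move=> se op pu fs fe bs be l0 lJ t0 tJ.
have -> : \sum_(0 <= j < J) windF (p j) (u j) s e k =
  \sum_(0 <= j < J) (\sum_(s <= m < e) thetaF (iter m F k) (p j.+1 m) -
                      \sum_(s <= m < e) thetaF (iter m F k) (p j m))
  + \sum_(0 <= j < J) rot (p j s - iter s F k) (p j.+1 s - iter s F k)
  - \sum_(0 <= j < J) rot (p j e - iter e F k) (p j.+1 e - iter e F k).
  rewrite -big_split -sumrB /=; apply: eq_big_nat => j /andP[_ jJ].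
  rewrite /wind /wind !pu // sumrB; congr (_ - _ + _ - _).
  by apply: eq_bigr => m _; rewrite pu.
(* Orbit angles of neighbouring gates cancel, leaving those of the two ends of the row; all other
   terms are visual angles along the row. *)
rewrite telescope_sumr //.
have ss : (s <= s <= e)%N by rewrite leqnn. have ee : (s <= e <= e)%N by rewrite leqnn andbT.
rewrite (theta_sum_half_plane se (op 0%N (leq0n _)) l0 t0).
rewrite (theta_sum_half_plane se (op J (leqnn _)) lJ tJ).
rewrite (rot_sum_half_plane (v := - n) (p := fun j => p j s - iter s F k)) //; last first.
  by move=> j jJ; rewrite pu //; exact: far_gate_dot FF _ _ _ _ (fs _ jJ).
rewrite (rot_sum_half_plane (v := n) (p := fun j => p j e - iter e F k)) //; last first.
  by move=> j jJ; rewrite pu //; exact: far_gate_dot FF _ _ _ _ (fe _ jJ).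
have qn : quarter (quarter n) = - n.
  by rewrite /quarter; case: n {bs be l0 lJ t0 tJ} => a b /=; congr pair.
have qNn : quarter (- n) = - quarter n by [].
have qNq : quarter (- quarter n) = n.
  by rewrite /quarter; case: n {bs be l0 lJ t0 tJ qn qNn} => a b /=; rewrite !opprK.
have e1 : rot n (p 0%N e - iter e F k) = rot (quarter n) (p 0%N e - iter e F k) + pi / 2.
  by apply: rot_quarter; [exact: be|exact: l0].
have e2 : rot (quarter n) (p 0%N s - iter s F k) =
    rot (- n) (p 0%N s - iter s F k) + pi / 2.
  by rewrite -qn; apply: rot_quarter; rewrite ?qn; [exact: l0|exact: bs].
have e3 : rot (- n) (p J s - iter s F k) =
    rot (- quarter n) (p J s - iter s F k) + pi / 2.
  by rewrite -qNn; apply: rot_quarter; rewrite ?qNn; [exact: bs|exact: lJ].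
have e4 : rot (- quarter n) (p J e - iter e F k) =
    rot n (p J e - iter e F k) + pi / 2.
  by rewrite -{2}qNq; apply: rot_quarter; rewrite ?qNq; [exact: lJ|exact: be].
(* Each change between perpendicular reference vectors, one at each corner, contributes pi / 2. *)
by rewrite e1 e2 e3 e4; lra.
Qed.

Lemma row_essential n (p : nat -> nat -> R * R) (u : nat -> R * R) J k s e : (s <= e)%N ->
  (forall j, (j <= J)%N -> is_orbit F (p j)) ->
  (forall j m, (j < J)%N -> p j.+1 m = p j m + u j) ->
  (forall j, (j < J)%N -> far_gate ka M F (p j) (u j) k s) ->
  (forall j, (j < J)%N -> far_gate ka M F (p j) (u j) k e) ->
  (forall j, (j <= J)%N -> 0 < dotp (- n) (p j s - iter s F k)) ->
  (forall j, (j <= J)%N -> 0 < dotp n (p j e - iter e F k)) ->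
  (forall m, (s <= m <= e)%N -> 0 < dotp (quarter n) (p 0%N m - iter m F k)) ->
  (forall m, (s <= m <= e)%N -> 0 < dotp (- quarter n) (p J m - iter m F k)) ->
  (forall m, (s <= m < e)%N -> `|thetaF (iter m F k) (p 0%N m)| < pi) ->
  (forall m, (s <= m < e)%N -> `|thetaF (iter m F k) (p J m)| < pi) ->
  exists2 j, (j < J)%N & windF (p j) (u j) s e k != 0.
Proof.
move=> se op pu fs fe bs be l0 lJ t0 tJ.
have h := row_wind se op pu fs fe bs be l0 lJ t0 tJ.
apply: contrapT => nex; have := @pi_gt0 R; move: h.
rewrite big_nat big1; first by lra.
move=> j /andP[_ jJ]; apply: contrapT => /eqP h; apply: nex; by exists j.
Qed.

(** Seen from k, the end p turns from [quarter n] through n to [- quarter n], a half turn in the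
    negative sense, while p + u goes through - n, a half turn in the positive sense; the difference
    is a full turn. *)
Lemma wind_pass n (p : nat -> R * R) u k s m1 m2 t : (s <= m1)%N -> (m1 <= m2)%N ->
  (m2 <= t)%N -> is_orbit F p -> shift_inv F u ->
  0 < dotp (p s - iter s F k) (p s + u - iter s F k) ->
  0 < dotp (p t - iter t F k) (p t + u - iter t F k) ->
  (forall m, (s <= m <= m1)%N -> 0 < dotp (quarter n) (p m - iter m F k) /\
     0 < dotp (quarter n) (p m + u - iter m F k)) ->
  (forall m, (m1 <= m <= m2)%N -> 0 < dotp n (p m - iter m F k) /\
     0 < dotp (- n) (p m + u - iter m F k)) ->
  (forall m, (m2 <= m <= t)%N -> 0 < dotp (- quarter n) (p m - iter m F k) /\
     0 < dotp (- quarter n) (p m + u - iter m F k)) ->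
  (forall m, (s <= m < t)%N -> `|thetaF (iter m F k) (p m)| < pi /\
     `|thetaF (iter m F k) (p m + u)| < pi) ->
  windF p u s t k = 2 * pi.
Proof.
move=> sm1 m12 m2t op uF ds dt hl hm hr th.
have op' := orbit_shift op uF.
have split3 (x : nat -> R) : \sum_(s <= m < t) x m =
    \sum_(s <= m < m1) x m + \sum_(m1 <= m < m2) x m + \sum_(m2 <= m < t) x m.
  by rewrite (big_cat_nat (leq_trans sm1 m12) m2t) /= (big_cat_nat sm1 m12).
have th1 m a c : (s <= a)%N -> (c <= t)%N -> (a <= m < c)%N ->
    `|thetaF (iter m F k) (p m)| < pi /\ `|thetaF (iter m F k) (p m + u)| < pi.
  by move=> sa ct /andP[am mc]; apply: th; rewrite (leq_trans sa am) (leq_trans mc ct).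
have s2 : (s <= m2)%N := leq_trans sm1 m12.
have t1 : (m1 <= t)%N := leq_trans m12 m2t.
rewrite /wind sumrB !split3.
rewrite (theta_sum_half_plane (v := quarter n) sm1 op') ?(theta_sum_half_plane (v := quarter n) sm1 op);
  try by [move=> m mm; have [] := hl m mm|move=> m mm; have [] := th1 m s m1 (leqnn _) t1 mm].
rewrite (theta_sum_half_plane (v := n) m12 op); last 2 first.
- by move=> m mm; have [] := hm m mm.
- by move=> m mm; have [] := th1 m m1 m2 sm1 m2t mm.
rewrite (theta_sum_half_plane (v := - n) m12 op'); last 2 first.
- by move=> m mm; have [] := hm m mm.
- by move=> m mm; have [] := th1 m m1 m2 sm1 m2t mm.
rewrite (theta_sum_half_plane (v := - quarter n) m2t op) ?(theta_sum_half_plane (v := - quarter n) m2t op');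
  try by [move=> m mm; have [] := hr m mm|move=> m mm; have [] := th1 m m2 t s2 (leqnn _) mm].
have [ls ls'] := hl s ltac:(by rewrite leqnn).
have [l1 l1'] := hl m1 ltac:(by rewrite leqnn sm1).
have [u1 u1'] := hm m1 ltac:(by rewrite leqnn).
have [u2 u2'] := hm m2 ltac:(by rewrite leqnn m12).
have [r2 r2'] := hr m2 ltac:(by rewrite leqnn).
have [rt rt'] := hr t ltac:(by rewrite leqnn m2t).
have qn : quarter (quarter n) = - n.
  by rewrite /quarter; case: (n) => a b /=; congr pair.
have qNn : quarter (- n) = - quarter n by [].
have qNq : quarter (- quarter n) = n.
  by rewrite /quarter; case: (n) => a b /=; rewrite !opprK.
have e1 := rot_quarter u1 l1.
have e2 : rot (- quarter n) (p m2 - iter m2 F k) = rot n (p m2 - iter m2 F k) + pi / 2.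
  by rewrite -{2}qNq; apply: rot_quarter; rewrite ?qNq.
have e3 : rot (quarter n) (p m1 + u - iter m1 F k) =
    rot (- n) (p m1 + u - iter m1 F k) + pi / 2.
  by rewrite -qn; apply: rot_quarter; rewrite ?qn.
have e4 : rot (- n) (p m2 + u - iter m2 F k) =
    rot (- quarter n) (p m2 + u - iter m2 F k) + pi / 2.
  by rewrite -qNn; apply: rot_quarter; rewrite ?qNn.
have f1 := rot_add ls ds ls'; have f2 := rot_add rt dt rt'.
by rewrite -f1 -f2 in e1 e2 e3 e4 *; lra.
Qed.

End Rows.

(** * Growth rates *)

Section Growth.
Context {R : realType}.
Variables (T : Type) (F : T -> T) (phi : T -> R) (B : R) (z0 : T).
Hypothesis phiB : forall z, `|phi (F z) - phi z| <= B.

Definition gain n z : R := phi (iter n F z) - phi z.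
Definition max_gain n : R := sup [set gain n z | z in [set: T]].
(** Since [max_gain] is subadditive, Fekete's lemma identifies this infimum with the limit of
    max_gain n / n. Written as an infimum it bounds [max_gain] from below at every n at once. *)
Definition growth : R := inf [set max_gain n.+1 / n.+1%:R | n in [set: nat]].

Lemma gain_add m n z : gain (m + n) z = gain m (iter n F z) + gain n z.
Proof. by rewrite /gain iterD; ring. Qed.

Lemma gain_norm n z : `|gain n z| <= n%:R * B.
Proof.
elim: n => [|n IH]; first by rewrite /gain subrr normr0 mul0r.
rewrite -addn1 addnC gain_add natrD mulrDl mul1r.
apply: le_trans (ler_normD _ _) _; apply: lerD => //.
exact: phiB.
Qed.

Lemma gain_set_sup n : has_sup [set gain n z | z in [set: T]].
Proof.
split; first by exists (gain n z0), z0.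
exists (n%:R * B) => _ [z _ <-].
exact: le_trans (ler_norm _) (gain_norm n z).
Qed.

Lemma gain_le_max n z : gain n z <= max_gain n.
Proof. by apply: (sup_upper_bound (gain_set_sup n)); exists z. Qed.

Lemma max_gain_attained n (e : R) : 0 < e -> exists z, max_gain n - e < gain n z.
Proof.
move=> e0; have [_ [z _ <-] h] := sup_adherent e0 (gain_set_sup n).
by exists z.
Qed.

Lemma max_gain_le n (c : R) : (forall z, gain n z <= c) -> max_gain n <= c.
Proof.
move=> h; apply: ge_sup; first by exists (gain n z0), z0.
by move=> _ [z _ <-].
Qed.

Lemma max_gain_norm n : `|max_gain n| <= n%:R * B.
Proof.
rewrite ler_norml; apply/andP; split.
  apply: le_trans (gain_le_max n z0).
  by have := gain_norm n z0; rewrite ler_norml => /andP[].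
apply: max_gain_le => z.
by have := gain_norm n z; rewrite ler_norml => /andP[].
Qed.

Lemma max_gain_add m n : max_gain (m + n) <= max_gain m + max_gain n.
Proof. by apply: max_gain_le => z; rewrite gain_add; apply: lerD; exact: gain_le_max. Qed.

Lemma max_gain_mul q n : max_gain (q * n) <= q%:R * max_gain n.
Proof.
elim: q => [|q IH].
  by rewrite mul0n mul0r; apply: max_gain_le => z; rewrite /gain subrr.
rewrite mulSn addnC; apply: le_trans (max_gain_add _ _) _.
by rewrite -[q.+1%:R]natr1 mulrDl mul1r lerD.
Qed.

Lemma growth_has_inf : has_inf [set max_gain n.+1 / n.+1%:R | n in [set: nat]].
Proof.
split; first by exists (max_gain 1 / 1), 0%N.
exists (- B) => _ [n _ <-]; rewrite ler_pdivlMr // mulNr mulrC.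
by have := max_gain_norm n.+1; rewrite ler_norml => /andP[].
Qed.

Lemma growth_le_max n : n%:R * growth <= max_gain n.
Proof.
case: n => [|n]; first by rewrite mul0r; apply: le_trans (gain_le_max 0 z0); rewrite /gain subrr.
rewrite mulrC -ler_pdivlMr //; apply: (inf_lbound (proj2 growth_has_inf)); by exists n.
Qed.

(** Cut n steps into blocks of a fixed length at which the infimum is almost attained; subadditivity
    handles the blocks and C absorbs the remainder. *)
Lemma gain_le (e : R) : 0 < e -> exists2 C, 0 <= C &
  forall n z, gain n z <= n%:R * growth + e * n%:R + C.
Proof.
move=> e0; have [_ [N _ <-] hN] := inf_adherent e0 growth_has_inf.
rewrite -/growth in hN.
have B0 : 0 <= B := le_trans (normr_ge0 _) (phiB z0).
have N0 : 0 < N.+1%:R :> R by [].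
exists (N.+1%:R * B + N.+1%:R * `|growth + e|).
  by rewrite addr_ge0 // mulr_ge0.
move=> n z; apply: le_trans (gain_le_max n z) _.
rewrite {1}(divn_eq n N.+1); set q := (n %/ N.+1)%N; set r := (n %% N.+1)%N.
have rN : r%:R <= N.+1%:R :> R by rewrite ler_nat ltnW // ltn_pmod.
apply: le_trans (max_gain_add _ _) _.
have h1 := max_gain_mul q N.+1.
have h2 : max_gain r <= N.+1%:R * B.
  apply: le_trans (ler_norm _) _; apply: le_trans (max_gain_norm r) _.
  by rewrite ler_wpM2r.
have h3 : q%:R * max_gain N.+1 <= q%:R * (N.+1%:R * (growth + e)).
  by rewrite ler_wpM2l // mulrC -ler_pdivrMr // ltW.
have nE : n%:R = q%:R * N.+1%:R + r%:R :> R by rewrite -natrM -natrD -divn_eq.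
have h4 : - (r%:R * (growth + e)) <= N.+1%:R * `|growth + e|.
  apply: le_trans (ler_norm _) _; rewrite normrN normrM ger0_norm //.
  by rewrite ler_wpM2r.
rewrite nE; lra.
Qed.

(* An orbit of largest gain over [N] steps: no piece of it can lose much, because no other
   piece gains much more than its share. *)
Lemma growth_straight (e : R) : 0 < e -> exists N0, forall N, (N0 <= N)%N ->
  exists z, forall m m', (m <= m' <= N)%N ->
  `|phi (iter m' F z) - phi (iter m F z) - (m'%:R - m%:R) * growth| <= e * N%:R.
Proof.
move=> e0; have e2 : 0 < e / 2 by lra.
have [C C0 hC] := gain_le e2.
have [N0 hN0] : exists N0 : nat, (2 * C + 1) / (e / 2) < N0%:R.
  by exists (Num.truncn ((2 * C + 1) / (e / 2))).+1; exact: truncnS_gt.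
exists N0 => N NN0.
have CN : 2 * C + 1 <= e / 2 * N%:R.
  rewrite [e / 2 * _]mulrC -ler_pdivrMr //; apply: le_trans (ltW hN0) _.
  by rewrite ler_nat.
have [z hz] := max_gain_attained N ltr01.
exists z => m m' /andP[mm' m'N].
have gl := growth_le_max N.
have e1 : gain N z = (phi (iter N F z) - phi (iter m' F z)) +
   (phi (iter m' F z) - phi (iter m F z)) + (phi (iter m F z) - phi z).
  by rewrite /gain; ring.
have d1 : phi (iter m F z) - phi z <= m%:R * growth + e / 2 * m%:R + C := hC m z.
have d2 : phi (iter m' F z) - phi (iter m F z) <=
    (m'%:R - m%:R) * growth + e / 2 * (m'%:R - m%:R) + C.
  have := hC (m' - m)%N (iter m F z).
  by rewrite /gain -iterD subnK // natrB.
have d3 : phi (iter N F z) - phi (iter m' F z) <=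
    (N%:R - m'%:R) * growth + e / 2 * (N%:R - m'%:R) + C.
  have := hC (N - m')%N (iter m' F z).
  by rewrite /gain -iterD subnK // natrB.
have m0 : 0 <= m%:R :> R by [].
have mm0 : m%:R <= m'%:R :> R by rewrite ler_nat.
have mN0 : m'%:R <= N%:R :> R by rewrite ler_nat.
have p1 : 0 <= e / 2 * m%:R by rewrite mulr_ge0 // ltW.
have p2 : 0 <= e / 2 * (m'%:R - m%:R) by rewrite mulr_ge0 ?subr_ge0 // ltW.
have p3 : 0 <= e / 2 * (N%:R - m'%:R) by rewrite mulr_ge0 ?subr_ge0 // ltW.
rewrite ler_norml; apply/andP; split; lra.
Qed.

Lemma growth_ge (c : R) : (forall e, 0 < e -> forall i, exists n z,
    (i <= n)%N /\ n%:R * (c - e) <= gain n z) -> c <= growth.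
Proof.
move=> h; apply/ler_addgt0Pr => e e0.
have e3 : 0 < e / 3 by lra.
have [C C0 hC] := gain_le e3.
have [N0 hN0] : exists N0 : nat, C / (e / 3) < N0%:R.
  by exists (Num.truncn (C / (e / 3))).+1; exact: truncnS_gt.
have [n [z [nN hz]]] := h _ e3 N0.+1.
have n0 : 0 < n%:R :> R by rewrite ltr0n (leq_trans _ nN).
have Cn : C < e / 3 * n%:R.
  rewrite mulrC -ltr_pdivrMr //; apply: lt_trans hN0 _; by rewrite ltr_nat.
have := hC n z => h1.
rewrite -(ler_pM2l n0); lra.
Qed.

End Growth.

(** * Crossing gates *)

Section Crossing.
Context {R : realType}.
Variables (ka M : R) (F : R * R -> R * R).
Hypothesis FF : near_shear ka M F.
Implicit Types (k p d u b l : R * R).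

Local Notation windF := (wind ka F).
Local Notation farF := (far_gate ka M F).
Local Notation gradF := (gate_rad ka M).
Local Notation sradF := (sep_rad ka M).

Definition orb (x0 : R * R) (m : nat) := iter m F x0.

Lemma orb_orbit x0 : is_orbit F (orb x0). Proof. by []. Qed.

(** One step of F shrinks large distances by at most a fixed factor and a constant. *)
Lemma iter_far b T (B : R) : exists B', forall l, B' <= `|l - b| ->
  forall m, (m <= T)%N -> B <= `|iter m F l - iter m F b|.
Proof.
have K1 : 1 <= 1 + `|ka| by have := normr_ge0 ka; lra.
elim: T B => [|T IH] B; first by exists B => l lb m; rewrite leqn0 => /eqP ->.
have [B1 h1] := IH (Num.max B ((1 + `|ka|) * (B + 2 * M))).
exists B1 => l /h1{}h1 m; rewrite leq_eqVlt => /predU1P[->|mT]; last first.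
  by apply: le_trans (h1 m _) => //; rewrite le_max lexx.
have h2 : (1 + `|ka|) * (B + 2 * M) <= `|iter T F l - iter T F b|.
  by apply: le_trans (h1 T _) => //; rewrite le_max lexx orbT.
have h3 := F_diff_ge FF (iter T F l) (iter T F b).
have := le_trans h2 h3; rewrite ler_pM2l /=; last by lra.
by lra.
Qed.

Lemma nat_bound (a : nat -> R) T : exists B, forall m, (m <= T)%N -> a m <= B.
Proof.
elim: T => [|T [B hB]]; first by exists (a 0%N) => m; rewrite leqn0 => /eqP ->.
exists (Num.max B (a T.+1)) => m; rewrite leq_eqVlt => /predU1P[->|/hB mB].
  by rewrite le_max lexx orbT.
by rewrite le_max mB.
Qed.

Definition unbounded (C : set (R * R)) := forall B : R, exists2 l, C l & B <= `|l|.

(** Provides the far end of a chain: a point of C whose winding around the given gate is trivial. *)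
Lemma unbounded_far_orbit (C : set (R * R)) (g : nat -> R * R) T B : unbounded C ->
  exists2 l, C l & forall m, (m <= T)%N -> B <= `|g m - iter m F l|.
Proof.
move=> uC.
have [B1 hB1] := nat_bound (fun m => `|g m - iter m F 0|) T.
have [B2 hB2] := iter_far 0 T (B1 + B).
have [l Cl lB] := uC B2; exists l => // m mT.
rewrite -[l]subr0 in lB; have h1 := hB2 l lB m mT.
have h2 := hB1 m mT; have h3 := ler_distD (g m) (iter m F l) (iter m F 0).
by rewrite [ `|iter m F l - g m|]distrC in h3; lra.
Qed.

Lemma wind_near x0 u s n k : shift_inv F u -> (s <= n)%N ->
  windF (orb x0) u s n k != 0 ->
  exists2 m, (s <= m < n)%N & `|orb x0 m - iter m F k| < gradF u.
Proof.
move=> uF sn w0; apply: contrapT => h; move/eqP: w0; apply.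
apply: (wind_far FF (orb_orbit x0)) => // m mn.
rewrite /far_gate leNgt; apply/negP => h1; apply: h; exists m => //.
Qed.

(** An orbit of C with nonzero winding at x has met x before n1, and by [top] it has not risen much
    above x since. At n1 the gate at y is higher than that, so the orbit is away from it. The
    pairing therefore forces one of the two windings at b to vanish. *)
Lemma crossing_sep (ev : R * R) (E : R) (C : set (R * R)) b x0 ux y0 uy n1 T (er : R) :
  0 < E -> (forall d, `|dotp ev d| <= E * `|d|) ->
  connected C -> C b -> unbounded C ->
  shift_inv F ux -> shift_inv F uy -> (n1 <= T)%N ->
  (forall k m, C k -> (m <= n1)%N ->
     dotp ev (orb x0 m - iter m F k) - er <= dotp ev (orb x0 n1 - iter n1 F k)) ->
  (forall k, C k -> farF (orb x0) ux k 0) ->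
  (forall k, C k -> farF (orb y0) uy k T) ->
  windF (orb x0) ux 0 n1 b != 0 -> windF (orb y0) uy n1 T b != 0 ->
  E * (gradF ux + gradF uy) + er < dotp ev (orb y0 n1 - orb x0 n1) ->
  (forall n, (n1 <= n <= T)%N -> farF (orb x0) ux b n) ->
  (forall m, (n1 <= m <= T)%N -> sradF ux uy <= `|orb x0 m - orb y0 m|) ->
  False.
Proof.
move=> E0 hE Cc Cb uC uxF uyF n1T top fx fy wx wy mg bfar sep.
have dB p q r : dotp ev (p - q) = dotp ev (p - r) - dotp ev (q - r).
  by rewrite /dotp /=; ring.
have [l Cl lfar] := unbounded_far_orbit (orb x0) T (gradF ux) uC.
pose Q k k' := forall n, (n <= T)%N -> gate_tame ka M F (orb x0) ux 0 n k k' /\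
   ((n1 <= n)%N -> gate_tame ka M F (orb y0) uy n T k k').
have [k Ck|L [c [c0 cL cC cQ]]] := @connected_chain _ C Q b l Cc Cb Cl.
  apply: (@near_forall_leq _ (nbhs k) _ (fun n k' =>
    gate_tame ka M F (orb x0) ux 0 n k k' /\
    ((n1 <= n)%N -> gate_tame ka M F (orb y0) uy n T k k'))) => n nT.
  have h1 := @near_gate_tame _ _ _ _ FF (orb x0) ux 0 n k (orb_orbit x0) uxF (leq0n _).
  have h2 := @near_gate_tame _ _ _ _ FF (orb y0) uy n T k (orb_orbit y0) uyF nT.
  by near=> k'; split; [near: k'|move=> _; near: k'].
have := @gate_obstruction R ka M F FF (orb x0) ux 0 (orb y0) uy T n1 L c
  (orb_orbit x0) (orb_orbit y0) uxF uyF.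
rewrite leq0n n1T => /(_ isT); rewrite c0 cL => h.
have /eqP : windF (orb y0) uy n1 T b * windF (orb x0) ux 0 n1 b = 0.
  apply: h.
  - by move=> i iL; apply: fx; exact: cC.
  - by move=> i iL; apply: fy; exact: cC.
  - move=> i iL; have [q|q] := cQ i iL; [left|right] => n /andP[n1n nT];
      have [q1 q2] := q n nT; split => //; exact: q2.
  - exact: sep.
  - move=> n /andP[n1n nT]; split; first by apply: bfar; rewrite n1n ltnW.
    by apply: lfar; exact: ltnW.
  - apply: (wind_far FF (orb_orbit x0)) => // m /andP[_ mn].
    by apply: lfar; exact: leq_trans (ltnW mn) n1T.
  move=> i iL nfy; apply: contrapT => /eqP w0.
  have [m /andP[_ mn1] nm] := wind_near uxF (leq0n _) w0.
  have h1 := top (c i) m (cC i iL) (ltnW mn1).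
  have h2 := hE (orb x0 m - iter m F (c i)).
  have h3 := hE (orb y0 n1 - iter n1 F (c i)).
  have h4 : E * `|orb x0 m - iter m F (c i)| <= E * gradF ux by rewrite ler_pM2l // ltW.
  have h5 : E * `|orb y0 n1 - iter n1 F (c i)| <= E * gradF uy.
    by rewrite ler_pM2l // leNgt; apply/negP => h5; apply: nfy; exact: ltW.
  rewrite (dB _ _ (iter n1 F (c i))) in mg.
  move: h2 h3; rewrite !ler_norml => /andP[h2 _] /andP[_ h3]; lra.
by rewrite mulf_eq0 (negbTE wx) (negbTE wy).
Unshelve. all: by end_near. Qed.

(** Separation has to be assumed only up to the time m1 when y meets b: from then on y is at most
    slightly above b, while x stays well above b. *)
Lemma crossing (ev : R * R) (E : R) (C : set (R * R)) b x0 ux y0 uy n1 m1 T (er : R) :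
  0 < E -> (forall d, `|dotp ev d| <= E * `|d|) ->
  connected C -> C b -> unbounded C ->
  shift_inv F ux -> shift_inv F uy -> (n1 <= m1 <= T)%N ->
  (forall k m m', C k -> (m <= m' <= T)%N ->
     dotp ev (orb x0 m - iter m F k) - er <= dotp ev (orb x0 m' - iter m' F k)) ->
  (forall k m m', C k -> (n1 <= m)%N -> (m <= m' <= T)%N ->
     dotp ev (orb y0 m' - iter m' F k) <= dotp ev (orb y0 m - iter m F k) + er) ->
  (forall k, C k -> farF (orb x0) ux k 0) ->
  (forall k, C k -> farF (orb y0) uy k T) ->
  windF (orb x0) ux 0 n1 b != 0 -> windF (orb y0) uy n1 T b != 0 ->
  E * (sradF ux uy + gradF uy) + 2 * er <= dotp ev (orb x0 n1 - iter n1 F b) ->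
  E * (gradF ux + gradF uy) + er < dotp ev (orb y0 n1 - orb x0 n1) ->
  `|orb y0 m1 - iter m1 F b| < gradF uy ->
  (forall m, (n1 <= m <= m1)%N -> sradF ux uy <= `|orb x0 m - orb y0 m|) ->
  False.
Proof.
move=> E0 hE Cc Cb uC uxF uyF /andP[n1m1 m1T] top bot fx fy wx wy la mg ym1 sep1.
have n1T : (n1 <= T)%N := leq_trans n1m1 m1T.
have dB p q r : dotp ev (p - q) = dotp ev (p - r) - dotp ev (q - r).
  by rewrite /dotp /=; ring.
have rx0 := gate_rad_gt0 FF ux; have ry0 := gate_rad_gt0 FF uy.
have sx : gradF ux <= sradF ux uy.
  rewrite /sep_rad; have M0 := M_ge0 FF; have ka0 := normr_ge0 ka.
  have K0 : 0 <= 1 + `|ka| by lra.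
  by have := mulr_ge0 K0 (ltW ry0); lra.
have er0 : 0 <= er.
  have := top b 0%N 0%N Cb; rewrite leqnn => /(_ isT); lra.
have xb m : (n1 <= m <= T)%N -> E * (sradF ux uy + gradF uy) + er <=
    dotp ev (orb x0 m - iter m F b).
  by move=> mm; have := top b n1 m Cb mm; lra.
have sep m : (n1 <= m <= T)%N -> sradF ux uy <= `|orb x0 m - orb y0 m|.
  move=> /andP[n1m mT]; have [mm1|m1m] := leqP m m1; first by apply: sep1; rewrite n1m.
  have h1 := xb m; rewrite n1m mT in h1; have {}h1 := h1 isT.
  have h2 := bot b m1 m Cb n1m1; rewrite (ltnW m1m) mT in h2; have {}h2 := h2 isT.
  have h3 := hE (orb y0 m1 - iter m1 F b).
  have h4 : E * `|orb y0 m1 - iter m1 F b| <= E * gradF uy by rewrite ler_pM2l // ltW.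
  have h5 := hE (orb x0 m - orb y0 m).
  rewrite (dB _ _ (iter m F b)) in h5.
  rewrite -(ler_pM2l E0); move: h3 h5; rewrite !ler_norml => /andP[_ h3] /andP[_ h5].
  lra.
have bfar n : (n1 <= n <= T)%N -> farF (orb x0) ux b n.
  move=> nn; rewrite /far_gate.
  have h1 := xb n nn; have h2 := hE (orb x0 n - iter n F b).
  have h3 : E * gradF ux <= E * sradF ux uy by rewrite ler_pM2l.
  have h4 : 0 <= E * gradF uy by rewrite mulr_ge0 ?ltW.
  rewrite -(ler_pM2l E0); move: h2; rewrite ler_norml => /andP[_ h2]; lra.
apply: (@crossing_sep ev E C b x0 ux y0 uy n1 T er) => //.
by move=> k m Ck mn1; apply: top => //; rewrite mn1.
Qed.

End Crossing.

(** * The Dehn twist case *)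

Section Dehn.
Context {R : realType}.

Lemma int_between (v w : R) : exists a : int, w - 1 <= v + a%:~R <= w.
Proof.
exists (Num.floor (w - v)).
have /andP[h1 h2] := floor_itv (w - v); rewrite intrD in h2.
by apply/andP; split; lra.
Qed.

(** Discrete form of the twist: D1 stands for a horizontal difference pushed at each step by K times
    the vertical difference D2. *)
Lemma drift_lower (D1 D2 : nat -> R) (K M c : R) s e : 0 <= K -> (s <= e)%N ->
  (forall m, (s <= m < e)%N -> D1 m + K * D2 m - M <= D1 m.+1) ->
  (forall m, (s <= m < e)%N -> c <= D2 m) ->
  D1 s + (e%:R - s%:R) * (K * c - M) <= D1 e.
Proof.
move=> K0; elim: e => [|e IH] se h1 h2.
  by move: se; rewrite leqn0 => /eqP ->; lra.
move: se; rewrite leq_eqVlt => /predU1P[<-|se]; first by lra.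
rewrite ltnS in se.
have {}IH : D1 s + (e%:R - s%:R) * (K * c - M) <= D1 e.
  by apply: IH => // m /andP[sm me]; [apply: h1|apply: h2]; rewrite sm ltnW.
have g1 : D1 e + K * D2 e - M <= D1 e.+1 by apply: h1; rewrite se ltnSn.
have g2 : K * c <= K * D2 e by rewrite ler_wpM2l // h2 // se ltnSn.
by rewrite -natr1; lra.
Qed.

Lemma drift_upper (D : nat -> R) (c : R) s e : (s <= e)%N ->
  (forall m, (s <= m < e)%N -> D m.+1 <= D m + c) ->
  D e <= D s + (e%:R - s%:R) * c.
Proof.
move=> se h.
have := @drift_lower (fun m => - D m) (fun=> 0) 0 c 0 s e (lexx _) se.
rewrite !mul0r => H; suff: - D s + (e%:R - s%:R) * (0 - c) <= - D e by lra.
by apply: H => // m mm; have := h m mm; lra.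
Qed.

Variables (kz : int) (M : R) (F : R * R -> R * R).
Local Notation ka := (kz%:~R : R).
Hypothesis FF : near_shear ka M F.
Implicit Types (k p d u b z : R * R).

Definition equivariant := forall z (a c : int),
  F (z + (a%:~R, c%:~R)) = F z + (a%:~R + ka * c%:~R, c%:~R).

Hypothesis Feq : equivariant.

Local Notation windF := (wind ka F).
Local Notation farF := (far_gate ka M F).
Local Notation gradF := (gate_rad ka M).
Local Notation sradF := (sep_rad ka M).

Lemma pair_add (a b c d : R) : (a, b) + (c, d) = (a + c, b + d). Proof. by []. Qed.

Lemma iter_translate z (a c : int) m :
  iter m F (z + (a%:~R, c%:~R)) = iter m F z + (a%:~R + m%:R * ka * c%:~R, c%:~R).
Proof.
elim: m => [|m IH]; first by rewrite /= !mul0r addr0.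
rewrite /= IH; have -> : a%:~R + m%:R * ka * c%:~R = (a + m%:Z * kz * c)%:~R :> R.
  by rewrite intrD !intrM.
rewrite Feq; congr (_ + _); congr pair.
rewrite intrD !intrM -[m.+1%:R]natr1; change (m%:Z%:~R : R) with (m%:R : R); ring.
Qed.

Lemma horizontal_shift (a : int) : shift_inv F (a%:~R, 0).
Proof. by move=> z; have := Feq z a 0; rewrite mulr0z mulr0 addr0. Qed.

Lemma orb_horizontal x0 (a : int) m : orb F (x0 + (a%:~R, 0)) m = orb F x0 m + (a%:~R, 0).
Proof. by rewrite /orb; have := iter_translate x0 a 0 m; rewrite mulr0z mulr0 addr0. Qed.

Lemma sgz_sqr (e : int) : (e == 1) || (e == -1) -> e%:~R * e%:~R = 1 :> R.
Proof. by move=> /orP[/eqP ->|/eqP ->]; rewrite ?mulr1 // mulrNN mulr1. Qed.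

(** The row consists of horizontal integer translates of one orbit, since horizontal vectors commute
    with F even in the presence of shear. J is so large that the two ends stay horizontally far from
    the orbit of b up to time t, where [theta_far] bounds their angles. *)
Lemma dehn_row (e : int) x0 b s t : (e == 1) || (e == -1) -> (s <= t)%N ->
  e%:~R * (orb F x0 s - iter s F b).2 <= - gradF (e%:~R, 0) ->
  gradF (e%:~R, 0) <= e%:~R * (orb F x0 t - iter t F b).2 ->
  exists a : int, windF (orb F (x0 + (a%:~R, 0))) (e%:~R, 0) s t b != 0.
Proof.
move=> e1 st bs bt; have ee := sgz_sqr e1.
set u := (e%:~R, 0) : R * R in bs bt *.
have r0 : 0 < gradF u := gate_rad_gt0 FF u.
have en1 : `|e%:~R| = 1 :> R by move: e1 => /orP[/eqP ->|/eqP ->]; rewrite ?normrN normr1.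
have [B hB] := nat_bound (fun m => `|(orb F x0 m - iter m F b).1| +
  `|ka * (orb F x0 m - iter m F b).2| + 4 * M) t.
pose J := (Num.truncn B).+1.
have BJ : B < J%:R by exact: truncnS_gt.
pose q (j : nat) : int := e * (j%:Z - J%:Z).
pose p j := orb F (x0 + ((q j)%:~R, 0)).
have qE j : (q j)%:~R = e%:~R * (j%:R - J%:R) :> R by rewrite intrM intrB.
have pE j m : p j m = orb F x0 m + ((q j)%:~R, 0) by exact: orb_horizontal.
have pd j m : p j m - iter m F b = (orb F x0 m - iter m F b) + ((q j)%:~R, 0).
  by rewrite pE addrAC.
have pd1 j m : (p j m - iter m F b).1 = (orb F x0 m - iter m F b).1 + e%:~R * (j%:R - J%:R).
  by rewrite pd /= qE.
have pd2 j m : (p j m - iter m F b).2 = (orb F x0 m - iter m F b).2.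
  by rewrite pd /= addr0.
have M0 := M_ge0 FF.
have farJ m (v : R) : (m <= t)%N -> `|v| = J%:R ->
    `|ka * (orb F x0 m - iter m F b).2| + 4 * M < `|(orb F x0 m - iter m F b).1 + v|.
  move=> mt vJ; have := hB m mt.
  have := ler_normD ((orb F x0 m - iter m F b).1 + v) (- (orb F x0 m - iter m F b).1).
  rewrite addrC addKr vJ normrN; lra.
have thpi j m : (m < t)%N -> `|e%:~R * (j%:R - J%:R) : R| = J%:R ->
    `|theta ka F (iter m F b) (p j m)| < pi.
  move=> mt vJ; rewrite (theta_far FF); last first.
    by rewrite pd1 pd2; apply: farJ => //; exact: ltnW.
  apply: lt_trans (rot_bound _ _) _; have := @pi_gt0 R; lra.
have eD m : (m <= t)%N -> `|e%:~R * (orb F x0 m - iter m F b).1| < J%:R.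
  move=> mt; rewrite normrM en1 mul1r.
  by have := hB m mt; have := normr_ge0 (ka * (orb F x0 m - iter m F b).2); lra.
have q0n : `|e%:~R * (0%:R - J%:R) : R| = J%:R.
  by rewrite normrM en1 mul1r sub0r normrN ger0_norm.
have qJn : `|e%:~R * ((2 * J)%:R - J%:R) : R| = J%:R.
  rewrite normrM en1 mul1r; have -> : (2 * J)%:R - J%:R = J%:R :> R by rewrite natrM; ring.
  by rewrite ger0_norm.
have sideN m : (m <= t)%N ->
    e%:~R * ((orb F x0 m - iter m F b).1 + e%:~R * (0%:R - J%:R)) < 0.
  move=> /eD; set v := (_ - _).1; rewrite (mulrDr _ v) mulrA ee ltr_norml => /andP[]; lra.
have sideP m : (m <= t)%N ->
    0 < e%:~R * ((orb F x0 m - iter m F b).1 + e%:~R * ((2 * J)%:R - J%:R)).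
  move=> /eD; set v := (_ - _).1; rewrite (mulrDr _ v) mulrA ee ltr_norml natrM => /andP[]; lra.
have lev (v : R) : `|v| = `|e%:~R * v| by rewrite normrM en1 mul1r.
have [||||||||||j jJ hj] := @row_essential R ka M F FF (0, e%:~R) p (fun=> u) (2 * J) b s t st.
- by move=> j _; exact: orb_orbit.
- move=> j m _; rewrite !pE -addrA; congr (_ + _); rewrite /u pair_add addr0 !qE -[j.+1%:R]natr1.
  by congr pair; ring.
- move=> j _; rewrite /far_gate; apply: le_trans (norm2_le _); rewrite pd2 lev.
  by rewrite -normrN; apply: le_trans (ler_norm _); rewrite lerNr.
- move=> j _; rewrite /far_gate; apply: le_trans (norm2_le _); rewrite pd2 lev.
  by apply: le_trans (ler_norm _).
- by move=> j _; rewrite /dotp pd2 /=; lra.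
- by move=> j _; rewrite /dotp pd2 /=; lra.
- move=> m /andP[_ mt]; rewrite /dotp pd1 /=; have := sideN m mt; lra.
- move=> m /andP[_ mt]; rewrite /dotp pd1 /=; have := sideP m mt; lra.
- by move=> m /andP[_ mt]; exact: thpi.
- by move=> m /andP[_ mt]; exact: thpi.
by exists (q j); exact: hj.
Qed.

End Dehn.

(** * Contradiction for a Dehn twist: horizontal separation of quadratic size *)

Section DehnMain.
Context {R : realType}.

Lemma near_linear (X a : R) : 0 < a -> \forall N \near \oo, X <= a * N%:R.
Proof.
move=> a0; exists (Num.truncn (X / a)).+1 => // n /= nn.
rewrite mulrC -ler_pdivrMr //; apply: ltW; apply: lt_le_trans (truncnS_gt _) _.
by rewrite ler_nat.
Qed.

Lemma near_geq (m : nat) : \forall N \near \oo, (m <= N)%N.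
Proof. by exists m. Qed.

Variables (kz : int) (M : R) (F : R * R -> R * R).
Local Notation ka := (kz%:~R : R).
Hypothesis FF : near_shear ka M F.
Hypothesis Feq : equivariant kz F.
Hypothesis kz0 : kz != 0.
Tactic Notation "lin" ne_hyp_list(H) := clear - FF H; lra.

Variable e : int.
Hypothesis e1 : (e == 1) || (e == -1).

Local Notation windF := (wind ka F).
Local Notation farF := (far_gate ka M F).
Local Notation gradF := (gate_rad ka M).
Local Notation sradF := (sep_rad ka M).

Definition height (z : R * R) : R := e%:~R * z.2.

Lemma height_norm d : `|height d| = `|d.2|.
Proof.
rewrite /height normrM.
by move: e1 => /orP[/eqP ->|/eqP ->]; rewrite ?normrN normr1 mul1r.
Qed.

Lemma heightB p q : height (p - q) = height p - height q.
Proof. by rewrite /height /=; ring. Qed.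

Lemma height_step z : `|height (F z) - height z| <= M.
Proof. by rewrite -heightB height_norm; exact: ns_bound2 FF z. Qed.

Lemma height_stepN z : `|- height (F z) - (- height z)| <= M.
Proof. by rewrite -opprD normrN height_step. Qed.

(** A vertical integer translation shears orbits horizontally but changes all heights by the same
    constant. *)
Lemma level_shift xs m0 w : exists x1 (d : R),
  (forall m, height (orb F x1 m) = height (orb F xs m) + d) /\
  w - 1 <= height (orb F x1 m0) <= w.
Proof.
have [a ha] := int_between (height (orb F xs m0)) w.
have eq m : height (orb F (xs + (0%:~R, (e * a)%:~R)) m) = height (orb F xs m) + a%:~R.
  rewrite /orb (iter_translate Feq) /height /= mulrDr intrM mulrA.
  by rewrite (sgz_sqr e1) mul1r.
by exists (xs + (0%:~R, (e * a)%:~R)), a%:~R; split => //; rewrite eq.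
Qed.

Lemma height_horizontal x0 (a : int) m :
  height (orb F (x0 + (a%:~R, 0)) m) = height (orb F x0 m).
Proof. by rewrite (orb_horizontal Feq) /height /= addr0. Qed.

Lemma twist_step p k (sg : R) : sg * (ka * e%:~R) = `|ka| -> `|sg| = 1 ->
  `|sg * (F p - F k).1 - (sg * (p - k).1 + `|ka| * height (p - k))| <= 2 * M.
Proof.
move=> sgE sg1; have [w wM ->] := F_diff FF p k.
rewrite -sgE /height.
have -> : sg * (shear ka (p - k) + w).1 -
   (sg * (p - k).1 + sg * (ka * e%:~R) * (e%:~R * (p - k).2)) =
   sg * w.1 + sg * ka * (p - k).2 * (1 - e%:~R * e%:~R) by rewrite /=; ring.
rewrite (sgz_sqr e1) subrr mulr0 addr0 normrM sg1 mul1r.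
exact: le_trans (norm1_le w) wM.
Qed.

Lemma height_diff_step p k : height (F p - F k) <= height (p - k) + 2 * M.
Proof.
rewrite !heightB; have := height_step p; have := height_step k.
by rewrite !ler_norml => /andP[h1 h2] /andP[h3 h4]; lra.
Qed.

(** The gate at x meets b early and then stays high above it for la N steps, so the twist carries it
    to the side [sg] by order N^2. The gate at y is above b, up to er, until it meets b, so before
    that it lies on the other side up to a much smaller amount. This is the separation that
    [crossing] asks for. *)
Lemma no_trapped_point_dehn z : 0 < growth F height -> 0 < growth F (fun z => - height z) ->
  (forall i, exists C b, [/\ connected C, unbounded C, C b, iter i F b = z &
    forall k m, C k -> 0 <= height (iter m F k)]) -> False.
Proof.
set h1 := growth F height; set h2 := growth F _ => h10 h20 H.
have ka0 : 0 < `|ka| by rewrite normr_gt0 intr_eq0.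
set K := `|ka| in ka0.
have ep0 : e%:~R != 0 :> R by rewrite intr_eq0; move: e1 => /orP[/eqP ->|/eqP ->].
pose sg : R := Num.sg (ka * e%:~R).
have en1 : `|e%:~R| = 1 :> R by move: e1 => /orP[/eqP ->|/eqP ->]; rewrite ?normrN normr1.
have sgE : sg * (ka * e%:~R) = K.
  by rewrite /sg -normrEsg normrM en1 mulr1.
have sg1 : `|sg| = 1 by rewrite /sg normr_sg mulf_neq0 ?intr_eq0 // -(intr_eq0 R).
have M0 := M_ge0 FF.
pose u : R * R := (e%:~R, 0); pose u' : R * R := ((- e)%:~R, 0).
have uF : shift_inv F u := horizontal_shift Feq e.
have uF' : shift_inv F u' := horizontal_shift Feq (- e).
set r := gradF u; set r' := gradF u'; set sep := sradF u u'.
have r0 : 0 < r := gate_rad_gt0 FF u; have r0' : 0 < r' := gate_rad_gt0 FF u'.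
have r0s : 0 <= sep.
  have : 0 <= (1 + K) * r' by rewrite mulr_ge0 //; lra.
  by rewrite /sep /sep_rad -/r -/r' -/K; lra.
(* In la N steps the height relative to b changes by at most h1 N / 4, so x is h1 N / 4 above b
   during the last la N steps before N. *)
pose la := h1 / (8 * (M + 1)).
have la0 : 0 < la by rewrite divr_gt0 // mulr_gt0 //; lra.
have laM : 2 * M * la <= h1 / 4.
  rewrite /la mulrA ler_pdivrMr; last by lra.
  by have : 0 <= h1 := ltW h10; lra.
(* In c N steps the descending orbit loses about (h1 + 4) N, enough to fall below height 0 from
   above x. *)
pose c := (Num.truncn ((h1 + 4) / h2)).+1.
have ch2 : h1 + 4 <= c%:R * h2.
  by rewrite -ler_pdivrMr //; apply: ltW; exact: truncnS_gt.
have c0 : 0 <= c%:R :> R by [].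
have c10 : 0 < 1 + c%:R :> R by lra.
(* The last bound keeps the horizontal error K (1 + c) et N^2 below a quarter of the twist gain K la
   h1 N^2 / 4. *)
pose et := Num.min 1 (Num.min (h1 / 8) (la * h1 / (16 * (1 + c%:R)))).
have et0 : 0 < et.
  rewrite !lt_min ltr01 /=; apply/andP; split; first by lra.
  by apply: divr_gt0; apply: mulr_gt0.
have et1 : et <= 1 by rewrite !ge_min lexx.
have et2 : et <= h1 / 8 by rewrite !ge_min lexx orbT.
have et3 : (1 + c%:R) * et <= la * h1 / 16.
  have : et <= la * h1 / (16 * (1 + c%:R)) by rewrite !ge_min lexx !orbT.
  by rewrite ler_pdivlMr ?mulr_gt0 //; lra.
pose t := et / (4 * (1 + c%:R)).
have t0 : 0 < t by rewrite divr_gt0 // mulr_gt0.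
have tE : t * (1 + c%:R) = et / 4 by rewrite /t; field; lra.
have [N1 straight1] := growth_straight (0 : R * R) height_step t0.
have [N2 straight2] := growth_straight (0 : R * R) height_stepN t0.
have [C1 C10 gain1] := gain_le (0 : R * R) height_step t0.
have [C2 C20 gain2] := gain_le (0 : R * R) height_stepN t0.
rewrite -/h1 -/h2 in straight1 straight2 gain1 gain2.
clearbody h1 h2.
pose B := K * r + 2 * M + K * h1 / 4 + 2 * M * la + c%:R * (K * r' + 2 * M).
near \oo => N.
have n1 : 1 <= N%:R :> R by rewrite -[N%:R]mul1r; near: N; exact: near_linear.
have bN1 : (N1 <= N)%N by near: N; exact: near_geq.
have bN2 : (N2 <= N)%N by near: N; exact: near_geq.
have bC1 : C1 <= et / 4 * N%:R by near: N; apply: near_linear; lin et0.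
have bC2 : C2 <= et / 4 * N%:R by near: N; apply: near_linear; lin et0.
have bf : 2 * (r + r') + 10 <= 1 * N%:R by near: N; exact: near_linear.
have bl : r + 1 + `|height z| + sep + r' + 1 <= h1 / 4 * N%:R.
  by near: N; apply: near_linear; lra.
have bM : 2 * M <= K * h1 / 4 * N%:R.
  by near: N; apply: near_linear; rewrite divr_gt0 // mulr_gt0.
(* What is left of the quadratic gain, 1 / 4 - 1 / 16 = 3 / 16, must outweigh all terms linear in N,
   whose coefficients are collected in B. *)
have bq : B + sep + r + r' <= 3 / 16 * la * h1 * K * N%:R.
  by near: N; apply: near_linear; do 3! apply: mulr_gt0 => //; rewrite divr_gt0.
have n0 : 0 < N%:R :> R := lt_le_trans ltr01 n1.
have hn : 0 <= h1 * N%:R by rewrite mulr_ge0 // ltW.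
pose T := ((1 + c) * N)%N.
have NT : (N <= T)%N by rewrite leq_pmull.
have TE : T%:R = (1 + c%:R) * N%:R :> R by rewrite natrM natrD.
have tT : t * T%:R = et / 4 * N%:R by rewrite TE mulrA tE.
pose er : R := et * N%:R.
have er0 : 0 < er by rewrite mulr_gt0.
have er8 : er <= h1 / 8 * N%:R by rewrite ler_wpM2r // ltW.
have [xs xsP] := straight1 T (leq_trans bN1 NT).
have [ys ysP] := straight2 T (leq_trans bN2 NT).
have [C [b [Cc uC Cb bz Cpos]]] := H N.
(* Height at most - r at time 0 puts the x gate out of reach of C, which lies at height at least
   0. *)
have [x1 [dx [x1E /andP[x1a x1b]]]] := level_shift xs 0 (- r).
have up m m' k : (m <= m' <= T)%N -> height (iter m' F k) - height (iter m F k) <=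
    (m'%:R - m%:R) * h1 + er / 2.
  move=> /andP[mm mT]; have := gain1 (m' - m)%N (iter m F k).
  rewrite /gain -iterD subnK // natrB // => h.
  have h3 : t * (m'%:R - m%:R) <= t * T%:R.
    by rewrite ler_pM2l // lerBlDr; apply: ler_wpDr => //; rewrite ler_nat.
  rewrite tT in h3; rewrite /er; lin h h3 bC1.
have down m m' k : (m <= m' <= T)%N -> height (iter m F k) - height (iter m' F k) <=
    (m'%:R - m%:R) * h2 + er / 2.
  move=> /andP[mm mT]; have := gain2 (m' - m)%N (iter m F k).
  rewrite /gain -iterD subnK // natrB // => h.
  have h3 : t * (m'%:R - m%:R) <= t * T%:R.
    by rewrite ler_pM2l // lerBlDr; apply: ler_wpDr => //; rewrite ler_nat.
  rewrite tT in h3; rewrite /er; lin h h3 bC2.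
have xup m m' : (m <= m' <= T)%N ->
    `|height (orb F x1 m') - height (orb F x1 m) - (m'%:R - m%:R) * h1| <= er / 4.
  move=> mm; rewrite !x1E; have := xsP m m' mm; rewrite tT /er => h.
  have -> : height (orb F xs m') + dx - (height (orb F xs m) + dx) =
    height (orb F xs m') - height (orb F xs m) by ring.
  by rewrite /orb; lin h.
have z0 : height z <= `|height z| := ler_norm _.
have za := normr_ge0 (height z).
have xN := xup 0%N N; rewrite leq0n NT in xN; have {}xN := xN isT.
rewrite subr0 in xN.
have xNz : h1 / 2 * N%:R <= height (orb F x1 N) - height z.
  move: xN; rewrite ler_norml => /andP[xN _].
  by lin xN x1a bl er8 z0 r0s r0' hn.
have [] := @dehn_row R kz M F FF Feq e x1 b 0 N e1 (leq0n _).
- rewrite -/(height _) heightB -/u -/r; have h := Cpos b 0%N Cb; lin h x1b.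
- by rewrite -/(height _) heightB bz -/u -/r; lin xNz bl z0 r0s r0' hn za.
move=> ax; set x0 := x1 + _; rewrite -/u => wx.
have x0E m : height (orb F x0 m) = height (orb F x1 m) by exact: height_horizontal.
have [y1 [dy [y1E /andP[y1a y1b]]]] := level_shift ys N (height (orb F x1 N) + r + r' + er + 2).
have ydn m m' : (m <= m' <= T)%N ->
    `|height (orb F y1 m) - height (orb F y1 m') - (m'%:R - m%:R) * h2| <= er / 4.
  move=> mm; rewrite !y1E; have := ysP m m' mm; rewrite tT /er => h.
  have -> : height (orb F ys m) + dy - (height (orb F ys m') + dy) =
    - height (orb F ys m') - - height (orb F ys m) by ring.
  by rewrite /orb; lin h.
have yT : height (orb F y1 T) <= - r'.
  have := ydn N T; rewrite NT leqnn TE => /(_ isT); rewrite ler_norml => /andP[h _].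
  move: xN; rewrite ler_norml => /andP[_ xN].
  have h3 : N%:R * (h1 + 4) <= N%:R * (c%:R * h2) by rewrite ler_pM2l.
  have h4 : er <= N%:R by rewrite /er ler_piMl // ltW.
  lin h xN h3 h4 y1b x1b bf r0 r0' n0.
have en1' : (- e == 1) || (- e == -1).
  by move: e1 => /orP[/eqP ->|/eqP ->].
have hN d : (- e)%:~R * d.2 = - height d by rewrite /height mulrNz mulNr.
(* With the opposite orientation the descent of y past b becomes a climb. *)
have [] := @dehn_row R kz M F FF Feq (- e) y1 b N T en1' NT.
- rewrite hN heightB bz -/u' -/r'; lin y1a xNz r0 er0 hn bl r0s z0 za.
- rewrite hN heightB -/u' -/r'; have h := Cpos b T Cb; lin h yT.
move=> ay; set y0 := y1 + _; rewrite -/u' => wy.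
have y0E m : height (orb F y0 m) = height (orb F y1 m) by exact: height_horizontal.
have [m0 /andP[_ m0N] xm0] := wind_near FF uF (leq0n _) wx.
have [m1 /andP[Nm1 m1T] ym1] := wind_near FF uF' NT wy.
have evE d : dotp (0, e%:~R) d = height d by rewrite /dotp /height /= mul0r add0r.
have hle d : `|height d| <= `|d| by rewrite height_norm norm2_le.
have top k m m' : (m <= m' <= T)%N ->
    height (orb F x0 m - iter m F k) - er <= height (orb F x0 m' - iter m' F k).
  move=> mm; have := xup m m' mm; rewrite ler_norml => /andP[g1 _].
  by have g2 := up m m' k mm; rewrite !heightB !x0E; lin g1 g2 er0.
have bot k m m' : (m <= m' <= T)%N ->
    height (orb F y0 m' - iter m' F k) <= height (orb F y0 m - iter m F k) + er.
  move=> mm; have := ydn m m' mm; rewrite ler_norml => /andP[g1 _].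
  by have g2 := down m m' k mm; rewrite !heightB !y0E; lin g1 g2 er0.
have xN0 : h1 / 2 * N%:R <= height (orb F x0 N - iter N F b) by rewrite heightB x0E bz.
apply: (@crossing R ka M F FF (0, e%:~R) 1 C b x0 u y0 u' N m1 T er) => //.
- by move=> d; rewrite evE mul1r.
- by rewrite Nm1 ltnW.
- by move=> k m m' _ mm; rewrite !evE; exact: top.
- by move=> k m m' _ _ mm; rewrite !evE; exact: bot.
- move=> k Ck; rewrite /far_gate; apply: le_trans (hle _); rewrite -normrN.
  apply: le_trans (ler_norm _); rewrite heightB x0E -/r; have h := Cpos k 0%N Ck; lin h x1b.
- move=> k Ck; rewrite /far_gate; apply: le_trans (hle _); rewrite -normrN.
  apply: le_trans (ler_norm _); rewrite heightB y0E -/r'; have h := Cpos k T Ck; lin h yT.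
- rewrite evE mul1r -/sep -/r'; have h := normr_ge0 (height z); lin h xN0 bl er8 r0.
- by rewrite evE mul1r heightB x0E y0E -/r -/r'; lin y1a.
pose D1 m := sg * (orb F x0 m - iter m F b).1.
pose D2 m := height (orb F x0 m - iter m F b).
pose E1 m := sg * (orb F y0 m - iter m F b).1.
pose E2 m := height (orb F y0 m - iter m F b).
have D1s m : D1 m + K * D2 m - 2 * M <= D1 m.+1.
  have := twist_step (orb F x0 m) (iter m F b) sgE sg1.
  by rewrite ler_norml => /andP[g _]; rewrite -/K in g; rewrite /D1 /D2 /orb !iterS; lin g.
have E1s m : E1 m + K * E2 m - 2 * M <= E1 m.+1.
  have := twist_step (orb F y0 m) (iter m F b) sgE sg1.
  by rewrite ler_norml => /andP[g _]; rewrite -/K in g; rewrite /E1 /E2 /orb !iterS; lin g.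
have D2s m : D2 m.+1 <= D2 m + 2 * M by exact: height_diff_step.
have xm0' : `|D2 m0| < r := le_lt_trans (hle _) xm0.
have ym1' : `|E2 m1| < r' := le_lt_trans (hle _) ym1.
have D1m0 : - r < D1 m0.
  have h : `|D1 m0| < r by rewrite normrM sg1 mul1r; exact: le_lt_trans (norm1_le _) xm0.
  by move: h; rewrite ltr_norml => /andP[].
have E1m1 : E1 m1 < r'.
  have h : `|E1 m1| < r' by rewrite normrM sg1 mul1r; exact: le_lt_trans (norm1_le _) ym1.
  by move: h; rewrite ltr_norml => /andP[].
pose L := Num.truncn (la * N%:R).
have lan : 0 <= la * N%:R by rewrite mulr_ge0 // ltW.
have L1 : L%:R <= la * N%:R by rewrite truncn_le.
have L2 : la * N%:R - 1 <= L%:R.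
  by have h := truncnS_gt (la * N%:R); rewrite -/L -natr1 in h; lin h.
have L0 : 0 <= L%:R :> R by [].
have LM : L%:R * (2 * M) <= h1 / 4 * N%:R.
  apply: (@le_trans _ _ (la * N%:R * (2 * M))); first by rewrite ler_wpM2r // mulr_ge0.
  have -> : la * N%:R * (2 * M) = 2 * M * la * N%:R by ring.
  by rewrite ler_wpM2r // ltW.
have D2late m : (N <= m + L)%N -> (m <= N)%N -> h1 / 4 * N%:R <= D2 m.
  move=> NmL mN; have := @drift_upper R D2 (2 * M) m N mN (fun m _ => D2s m).
  have h : N%:R - m%:R <= L%:R :> R by rewrite lerBlDl -natrD ler_nat.
  have h' : (N%:R - m%:R) * (2 * M) <= L%:R * (2 * M) by rewrite ler_wpM2r // mulr_ge0.
  by rewrite /D2 in xN0 *; move=> g; lin g xN0 h' LM.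
(* The meeting with b precedes the L steps during which x is high above b. *)
have m0L : (m0 + L <= N)%N.
  rewrite leqNgt; apply/negP => h; have := D2late m0 (ltnW h) (ltnW m0N).
  move: xm0'; rewrite ltr_norml => /andP[_ g] g2; have g3 := normr_ge0 (height z).
  by rewrite /D2 in g g2; lin g g2 g3 bl r0s r0'.
have LN : (L <= N)%N := leq_trans (leq_addl _ _) m0L.
have Dm0 m : (m0 <= m <= T)%N -> - r - er <= D2 m.
  move=> mm; have g2 := top b m0 m mm; rewrite -/(D2 m0) -/(D2 m) in g2.
  by move: xm0'; rewrite ltr_norml => /andP[g _]; rewrite /D2 in g g2 *; lin g g2.
have Em1 m : (m <= m1)%N -> - r' - er <= E2 m.
  move=> mm; have := bot b m m1; rewrite mm (ltnW m1T) => /(_ isT) g2.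
  by move: ym1'; rewrite ltr_norml => /andP[g _]; rewrite /E2 in g *; lin g g2.
have K0 : 0 <= K by exact: ltW.
have s1 := @drift_lower R D1 D2 K (2 * M) (- r - er) m0 (N - L) K0.
have {}s1 : D1 m0 + ((N - L)%:R - m0%:R) * (K * (- r - er) - 2 * M) <= D1 (N - L)%N.
  apply: s1; [by rewrite leq_subRL // addnC|by move=> *; exact: D1s|].
  move=> m /andP[m0m mNL]; apply: Dm0; rewrite m0m /= (leq_trans (ltnW mNL)) //.
  exact: leq_trans (leq_subr _ _) NT.
have s2 : D1 (N - L)%N + (N%:R - (N - L)%:R) * (K * (h1 / 4 * N%:R) - 2 * M) <= D1 N.
  apply: (@drift_lower R D1 D2 K (2 * M)) => //; first exact: leq_subr.
  move=> m /andP[m0m mNL]; apply: D2late; last exact: ltnW.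
  by rewrite addnC -leq_subLR.
have s3 m : (N <= m <= m1)%N -> D1 N <= D1 m.
  move=> /andP[Nm mm1].
  have s : D1 N + (m%:R - N%:R) * (K * (h1 / 4 * N%:R) - 2 * M) <= D1 m.
    apply: (@drift_lower R D1 D2 K (2 * M)) => // j /andP[Nj jm].
    have jT : (N <= j <= T)%N.
      by rewrite Nj (leq_trans (ltnW jm)) // (leq_trans mm1) // ltnW.
    by have g := top b N j jT; rewrite /D2; lin g xN0 er8 hn.
  have p : 0 <= (m%:R - N%:R) * (K * (h1 / 4 * N%:R) - 2 * M).
    by rewrite mulr_ge0 // subr_ge0 ?ler_nat //; lin bM.
  by lin s p.
have s4 m : (N <= m <= m1)%N -> E1 m <= r' + c%:R * N%:R * (K * (r' + er) + 2 * M).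
  move=> /andP[Nm mm1].
  have s : E1 m + (m1%:R - m%:R) * (K * (- r' - er) - 2 * M) <= E1 m1.
    apply: (@drift_lower R E1 E2 K (2 * M)) => // j /andP[Nj jm].
    by apply: Em1; exact: ltnW.
  have Z0 : 0 <= K * (r' + er) + 2 * M.
    by rewrite addr_ge0 ?mulr_ge0 // addr_ge0 // ltW.
  have mc : m1%:R - m%:R <= c%:R * N%:R :> R.
    have g1 : m1%:R <= T%:R :> R by rewrite ler_nat ltnW.
    have g2 : N%:R <= m%:R :> R by rewrite ler_nat.
    by rewrite TE in g1; lin g1 g2.
  have g := ler_wpM2r Z0 mc; lin g s E1m1.
move=> m mm; have d1 := s3 m mm; have d2 := s4 m mm.
rewrite -/sep; apply: le_trans (norm1_le _).
have nm1 (d : R) : `|d| = `|sg * d| by rewrite normrM sg1 mul1r.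
rewrite nm1; apply: le_trans (ler_norm _).
have -> : sg * (orb F x0 m - orb F y0 m).1 = D1 m - E1 m by rewrite /D1 /E1 /=; ring.
rewrite natrB // in s1 s2.
have Z0 : 0 <= K * (r + er) + 2 * M.
  by rewrite addr_ge0 ?mulr_ge0 // addr_ge0 // ltW.
have a1 : (N%:R - L%:R - m0%:R) * (K * (r + er) + 2 * M) <= N%:R * (K * (r + er) + 2 * M).
  by apply: ler_wpM2r => //; have g : 0 <= m0%:R :> R by []; lin g L0.
have Kn : 0 <= K * h1 / 4 * N%:R by rewrite !mulr_ge0 // ltW.
have a2 := ler_wpM2r Kn L2.
have q0 : 0 <= K * N%:R * N%:R by rewrite !mulr_ge0 // ltW.
have a3 := ler_wpM2r q0 et3.
have a4 := ler_wpM2r (ltW n0) bq.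
have M20 : 0 <= 2 * M by rewrite mulr_ge0.
have a5 := ler_wpM2r M20 L1.
have a6 : 0 <= (N%:R - 1) * (sep + r + r').
  by apply: mulr_ge0; [rewrite subr_ge0|lin r0s r0 r0'].
rewrite /er in s1 d2 a1; rewrite /B in a4.
lin d1 d2 s1 s2 a1 a2 a3 a4 a5 a6 D1m0.
Unshelve. all: by end_near. Qed.

End DehnMain.

(** * Gates for a periodic displacement *)

Section LatticeRow.
Context {R : realType}.
Implicit Types (k p d u b z w : R * R).

Definition norm1 w : R := `|w.1| + `|w.2|.

Lemma dotp_norm1 w d : `|dotp w d| <= norm1 w * `|d|.
Proof.
rewrite /dotp /norm1 mulrDl; apply: le_trans (ler_normD _ _) _.
by rewrite !normrM; apply: lerD; rewrite ler_wpM2l ?norm1_le ?norm2_le.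
Qed.

Lemma norm1_ge0 w : 0 <= norm1 w. Proof. by rewrite addr_ge0. Qed.

Lemma dotpBr w p q : dotp w (p - q) = dotp w p - dotp w q.
Proof. by rewrite /dotp /=; ring. Qed.

Lemma dotpDr w p q : dotp w (p + q) = dotp w p + dotp w q.
Proof. by rewrite /dotp /=; ring. Qed.

Lemma dotpZr w (a : R) p : dotp w (a *: p) = a * dotp w p.
Proof.
by change (w.1 * (a * p.1) + w.2 * (a * p.2) = a * (w.1 * p.1 + w.2 * p.2)); ring.
Qed.

Lemma dotpNl w p : dotp (- w) p = - dotp w p.
Proof. by rewrite /dotp /=; ring. Qed.

Definition lattice u := exists a c : int, u = (a%:~R, c%:~R).

Variables (M : R) (F : R * R -> R * R).
Hypothesis FF : near_shear 0 M F.

Definition periodic_lift := forall z u, lattice u -> F (z + u) = F z + u.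
Hypothesis Fper : periodic_lift.

Local Notation windF := (wind 0 F).
Local Notation farF := (far_gate 0 M F).
Local Notation gradF := (gate_rad 0 M).
Local Notation sradF := (sep_rad 0 M).

Lemma lattice_shift u : lattice u -> shift_inv F u.
Proof. by move=> lu z; exact: Fper. Qed.

Lemma orb_lattice x0 u m : lattice u -> orb F (x0 + u) m = orb F x0 m + u.
Proof. by move=> lu; rewrite /orb; elim: m => //= m ->; exact: Fper. Qed.

Lemma gate_radE u : gradF u = 2 * `|u| + 6 * M + 1.
Proof. by rewrite /gate_rad normr0; ring. Qed.

Definition floor_pt (z : R * R) : R * R := ((Num.floor z.1)%:~R, (Num.floor z.2)%:~R).

Lemma floor_pt_lattice z : lattice (floor_pt z).
Proof. by exists (Num.floor z.1), (Num.floor z.2). Qed.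

Lemma latticeB u u' : lattice u -> lattice u' -> lattice (u - u').
Proof.
by move=> [a [c ->]] [a' [c' ->]]; exists (a - a'), (c - c'); rewrite !intrB.
Qed.

Lemma floor_pt_near z : `|floor_pt z - z| <= 1.
Proof.
by apply: norm_le; rewrite /floor_pt /=;
  [have /andP[] := floor_itv z.1|have /andP[] := floor_itv z.2];
  rewrite intrD ler_norml => h1 h2; apply/andP; split; lra.
Qed.

(** The row follows a line orthogonal to w, rounded to lattice points. Rounding keeps the links
    below 1 + 1 + 3 = 5, so gate radii are at most 6 M + 11, and the levels along w within 3; with
    [norm1 w <= 3] this gives 3 (6 M + 11) + 3. *)
Lemma lattice_row w x0 b s t (lev : R) :
  norm1 w <= 3 -> 0 < dotp w w -> (s <= t)%N -> 3 * (6 * M + 12) <= lev ->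
  dotp w (orb F x0 s - iter s F b) <= - lev ->
  lev <= dotp w (orb F x0 t - iter t F b) ->
  exists U u, [/\ lattice U, lattice u, `|u| <= 5, `|dotp w U| <= 3 &
    windF (orb F (x0 + U)) u s t b != 0].
Proof.
move=> w3 w0 st lev0 bs bt; have M0 := M_ge0 FF.
pose d : R * R := (w.2, - w.1).
have d3 : norm1 d <= 3 by rewrite /norm1 /= normrN addrC.
have wd0 : dotp w d = 0 by rewrite /dotp /=; ring.
have dd : dotp d d = dotp w w by rewrite /dotp /=; ring.
have dle v q : norm1 v <= 3 -> `|dotp v q| <= 3 * `|q|.
  by move=> v3; apply: le_trans (dotp_norm1 _ _) _; rewrite ler_wpM2r.
have [B hB] := nat_bound (fun m => 3 * `|orb F x0 m - iter m F b| + 12 * M + 4) t.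
pose J := (Num.truncn (B / dotp w w)).+1.
have BJ : B < J%:R * dotp w w by rewrite -ltr_pdivrMr //; exact: truncnS_gt.
pose V (j : nat) : R * R := (j%:R - J%:R) *: d.
pose U (j : nat) : R * R := floor_pt (V j).
have Ul j : lattice (U j) by exact: floor_pt_lattice.
pose p j := orb F (x0 + U j).
have pE j m : p j m = orb F x0 m + U j by exact: orb_lattice.
have pd j m v : dotp v (p j m - iter m F b) =
    dotp v (orb F x0 m - iter m F b) + dotp v (U j).
  by rewrite pE !dotpBr dotpDr; ring.
have vU j v : norm1 v <= 3 -> `|dotp v (U j) - dotp v (V j)| <= 3.
  move=> v3; rewrite -dotpBr; apply: le_trans (dle _ _ v3) _.
  by rewrite -[X in _ <= X]mulr1 ler_wpM2l // floor_pt_near.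
have wV j : dotp w (V j) = 0.
  by rewrite /V dotpZr wd0 mulr0.
have wU j : `|dotp w (U j)| <= 3 by have := vU j w w3; rewrite wV subr0.
have dV j : dotp d (V j) = (j%:R - J%:R) * dotp w w.
  by rewrite /V dotpZr dd.
pose u j := U j.+1 - U j.
have ul j : lattice (u j) by exact: latticeB.
have u5 j : `|u j| <= 5.
  have -> : u j = (U j.+1 - V j.+1) - (U j - V j) + d.
    rewrite /u (_ : V j.+1 = V j + d); last by rewrite /V -natr1 addrAC scalerDl scale1r.
    by rewrite !opprD !opprK; apply: (@pair_equal_spec R R _ _ _ _).2; split => /=; lra.
  have h1 := floor_pt_near (V j.+1); have h2 := floor_pt_near (V j).
  have h3 : `|d| <= 3.
    apply: norm_le; apply: le_trans d3; rewrite /norm1; first by rewrite lerDl.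
    by rewrite lerDr.
  apply: le_trans (ler_normD _ _) _.
  have := ler_normB (U j.+1 - V j.+1) (U j - V j); rewrite -/(U j.+1) -/(U j) in h1 h2; lra.
have gu j : gradF (u j) <= 6 * M + 11 by rewrite gate_radE; have := u5 j; lra.
have far3 j m : (3 * (6 * M + 11) <= `|dotp w (p j m - iter m F b)|) ->
    farF (p j) (u j) b m.
  move=> h; rewrite /far_gate; apply: le_trans (gu j) _.
  by have := dle w (p j m - iter m F b) w3; lra.
have farpi j m : (m <= t)%N -> J%:R * dotp w w - 3 <= `|dotp d (U j)| ->
    `|theta 0 F (iter m F b) (p j m)| < pi.
  move=> mt h; rewrite (theta_far0 FF) //.
    apply: lt_trans (rot_bound _ _) _; have := @pi_gt0 R; lra.
  have h1 := hB m mt; have h2 := pd j m d.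
  have h3 := dle d (p j m - iter m F b) d3.
  have h4 := dle d (orb F x0 m - iter m F b) d3.
  have h5 : 4 * M < `|p j m - iter m F b|.
    have h6 := ler_normB (dotp d (p j m - iter m F b)) (dotp d (orb F x0 m - iter m F b)).
    rewrite h2 addrC addKr in h6; rewrite h2 in h3; lra.
  move: h5; rewrite prod_normE lt_max => /orP[?|?]; [by left|by right].
have dU0 : dotp d (U 0%N) <= - (J%:R * dotp w w - 3).
  have := vU 0%N d d3; rewrite dV sub0r ler_norml => /andP[_ h]; lra.
have dUJ : J%:R * dotp w w - 3 <= dotp d (U (2 * J)%N).
  have := vU (2 * J)%N d d3; rewrite dV natrM ler_norml => /andP[h _]; lra.
have qw v : dotp (quarter w) v = - dotp d v by rewrite /dotp /quarter /=; ring.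
have [||||||||||j jJ hj] := @row_essential R 0 M F FF w p u (2 * J) b s t st.
- by move=> j _; exact: orb_orbit.
- by move=> j m _; rewrite !pE /u -addrA; congr (_ + _); rewrite addrC subrK.
- move=> j _; apply: far3; rewrite pd -normrN; apply: le_trans (ler_norm _).
  by have := wU j; rewrite ler_norml => /andP[_ h]; lra.
- move=> j _; apply: far3; rewrite pd; apply: le_trans (ler_norm _).
  by have := wU j; rewrite ler_norml => /andP[h _]; lra.
- move=> j _; rewrite dotpNl pd; have := wU j; rewrite ler_norml => /andP[_ h]; lra.
- move=> j _; rewrite pd; have := wU j; rewrite ler_norml => /andP[h _]; lra.
- move=> m /andP[_ mt]; rewrite qw pd; have h1 := hB m mt.
  have := dle d (orb F x0 m - iter m F b) d3; rewrite ler_norml => /andP[_ h]; lra.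
- move=> m /andP[_ mt]; rewrite dotpNl qw pd; have h1 := hB m mt.
  have := dle d (orb F x0 m - iter m F b) d3; rewrite ler_norml => /andP[h _]; lra.
- move=> m /andP[_ mt]; apply: farpi; first exact: ltnW.
  by rewrite -normrN; apply: le_trans (ler_norm _); lra.
- move=> m /andP[_ mt]; apply: farpi; first exact: ltnW.
  by apply: le_trans (ler_norm _).
by exists (U j), (u j).
Qed.

End LatticeRow.

(** * Extremal gates around orbits trapped in a half-plane, and the transverse drift of these
    orbits *)

Section LatticeGates.
Context {R : realType}.
Implicit Types (k p d u b z w : R * R).

Variables (M : R) (F : R * R -> R * R).
Hypothesis FF : near_shear 0 M F.
Hypothesis Fper : periodic_lift F.

Local Notation windF := (wind 0 F).
Local Notation farF := (far_gate 0 M F).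
Local Notation gradF := (gate_rad 0 M).
Local Notation sradF := (sep_rad 0 M).

Variables (C : set (R * R)) (vv ev qv : R * R).
Variables (h1 h2 kq la er eps1 D S S2 Q : R) (Tm : nat) (xs ys : R * R).
Local Notation e := (dotp ev).
Local Notation q := (dotp qv).
Local Notation rho := (6 * M + 11).
Hypothesis Cc : connected C.
Hypothesis uC : unbounded C.
Hypothesis free : forall k m, C k -> 0 <= dotp vv (iter m F k).
Hypothesis v3 : norm1 vv <= 3.
Hypothesis e3 : norm1 ev <= 3.
Hypothesis e0 : 0 < dotp ev ev.
Hypothesis qQ : norm1 qv <= Q.
Hypothesis top : forall k m m', (m <= m' <= Tm)%N ->
  e (iter m' F k) - e (iter m F k) <= (m'%:R - m%:R) * h1 + er.
Hypothesis bot : forall k m m', (m <= m' <= Tm)%N ->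
  e (iter m F k) - e (iter m' F k) <= (m'%:R - m%:R) * h2 + er.
Hypothesis xsP : forall m m', (m <= m' <= Tm)%N ->
  (m'%:R - m%:R) * h1 - er <= e (iter m' F xs) - e (iter m F xs).
Hypothesis ysP : forall m m', (m <= m' <= Tm)%N ->
  (m'%:R - m%:R) * h2 - er <= e (iter m F ys) - e (iter m' F ys).
(** That one rate [kq] serves here and in [expo_bot] is the purpose of the tilted transverse vector
    [qv] built in [frame_exists]. *)
Hypothesis expo_top : forall k m m', (m <= m' <= Tm)%N ->
  (m'%:R - m%:R) * h1 - 10 * la <= e (iter m' F k) - e (iter m F k) ->
  `|q (iter m' F k) - q (iter m F k) - kq * (m'%:R - m%:R)| <= eps1.
Hypothesis expo_bot : forall k m m', (m <= m' <= Tm)%N ->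
  (m'%:R - m%:R) * h2 - 10 * la <= e (iter m F k) - e (iter m' F k) ->
  `|q (iter m' F k) - q (iter m F k) - kq * (m'%:R - m%:R)| <= eps1.
Hypothesis ve : forall d, `|d| <= S2 -> `|dotp vv d - e d| <= D / 4.
Hypothesis SS2 : S + rho + 2 * M * Tm%:R <= S2.
Hypothesis er0 : 0 <= er.
Hypothesis er_la : 10 * er <= la.
Hypothesis la_big : 100 * (rho + 2 * M + 2) <= la.
Hypothesis la_D : 10 * la <= D.
Hypothesis Q0 : 0 < Q.
Hypothesis eps_big : Q * (3 * rho + 2 * M) <= eps1.

Tactic Notation "lin" ne_hyp_list(H) :=
  generalize er0 er_la la_big la_D SS2 eps_big;
  clear - FF Fper Cc uC free v3 e3 e0 qQ top bot xsP ysP expo_top expo_bot ve SS2 er0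
    er_la la_big la_D Q0 eps_big H; lra.

Definition sized k := forall m, (m <= Tm)%N -> `|iter m F k| <= S.

Definition top_block x0 := forall m m', (m <= m' <= Tm)%N ->
  (m'%:R - m%:R) * h1 - er <= e (orb F x0 m') - e (orb F x0 m).
Definition bot_block y0 := forall m m', (m <= m' <= Tm)%N ->
  (m'%:R - m%:R) * h2 - er <= e (orb F y0 m) - e (orb F y0 m').

Lemma M0 : 0 <= M. Proof. exact: M_ge0 FF. Qed.

Lemma dotp3 w d : norm1 w <= 3 -> `|dotp w d| <= 3 * `|d|.
Proof. by move=> w3; apply: le_trans (dotp_norm1 _ _) _; rewrite ler_wpM2r. Qed.

Lemma edotp d : `|e d| <= 3 * `|d|. Proof. exact: dotp3. Qed.

Lemma qdotp d : `|q d| <= Q * `|d|.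
Proof. by apply: le_trans (dotp_norm1 _ _) _; rewrite ler_wpM2r. Qed.

Lemma grad_rho u : `|u| <= 5 -> gradF u <= rho.
Proof. by move=> u5; rewrite gate_radE; lra. Qed.

Lemma srad_rho u u' : `|u| <= 5 -> `|u'| <= 5 -> sradF u u' <= 2 * rho + 2 * M.
Proof.
move=> /grad_rho h /grad_rho h'; rewrite /sep_rad normr0 addr0 mul1r; lra.
Qed.

Lemma dist_back p k m n : (m <= n)%N ->
  `|iter m F p - iter m F k| <= `|iter n F p - iter n F k| + 2 * M * (n%:R - m%:R).
Proof.
elim: n => [|n IH]; first by rewrite leqn0 => /eqP ->; rewrite subrr mulr0 addr0.
rewrite leq_eqVlt => /predU1P[->|/IH{}IH]; first by rewrite subrr mulr0 addr0.
apply: le_trans IH _; have := F_diff_ge FF (iter n F p) (iter n F k).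
by rewrite normr0 addr0 mul1r /= -[n.+1%:R]natr1; lra.
Qed.

Lemma dist_forw p k m n : (m <= n)%N ->
  `|iter n F p - iter n F k| <= `|iter m F p - iter m F k| + 2 * M * (n%:R - m%:R).
Proof.
elim: n => [|n IH]; first by rewrite leqn0 => /eqP ->; rewrite subrr mulr0 addr0.
rewrite leq_eqVlt => /predU1P[->|/IH{}IH]; first by rewrite subrr mulr0 addr0.
have := F_diff_le FF (iter n F p) (iter n F k).
by rewrite normr0 addr0 mul1r /= -[n.+1%:R]natr1; lra.
Qed.

Lemma lattice_level (x : R) : exists2 V, lattice V & `|e V - x| <= 3.
Proof.
exists (floor_pt ((x / dotp ev ev) *: ev)); first exact: floor_pt_lattice.
have := edotp (floor_pt ((x / dotp ev ev) *: ev) - (x / dotp ev ev) *: ev).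
rewrite dotpBr dotpZr mulfVK ?gt_eqF // => h.
by have g := floor_pt_near ((x / dotp ev ev) *: ev); lra.
Qed.

Lemma top_block_shift x0 U : lattice U -> top_block x0 -> top_block (x0 + U).
Proof.
move=> lU tb m m' mm; rewrite !(orb_lattice Fper) // !dotpDr.
by have := tb m m' mm; lra.
Qed.

Lemma bot_block_shift y0 U : lattice U -> bot_block y0 -> bot_block (y0 + U).
Proof.
move=> lU tb m m' mm; rewrite !(orb_lattice Fper) // !dotpDr.
by have := tb m m' mm; lra.
Qed.

Lemma free_level k m : C k -> sized k -> (m <= Tm)%N -> - (D / 4) <= e (iter m F k).
Proof.
move=> Ck sk mT; have h1' := free m Ck.
have h2' : `|iter m F k| <= S2.
  apply: le_trans (sk m mT) _; have M0' := M0.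
  have g : 0 <= M * Tm%:R by rewrite mulr_ge0.
  by lin g M0'.
by have := ve h2'; rewrite ler_norml => /andP[g1 g2]; lra.
Qed.

Lemma far_free g u k m : `|u| <= 5 -> C k -> dotp vv (g m) <= - (3 * rho) ->
  farF g u k m.
Proof.
move=> u5 Ck h; rewrite /far_gate; apply: le_trans (grad_rho u5) _.
have := dotp3 (g m - iter m F k) v3; rewrite dotpBr ler_norml => /andP[g1 _].
by have g2 := free m Ck; lra.
Qed.

(** A translate of the climbing orbit ending just above k at time n was far below k at time 0, so a
    row of its translates winds around k. The gate found has passed near k, which bounds its size at
    time 0; hence its low level along [ev] is also low along [vv], and it starts out of reach of
    C. *)
Lemma up_gate k n l : C k -> sized k -> (n <= Tm)%N -> 3 * (6 * M + 12) <= l ->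
  e (iter n F k) + l + 12 <= n%:R * h1 - D ->
  exists x0 u, [/\ [/\ lattice u, `|u| <= 5 & top_block x0], windF (orb F x0) u 0 n k != 0,
    (exists2 m0, (m0 < n)%N & `|orb F x0 m0 - iter m0 F k| < rho),
    l <= e (orb F x0 n - iter n F k) <= l + 12 &
    forall k', C k' -> farF (orb F x0) u k' 0].
Proof.
move=> Ck sk nT hl hn; have M0' := M0.
(* The offset 6 absorbs two roundings of size 3, here and in the choice of a gate of the row. *)
have [V lV hV] := lattice_level (e (iter n F k) + l + 6 - e (orb F xs n)).
have tb1 : top_block (xs + V) by apply: top_block_shift => // m m'; exact: xsP.
have x1n : e (orb F (xs + V) n) = e (orb F xs n) + e V.
  by rewrite (orb_lattice Fper) // dotpDr.
move: hV; rewrite ler_norml => /andP[V1 V2].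
have x10 := tb1 0%N n; rewrite leq0n nT subr0 in x10; have {}x10 := x10 isT.
have k0 := free_level Ck sk (leq0n _).
have [||U [u [lU lu u5 eU w0]]] := @lattice_row R M F FF Fper ev (xs + V) k 0 n
    (3 * (6 * M + 12)) e3 e0 (leq0n _) (lexx _).
- by rewrite dotpBr; lin x10 x1n V1 V2 hn k0 M0'.
- by rewrite dotpBr x1n; lin V1 V2 hl.
have uF := lattice_shift Fper lu.
move: eU; rewrite ler_norml => /andP[U1 U2].
have x0E m : e (orb F (xs + V + U) m) = e (orb F (xs + V) m) + e U.
  by rewrite (orb_lattice Fper) // dotpDr.
have [m0 /andP[_ m0n] near0] := wind_near FF uF (leq0n _) w0.
have near0' : `|orb F (xs + V + U) m0 - iter m0 F k| < rho.
  by apply: lt_le_trans near0 _; exact: grad_rho.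
exists (xs + V + U), u; split => //.
- by split => //; exact: top_block_shift.
- by exists m0.
- by rewrite dotpBr x0E x1n; apply/andP; split; lin V1 V2 U1 U2.
move=> k' Ck'; apply: far_free => //.
have sz : `|orb F (xs + V + U) 0| <= S2.
  have h4 := dist_back (xs + V + U) k (leq0n m0); rewrite subr0 in h4.
  have h5 : M * m0%:R <= M * Tm%:R.
    by rewrite ler_wpM2l // ler_nat (leq_trans (ltnW m0n)).
  have h6 := ler_normB (orb F (xs + V + U) 0 - iter 0 F k) (- iter 0 F k).
  rewrite opprK subrK in h6; rewrite normrN in h6.
  have h7 := sk 0%N (leq0n _).
  rewrite /orb in h6 near0' *; lin h4 h5 h6 h7 near0'.
have := ve sz; rewrite x0E ler_norml => /andP[_ h].
by rewrite /= in x10 k0 *; lin h x10 x1n V1 V2 hn U1 U2 M0'.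
Qed.

Lemma down_gate k n T l : C k -> sized k -> (n <= T <= Tm)%N -> 3 * (6 * M + 12) <= l ->
  e (iter n F k) + l + 12 <= (T%:R - n%:R) * h2 - D ->
  exists y0 u, [/\ [/\ lattice u, `|u| <= 5 & bot_block y0], windF (orb F y0) u n T k != 0,
    (exists2 m1, (n <= m1 < T)%N & `|orb F y0 m1 - iter m1 F k| < rho),
    l <= e (orb F y0 n - iter n F k) <= l + 12 &
    forall k', C k' -> farF (orb F y0) u k' T].
Proof.
move=> Ck sk /andP[nT TT] hl hn; have M0' := M0.
have [V lV hV] := lattice_level (e (iter n F k) + l + 6 - e (orb F ys n)).
have tb1 : bot_block (ys + V) by apply: bot_block_shift => // m m'; exact: ysP.
have y1n : e (orb F (ys + V) n) = e (orb F ys n) + e V.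
  by rewrite (orb_lattice Fper) // dotpDr.
move: hV; rewrite ler_norml => /andP[V1 V2].
have y10 := tb1 n T; rewrite nT TT in y10; have {}y10 := y10 isT.
have kT := free_level Ck sk TT.
have eN3 : norm1 (- ev) <= 3 by rewrite /norm1 /= !normrN.
have eN0 : 0 < dotp (- ev) (- ev) by have -> : dotp (- ev) (- ev) = dotp ev ev by rewrite /dotp /=; ring.
have [||U [u [lU lu u5 eU w0]]] := @lattice_row R M F FF Fper (- ev) (ys + V) k n T
    (3 * (6 * M + 12)) eN3 eN0 nT (lexx _).
- by rewrite dotpNl dotpBr y1n; lin V1 V2 hl.
- by rewrite dotpNl dotpBr; lin y10 y1n V1 V2 hn kT M0'.
have uF := lattice_shift Fper lu.
move: eU; rewrite dotpNl normrN ler_norml => /andP[U1 U2].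
have y0E m : e (orb F (ys + V + U) m) = e (orb F (ys + V) m) + e U.
  by rewrite (orb_lattice Fper) // dotpDr.
have [m1 /andP[nm1 m1T] near1] := wind_near FF uF nT w0.
have near1' : `|orb F (ys + V + U) m1 - iter m1 F k| < rho.
  by apply: lt_le_trans near1 _; exact: grad_rho.
exists (ys + V + U), u; split => //.
- by split => //; exact: bot_block_shift.
- by exists m1; rewrite ?nm1.
- by rewrite dotpBr y0E y1n; apply/andP; split; lin V1 V2 U1 U2.
move=> k' Ck'; apply: far_free => //.
have sz : `|orb F (ys + V + U) T| <= S2.
  have h4 := dist_forw (ys + V + U) k (ltnW m1T).
  have h5 : M * (T%:R - m1%:R) <= M * Tm%:R.
    have h : T%:R <= Tm%:R :> R by rewrite ler_nat.
    have h' : 0 <= m1%:R :> R by [].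
    by rewrite ler_wpM2l //; lin h h'.
  have h6 := ler_normB (orb F (ys + V + U) T - iter T F k) (- iter T F k).
  rewrite opprK subrK in h6; rewrite normrN in h6.
  have h7 := sk T TT.
  rewrite /orb in h6 near1' *; lin h4 h5 h6 h7 near1'.
have := ve sz; rewrite y0E ler_norml => /andP[_ h].
by lin h y10 y1n V1 V2 hn U1 U2 M0'.
Qed.

(* Either [k] descends extremally between [n] and [n'], or an upward gate through [k] at
   time [n] and a downward gate through [k] at time [n'] would cross. *)
Lemma drift_control k n n' : C k -> sized k -> (n <= n' <= Tm)%N ->
  e (iter n F k) + 3 * la + 12 <= n%:R * h1 - D ->
  e (iter n' F k) + la + 12 <= (Tm%:R - n'%:R) * h2 - D ->
  `|q (iter n' F k) - q (iter n F k) - kq * (n'%:R - n%:R)| <= 8 * eps1.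
Proof.
move=> Ck sk /andP[nn' n'T] hn hn'; have M0' := M0.
have nT := leq_trans nn' n'T.
have [||x0 [u [[lu u5 xb] wx [m0 m0n nx] /andP[x1 x2] fx]]] := @up_gate k n (3 * la) Ck sk nT.
- by lin M0'.
- by lin hn.
have [|||y0 [u' [[lu' u5' yb] wy [m1 /andP[n'm1 m1T] ny] /andP[y1 y2] fy]]] :=
  @down_gate k n' Tm la Ck sk.
- by rewrite n'T leqnn.
- by lin M0'.
- by lin hn'.
have uF := lattice_shift Fper lu; have uF' := lattice_shift Fper lu'.
have nn : (n <= n' <= Tm)%N by rewrite nn' n'T.
have yn := yb n n' nn; have Yn := bot k nn.
have eps0 : 0 <= eps1.
  by apply: le_trans eps_big; apply: mulr_ge0; [exact: ltW|lin M0'].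
(* If y is still within 5 la of k at time n, then k loses almost as much as y between n and n', so
   its own descent is almost extremal. *)
have [small|large] := leP (e (orb F y0 n - iter n F k)) (5 * la).
  apply: (@le_trans _ _ eps1); last by lin eps0.
  apply: expo_bot => //; rewrite !dotpBr in small y1.
  by lin yn small y1 M0'.
apply: contrapT => /negP; rewrite -ltNge => dev.
have xmono k' m m' : (m <= m' <= Tm)%N ->
    e (orb F x0 m - iter m F k') - 2 * er <= e (orb F x0 m' - iter m' F k').
  by move=> mm; have g1 := xb m m' mm; have g2 := top k' mm; rewrite !dotpBr; lin g1 g2.
have ymono k' m m' : (m <= m' <= Tm)%N ->
    e (orb F y0 m' - iter m' F k') <= e (orb F y0 m - iter m F k') + 2 * er.
  by move=> mm; have g1 := yb m m' mm; have g2 := bot k' mm; rewrite !dotpBr; lin g1 g2.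
have nxe : `|e (orb F x0 m0 - iter m0 F k)| <= 3 * rho.
  by apply: le_trans (edotp _) _; rewrite ler_pM2l // ltW.
have nye : `|e (orb F y0 m1 - iter m1 F k)| <= 3 * rho.
  by apply: le_trans (edotp _) _; rewrite ler_pM2l // ltW.
have nxq : `|q (orb F x0 m0 - iter m0 F k)| <= eps1.
  apply: le_trans (qdotp _) _; apply: le_trans eps_big.
  by rewrite ler_pM2l //; lin nx M0'.
have nyq : `|q (orb F y0 m1 - iter m1 F k)| <= eps1.
  apply: le_trans (qdotp _) _; apply: le_trans eps_big.
  by rewrite ler_pM2l //; lin ny M0'.
have m0nn : (m0 <= n <= Tm)%N by rewrite ltnW.
have n'm1T : (n' <= m1 <= Tm)%N by rewrite n'm1 ltnW.
have kq1 : `|q (iter n F k) - q (iter m0 F k) - kq * (n%:R - m0%:R)| <= eps1.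
  apply: expo_top => //; have g := xb m0 n m0nn.
  move: nxe; rewrite !dotpBr ler_norml in x2 * => /andP[g1 g2].
  by lin g g1 g2 x2 M0'.
have kq2 : `|q (iter m1 F k) - q (iter n' F k) - kq * (m1%:R - n'%:R)| <= eps1.
  apply: expo_bot => //; have g := yb n' m1 n'm1T.
  move: nye; rewrite !dotpBr ler_norml in y2 * => /andP[g1 g2].
  by lin g g1 g2 y2 M0'.
have xq m : (n <= m <= Tm)%N ->
    `|q (orb F x0 m) - q (orb F x0 m0) - kq * (m%:R - m0%:R)| <= eps1.
  move=> /andP[nm mT]; have mm : (m0 <= m <= Tm)%N by rewrite mT (leq_trans (ltnW m0n)).
  by apply: expo_top => //; have g := xb m0 m mm; rewrite /orb in g; lin g M0'.
have yq m : (n <= m <= n')%N ->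
    `|q (orb F y0 m1) - q (orb F y0 m) - kq * (m1%:R - m%:R)| <= eps1.
  move=> /andP[nm mn']; have mm : (m <= m1 <= Tm)%N.
    by rewrite (ltnW m1T) (leq_trans mn').
  by apply: expo_bot => //; have g := yb m m1 mm; rewrite /orb in g; lin g M0'.
have g5 := grad_rho u5; have g5' := grad_rho u5'.
have s5 := srad_rho u5 u5'.
have xk m : (n <= m <= Tm)%N -> 3 * la - 2 * er <= e (orb F x0 m - iter m F k).
  by move=> mm; have g := xmono k n m mm; lin g x1.
have := @crossing_sep R 0 M F FF ev 3 C k x0 u y0 u' n Tm (2 * er) _ edotp Cc Ck uC uF uF' nT.
apply => //.
- by move=> k' m Ck' mn; apply: xmono; rewrite mn.
(* Before n' the gate is about la above k, so starting the count at n instead of n' adds nothing. *)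
- have -> : windF (orb F y0) u' n Tm k = windF (orb F y0) u' n' Tm k.
    rewrite -(@wind_cat _ _ _ _ _ n n' Tm) // (wind_far FF (orb_orbit F y0)) ?add0r //.
    move=> m /andP[nm mn']; have mm : (m <= n' <= Tm)%N by rewrite (ltnW mn').
    have g := ymono k m n' mm; rewrite /far_gate; apply: le_trans g5' _.
    have := edotp (orb F y0 m - iter m F k); rewrite ler_norml => /andP[_ g'].
    by lin g g' y1 M0'.
  exact: wy.
- by rewrite dotpBr; rewrite !dotpBr in large x2; lin large x2 g5 g5' M0'.
- move=> m mm; rewrite /far_gate; apply: le_trans g5 _.
  have := edotp (orb F x0 m - iter m F k); rewrite ler_norml => /andP[_ g'].
  by have g := xk m mm; lin g g' M0'.
move=> m /andP[nm mT]; have [mn'|n'm] := leqP m n'; last first.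
  have g1 := xk m; rewrite nm mT in g1; have {}g1 := g1 isT.
  have g2 := ymono k n' m; rewrite (ltnW n'm) mT in g2; have {}g2 := g2 isT.
  have := edotp (orb F x0 m - orb F y0 m); rewrite dotpBr ler_norml => /andP[_ g'].
  rewrite !dotpBr in g1 g2 y2.
  by lin g1 g2 g' y2 s5 M0'.
have h1' := xq m; rewrite nm mT in h1'; have {}h1' := h1' isT.
have h2' := yq m; rewrite nm mn' in h2'; have {}h2' := h2' isT.
have h3' := qdotp (orb F x0 m - orb F y0 m).
rewrite dotpBr in h3'; rewrite !dotpBr in nxq nyq.
(* Both orbits are tracked through their meetings with k, at a cost of three errors eps1 each; six
   are subtracted from the assumed deviation of 8. *)
have h4' : 2 * eps1 < `|q (orb F x0 m) - q (orb F y0 m)|.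
  have [d1|d1] := leP 0 (q (iter n' F k) - q (iter n F k) - kq * (n'%:R - n%:R)).
    rewrite (ger0_norm d1) in dev; rewrite -normrN.
    apply: lt_le_trans (ler_norm _).
    move: h1' h2' nxq nyq kq1 kq2; rewrite !ler_norml.
    move=> /andP[a1 a2] /andP[b1 b2] /andP[c1 c2] /andP[d1' d2] /andP[f1 f2] /andP[f3 f4].
    by lin a1 a2 b1 b2 c1 c2 d1' d2 f1 f2 f3 f4 dev.
  rewrite (ltr0_norm d1) in dev.
  apply: lt_le_trans (ler_norm _).
  move: h1' h2' nxq nyq kq1 kq2; rewrite !ler_norml.
  move=> /andP[a1 a2] /andP[b1 b2] /andP[c1 c2] /andP[d1' d2] /andP[f1 f2] /andP[f3 f4].
  by lin a1 a2 b1 b2 c1 c2 d1' d2 f1 f2 f3 f4 dev.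
apply: le_trans s5 _; rewrite -(ler_pM2l Q0).
have h5' : Q * (2 * rho + 2 * M) <= Q * (3 * rho + 2 * M) by rewrite ler_pM2l //; lin M0'.
by lin h3' h4' h5' eps0.
Qed.

Lemma first_zero (w : nat -> R) L : w 0%N != 0 -> w L = 0 ->
  exists j, [/\ (j < L)%N, w j.+1 = 0 & forall i, (i <= j)%N -> w i != 0].
Proof.
elim: L => [|L IH] w0 wL; first by rewrite wL eqxx in w0.
have [wL0|wL0] := eqVneq (w L) 0.
  have [j [jL wj hj]] := IH w0 wL0.
  by exists j; split => //; exact: ltnW.
have [[j [jL wj hj]]|nex] := pselect (exists j, [/\ (j < L)%N, w j.+1 = 0 &
    forall i, (i <= j)%N -> w i != 0]).
  by exists j; split => //; exact: ltnW.
exists L; split => // i iL; apply: contrapT => /negP; rewrite negbK => /eqP wi.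
have [m mw mmin] : exists2 m, w m = 0 & forall m', w m' = 0 -> (m <= m')%N.
  have ex : exists m, w m == 0 by exists i; rewrite wi.
  exists (ex_minn ex); case: ex_minnP => m /eqP // wm hm m' wm'.
  by apply: hm; rewrite wm'.
case: m mw mmin => [|m] mw mmin; first by rewrite mw eqxx in w0.
apply: nex; exists m; split => //; first by exact: leq_trans (mmin i wi) iL.
move=> j jm; apply/negP => /eqP wj; have := mmin j wj.
by rewrite leqNgt ltnS jm.
Qed.

Lemma quarter_dotp w d : dotp (quarter (quarter w)) d = - dotp w d.
Proof. by rewrite /quarter /dotp /=; ring. Qed.

(** * A gate carried past b at time i by an orbit of maximal transverse drift *)

Section SlidingGate.
Variables (b : R * R) (i n0 T mu nu : nat).
Variables (nn Wn el rg gr om : R) (r0 g : R * R).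
Local Notation z := (iter i F b).
Local Notation nv := (quarter qv).
Local Notation PP := (2 * rho + 4 * M * Wn).
Local Notation r := (orb F r0).
Hypothesis Cb : C b.
Hypothesis bS : forall m, (m <= Tm)%N -> `|iter m F b| + 2 * rho + 4 * M * Tm%:R <= S.
Hypothesis n0i : (n0 <= i)%N.
Hypothesis inuT : (i + nu <= T)%N.
Hypothesis TTm : (T <= Tm)%N.
Hypothesis munu : (mu <= nu)%N.
Hypothesis mui : (n0 + mu <= i)%N.
Hypothesis kq0 : kq <= 0.
Hypothesis h10 : 0 <= h1.
Hypothesis h20 : 0 <= h2.
Hypothesis om0 : 0 <= om.
Hypothesis z_nn : `|e z| + D / 4 + la <= nn.
Hypothesis Wn0 : 0 <= Wn.
Hypothesis Wn_h1 : forall t, t * h1 <= 2 * nn -> t <= Wn.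
Hypothesis Wn_i : Wn <= i%:R - n0%:R.
Hypothesis in1 : e z + 3 * PP + (i%:R - n0%:R) * h2 + er + 3 * la + 12 <= n0%:R * h1 - D.
Hypothesis in2 : e z + 3 * PP + (T%:R - i%:R) * h1 + er + 3 * la + 12 <= (Tm%:R - T%:R) * h2 - D.
Hypothesis rb : forall m m', (m <= m' <= Tm)%N ->
  (m'%:R - m%:R) * om - er <= q (r m') - q (r m).
Hypothesis lg : lattice g.
Hypothesis grg : gradF g <= rg.
Hypothesis r_up : el <= dotp nv (r i - z).
Hypothesis r_dn : dotp nv (r i + g - z) <= - el.
Hypothesis r_q : `|q (r i - z)| <= 2 * Q.
Hypothesis g_q : `|q g| <= 2 * Q.
Hypothesis r_gr : `|r i - z| <= gr.
Hypothesis B1 : Q * (2 * M * mu%:R) + Q * (4 * M + 1) <= el.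
Hypothesis B2 : 4 * Q + er + 9 * eps1 <= mu%:R * om.
Hypothesis B3 : Q * rg + 2 * Q + 19 * eps1 + er <= nu%:R * om.
Hypothesis B4 : 3 * (rg + 2 * M * nu%:R) + 3 * rho + 3 * gr <= nn.
Hypothesis B5 : Q * rg + 2 * Q + Q * PP + 8 * eps1 + er <= (i%:R - n0%:R) * om.
Hypothesis B6 : nu%:R * (h1 + h2) + la <= nn.
Hypothesis B7 : e z + nu%:R * h1 + er + 2 * nn + 12 <= (T%:R - (i + nu)%:R) * h2 - D.
Hypothesis B8 : e z + nn + 12 <= i%:R * h1 - D.

Tactic Notation "lfin" ne_hyp_list(H) :=
  clear - FF Fper Cc uC free v3 e3 e0 qQ top bot xsP ysP expo_top expo_bot ve SS2 er0
    er_la la_big la_D Q0 eps_big Cb bS n0i inuT TTm munu mui kq0 h10 h20 om0 z_nn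
    Wn0 Wn_h1 Wn_i in1 in2 rb lg grg r_up r_dn r_q g_q r_gr B1 B2 B3 B4 B5 B6 B7 B8 H; lra.

Let iT : (i <= Tm)%N.
Proof. by apply: leq_trans TTm; apply: leq_trans inuT; exact: leq_addr. Qed.

Let eps0 : 0 <= eps1.
Proof.
apply: le_trans eps_big; apply: mulr_ge0; first exact: ltW.
have := M0; lra.
Qed.

(** The orbits whose drift is controlled on all of [n0, T]. The radius PP is the distance at time i
    of two orbits that have both met the x gate within the preceding Wn steps. *)
Definition inner k := [/\ C k, sized k & `|iter i F k - z| <= PP].

(** The level at time i is that of z up to 3 PP; [top] and [bot] carry it to the other times, where
    [in1] and [in2] leave enough room for [drift_control]. *)
Lemma inner_drift k m m' : inner k -> (n0 <= m)%N -> (m <= m')%N -> (m' <= T)%N ->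
  `|q (iter m' F k) - q (iter m F k) - kq * (m'%:R - m%:R)| <= 8 * eps1.
Proof.
move=> [Ck sk kz] n0m mm' m'T; have M0' := M0.
have m'Tm := leq_trans m'T TTm; have mTm := leq_trans mm' m'Tm.
have ezi : e (iter i F k) <= e z + 3 * PP.
  have := edotp (iter i F k - z); rewrite dotpBr ler_norml => /andP[_ g1]; lra.
have lev j : (n0 <= j <= T)%N ->
    e (iter j F k) + 3 * la + 12 <= j%:R * h1 - D /\
    e (iter j F k) + la + 12 <= (Tm%:R - j%:R) * h2 - D.
  move=> /andP[n0j jT].
  have a0 : n0%:R * h1 <= j%:R * h1 by rewrite ler_wpM2r // ler_nat.
  have a1 : (Tm%:R - T%:R) * h2 <= (Tm%:R - j%:R) * h2.
    by rewrite ler_wpM2r // lerD2l lerN2 ler_nat.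
  have a2 : n0%:R * h1 <= i%:R * h1 by rewrite ler_wpM2r // ler_nat.
  have a3 : 0 <= (i%:R - n0%:R) * h2 by rewrite mulr_ge0 // subr_ge0 ler_nat.
  have a4 : 0 <= (T%:R - i%:R) * h1.
    by rewrite mulr_ge0 // subr_ge0 ler_nat (leq_trans (leq_addr nu i)).
  have la0 : 0 <= la by move: la_big; lra.
  have [ji|ij] := leqP j i.
    have c1 := bot k (m := j) (m' := i); rewrite ji iT in c1; have {}c1 := c1 isT.
    have a5 : (i%:R - j%:R) * h2 <= (i%:R - n0%:R) * h2.
      by rewrite ler_wpM2r // lerD2l lerN2 ler_nat.
    have a6 : (Tm%:R - T%:R) * h2 <= (Tm%:R - i%:R) * h2.
      by rewrite ler_wpM2r // lerD2l lerN2 ler_nat (leq_trans (leq_addr nu i)).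
    by split; move: in1 in2; lfin a0 a1 a2 a3 a4 a5 a6 c1 ezi la0.
  have c1 := top k (m := i) (m' := j); rewrite (ltnW ij) (leq_trans jT TTm) in c1.
  have {}c1 := c1 isT.
  have a5 : (j%:R - i%:R) * h1 <= (T%:R - i%:R) * h1.
    by rewrite ler_wpM2r // lerD2r ler_nat.
  by split; move: in1 in2; lfin a0 a1 a2 a3 a4 a5 c1 ezi la0.
apply: drift_control => //; first by rewrite mm'.
  by have [] := lev m; rewrite ?n0m ?(leq_trans mm').
by have [] := lev m'; rewrite ?m'T ?(leq_trans n0m).
Qed.

Lemma inner_b : inner b.
Proof.
have M0' := M0; split => //.
- move=> m mT; have h := bS mT; have : 0 <= M * Tm%:R by rewrite mulr_ge0.
  by lra.
- have g1 : 0 <= M * Wn by rewrite mulr_ge0.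
  by rewrite subrr normr0; lra.
Qed.

(* Before time [i] the orbit of [r] is behind, after time [i] ahead of, any inner
   orbit whose [q]-value at time [i] is comparable with that of [z]. *)
Lemma r_behind k m (c : R) : inner k -> q z - q (iter i F k) <= c ->
  (n0 <= m <= i)%N ->
  q (r m - iter m F k) <= 2 * Q + c + 8 * eps1 + er - (i%:R - m%:R) * om.
Proof.
move=> ik hc /andP[n0m mi]; have iT' : (i <= T)%N := leq_trans (leq_addr nu i) inuT.
have d1 := inner_drift ik n0m mi iT'; have d2 := rb (m := m) (m' := i).
rewrite mi iT in d2; have {}d2 := d2 isT.
have kqm : kq * (i%:R - m%:R) <= 0 by rewrite mulr_le0_ge0 // subr_ge0 ler_nat.
move: r_q d1; rewrite !dotpBr !ler_norml => /andP[g1 g2] /andP[g3 g4].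
by lfin d2 kqm g1 g2 g3 g4 hc.
Qed.

Lemma r_ahead k m (c : R) : inner k -> q (iter i F k) - q z <= c ->
  (i <= m <= T)%N ->
  (m%:R - i%:R) * om - (2 * Q + c + 8 * eps1 + er) <= q (r m - iter m F k).
Proof.
move=> ik hc /andP[im mT]; have mTm := leq_trans mT TTm.
have d1 := inner_drift ik n0i im mT; have d2 := rb (m := i) (m' := m).
rewrite im mTm in d2; have {}d2 := d2 isT.
have kqm : kq * (m%:R - i%:R) <= 0 by rewrite mulr_le0_ge0 // subr_ge0 ler_nat.
move: r_q d1; rewrite !dotpBr !ler_norml => /andP[g1 g2] /andP[g3 g4].
by lfin d2 kqm g1 g2 g3 g4 hc.
Qed.

Lemma far_r k m : Q * rg <= `|q (r m - iter m F k)| -> farF r g k m.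
Proof.
move=> h; rewrite /far_gate; apply: le_trans grg _.
by rewrite -(ler_pM2l Q0); exact: le_trans h (qdotp _).
Qed.

Lemma rg0 : 0 <= rg.
Proof. exact: le_trans (ltW (gate_rad_gt0 FF g)) grg. Qed.

Lemma rel_drift p k m n : (m <= n)%N ->
  `|(iter n F p - iter n F k) - (iter m F p - iter m F k)| <= 2 * M * (n%:R - m%:R).
Proof.
elim: n => [|n IH].
  by rewrite leqn0 => /eqP ->; rewrite !subrr normr0 mulr0.
rewrite leq_eqVlt => /predU1P[->|/IH{}IH]; first by rewrite !subrr normr0 mulr0.
have [w wM] := F_diff FF (iter n F p) (iter n F k).
have -> : shear 0 (iter n F p - iter n F k) = iter n F p - iter n F k.
  by rewrite /shear mul0r addr0 -surjective_pairing.
move=> /= ->; rewrite -addrA addrC -addrA.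
apply: le_trans (ler_normD _ _) _; rewrite -[n.+1%:R]natr1.
by rewrite [X in _ + `|X|]addrC; lra.
Qed.

(** As kq is at most 0, the gate gains on b in the direction [qv] at rate om up to errors: both ends
    are behind b until i - mu and ahead of it from i + mu on. In between, b passes between the ends,
    which lie on opposite sides of it in the direction [nv]. *)
Lemma r_wind_b : windF r g n0 (i + nu) b = 2 * pi.
Proof.
have M0' := M0; have rg0' := rg0; have ib := inner_b.
have qb0 : q z - q z <= 0 by rewrite subrr.
have rgQ : 0 <= Q * rg by rewrite mulr_ge0 // ltW.
have epsQ : Q * (4 * M + 1) < eps1.
  by apply: lt_le_trans eps_big; rewrite ltr_pM2l //; lra.
have QM : 0 <= Q * (4 * M + 1) by rewrite mulr_ge0 ?(ltW Q0) //; lra.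
have nvQ d : `|dotp nv d| <= Q * `|d|.
  apply: le_trans (dotp_norm1 _ _) _; rewrite ler_wpM2r //.
  by rewrite /quarter /norm1 /= normrN addrC.
have gq := g_q; rewrite ler_norml in gq; move: gq => /andP[gq1 gq2].
have qg d m : q (d + g - iter m F b) = q (d - iter m F b) + q g.
  by rewrite !dotpBr dotpDr; ring.
have behind m : (n0 <= m <= i - mu)%N -> q (r m - iter m F b) <= - (2 * Q + eps1).
  move=> /andP[n0m mi]; have mi' := leq_trans mi (leq_subr _ _).
  have h := @r_behind b m 0 ib qb0; rewrite n0m mi' in h; have {}h := h isT.
  have h' : mu%:R * om <= (i%:R - m%:R) * om.
    rewrite ler_wpM2r // lerBrDl -natrD ler_nat.
    have mu_i : (mu <= i)%N := leq_trans (leq_addl n0 mu) mui.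
    by rewrite -(subnK mu_i) leq_add2r.
  by move: B2; lfin h h'.
have ahead m : (i + mu <= m <= i + nu)%N -> 2 * Q + eps1 <= q (r m - iter m F b).
  move=> /andP[im mi]; have im' := leq_trans (leq_addr _ _) im.
  have h := @r_ahead b m 0 ib qb0; rewrite im' (leq_trans mi inuT) in h.
  have {}h := h isT.
  have h' : mu%:R * om <= (m%:R - i%:R) * om.
    by rewrite ler_wpM2r // lerBrDl -natrD ler_nat.
  by move: B2; lfin h h'.
have mid m : (i - mu <= m <= i + mu)%N ->
    Q * (4 * M + 1) <= dotp nv (r m - iter m F b) /\
    dotp nv (r m + g - iter m F b) <= - (Q * (4 * M + 1)).
  move=> /andP[im mi].
  have dr : `|(r m - iter m F b) - (r i - z)| <= 2 * M * mu%:R.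
    have [mi2|im2] := leqP m i.
      rewrite distrC; apply: le_trans (rel_drift r0 b mi2) _.
      by rewrite ler_wpM2l ?mulr_ge0 // lerBlDr -natrD ler_nat -leq_subLR.
    apply: le_trans (rel_drift r0 b (ltnW im2)) _.
    by rewrite ler_wpM2l ?mulr_ge0 // lerBlDl -natrD ler_nat.
  have nvm := nvQ ((r m - iter m F b) - (r i - z)).
  have nvm' : Q * `|(r m - iter m F b) - (r i - z)| <= Q * (2 * M * mu%:R).
    by rewrite ler_pM2l.
  have hg : dotp nv (r m + g - iter m F b) =
    dotp nv ((r m - iter m F b) - (r i - z)) + dotp nv (r i + g - z).
    by rewrite !dotpBr !dotpDr; ring.
  have hg' : dotp nv (r m - iter m F b) =
    dotp nv ((r m - iter m F b) - (r i - z)) + dotp nv (r i - z).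
    by rewrite !dotpBr; ring.
  rewrite hg hg'; move: nvm; rewrite ler_norml => /andP[c1 c2].
  by split; move: B1 r_up r_dn; lfin c1 c2 nvm'.
have qn d : dotp (quarter nv) d = - q d by exact: quarter_dotp.
have sq d : Q * (4 * M + 1) <= `|q d| -> 4 * M < `|d|.
  by move=> h; have := le_trans h (qdotp d); rewrite ler_pM2l //; lra.
have sn d : Q * (4 * M + 1) <= `|dotp nv d| -> 4 * M < `|d|.
  by move=> h; have := le_trans h (nvQ d); rewrite ler_pM2l //; lra.
have thp p m : 4 * M < `|p - iter m F b| -> `|theta 0 F (iter m F b) p| < pi.
  move=> h; rewrite (theta_far0 FF) //.
    by apply: lt_trans (rot_bound _ _) _; have := @pi_gt0 R; lra.
  by move: h; rewrite prod_normE lt_max => /orP[?|?]; [left|right].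
have nN (x y : R) : x <= - y -> y <= `|x|.
  by move=> h; rewrite -normrN; apply: le_trans (ler_norm _); rewrite lerNr.
have nP (x y : R) : y <= x -> y <= `|x|.
  by move=> h; apply: le_trans (ler_norm _).
have lgF := lattice_shift Fper lg.
have mu_i : (mu <= i)%N := leq_trans (leq_addl n0 mu) mui.
have n0mu : (n0 <= i - mu)%N by rewrite leq_subRL // addnC.
have Q00 : 0 <= Q := ltW Q0.
apply: (@wind_pass R 0 M F FF nv r g b n0 (i - mu) (i + mu) (i + nu)) => //.
- exact: leq_trans (leq_subr _ _) (leq_addr _ _).
- by rewrite leq_add2l.
- apply: (far_gate_dot FF); apply: far_r; apply: nN.
  have h := @r_behind b n0 0 ib qb0; rewrite leqnn n0i in h; have {}h := h isT.
  have PP0 : 0 <= Q * PP.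
    by rewrite mulr_ge0 // addr_ge0 ?mulr_ge0 //; lfin M0'.
  by move: B5 eps0; lfin h PP0.
- apply: (far_gate_dot FF); apply: far_r; apply: nP.
  have h := @r_ahead b (i + nu) 0 ib qb0; rewrite leq_addr inuT in h.
  have {}h := h isT; rewrite natrD addrAC subrr add0r in h.
  by move: B3 eps0; lfin h.
- move=> m mm; rewrite !qn qg; have h := behind m mm.
  by split; [lfin h Q00 epsQ QM|lfin h gq2 epsQ QM].
- move=> m mm; rewrite dotpNl; have [h h'] := mid m mm.
  have Q4 : 0 < Q * (4 * M + 1) by rewrite mulr_gt0 //; lfin M0'.
  by split; [lfin h Q4|lfin h' Q4].
- move=> m mm; rewrite 2!dotpNl 2!qn qg; have h := ahead m mm.
  by split; [lfin h Q00 epsQ QM|lfin h gq1 epsQ QM].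
move=> m /andP[n0m mT].
have [m1|m1] := leqP m (i - mu).
  have h := behind m; rewrite n0m m1 in h; have {}h := h isT.
  split; apply: thp; apply: sq; apply: nN; first by lfin h Q00 epsQ.
  by rewrite qg; lfin h gq2 epsQ.
have [m2|m2] := leqP m (i + mu).
  have [h h'] := mid m ltac:(by rewrite (ltnW m1)).
  by split; apply: thp; apply: sn; [apply: nP|apply: nN].
have h := ahead m; rewrite (ltnW m2) (ltnW mT) in h; have {}h := h isT.
split; apply: thp; apply: sq; apply: nP; first by lfin h Q00 epsQ.
by rewrite qg; lfin h gq1 epsQ.
Qed.

Lemma near_everywhere p k j m : (j <= Tm)%N -> (m <= Tm)%N ->
  `|iter j F p - iter j F k| < rho -> `|iter m F p - iter m F k| <= rho + 2 * M * Tm%:R.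
Proof.
move=> jT mT nj; have M0' := M0.
have d0 : 0 <= m%:R :> R by []. have d1 : 0 <= j%:R :> R by [].
have dm : m%:R <= Tm%:R :> R by rewrite ler_nat.
have dj : j%:R <= Tm%:R :> R by rewrite ler_nat.
have [jm|mj] := leqP j m.
  have h := dist_forw p k jm.
  have h' : M * (m%:R - j%:R) <= M * Tm%:R by rewrite ler_wpM2l //; lfin d1 dm.
  by lfin h h' nj.
have h := dist_back p k (ltnW mj).
have h' : M * (j%:R - m%:R) <= M * Tm%:R by rewrite ler_wpM2l //; lfin d0 dj.
by lfin h h' nj.
Qed.

Section XGate.
Variables (x0 ux : R * R).
Hypothesis ux5 : `|ux| <= 5.
Hypothesis lux : lattice ux.
Hypothesis xb : top_block x0.
Hypothesis x2 : e (orb F x0 i - z) <= nn + 12.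

(** Close to an orbit of C, x cannot be far below level 0, and at time i it is only about nn above
    z; climbing at rate h1 takes at most Wn steps for this. *)
Lemma crossing_time p j : C p -> sized p -> (j <= i)%N ->
  `|orb F x0 j - iter j F p| < rho -> i%:R - j%:R <= Wn.
Proof.
move=> Cp sp ji nj; apply: Wn_h1; have M0' := M0.
have jT := leq_trans ji iT.
have g2 := @xb j i; rewrite ji iT in g2; have {}g2 := g2 isT.
have g3 := free_level Cp sp jT.
have g4 := edotp (orb F x0 j - iter j F p).
move: g4 x2; rewrite !dotpBr ler_norml => /andP[g4 _] x2'.
have g5 := ler_norm (e z).
by move: z_nn er0 er_la la_big; lfin g2 g3 g4 g5 nj x2' M0'.
Qed.

(** Both b and k have met the x gate within Wn steps before i, so they are still within PP of each
    other at time i. The level bound holds because x climbs extremally and k cannot outrun it. *)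
Lemma crossed_inner m0 k : (m0 < i)%N -> `|orb F x0 m0 - iter m0 F b| < rho ->
  C k -> windF (orb F x0) ux 0 i k != 0 ->
  inner k /\ e (iter i F k) <= e z + nn + 12 + 3 * rho + 2 * er.
Proof.
move=> m0i nx Ck wk; have M0' := M0; have [_ sb _] := inner_b.
have [m /andP[_ mi] nk0] := wind_near FF (lattice_shift Fper lux) (leq0n _) wk.
have nk : `|orb F x0 m - iter m F k| < rho.
  by apply: lt_le_trans nk0 _; exact: grad_rho.
have mT := leq_trans (ltnW mi) iT; have m0T := leq_trans (ltnW m0i) iT.
have sk : sized k.
  move=> j jT; have a1 := near_everywhere m0T jT nx; have a2 := near_everywhere mT jT nk.
  have a3 := bS jT.
  have a4 := ler_normB (iter j F x0 - iter j F b) (iter j F x0 - iter j F k).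
  have -> : iter j F k = iter j F b + ((iter j F x0 - iter j F b) - (iter j F x0 - iter j F k)).
    by rewrite opprB addrA [iter j F b + _]addrC subrK addrC subrK.
  apply: le_trans (ler_normD _ _) _.
  by lfin a1 a2 a3 a4.
have t0 := crossing_time Cb sb (ltnW m0i) nx.
have t1 := crossing_time Ck sk (ltnW mi) nk.
split.
  split => //.
  have a1 := dist_forw x0 b (ltnW m0i); have a2 := dist_forw x0 k (ltnW mi).
  have a3 : M * (i%:R - m0%:R) <= M * Wn by rewrite ler_wpM2l.
  have a4 : M * (i%:R - m%:R) <= M * Wn by rewrite ler_wpM2l.
  have a5 := ler_normB (iter i F x0 - z) (iter i F x0 - iter i F k).
  have -> : iter i F k - z = (iter i F x0 - z) - (iter i F x0 - iter i F k).
    by rewrite opprB [RHS]addrC addrA subrK.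
  rewrite /orb in nx nk; apply: le_trans a5 _.
  by lfin a1 a2 a3 a4 nx nk.
have g2 := @xb m i; rewrite (ltnW mi) iT in g2; have {}g2 := g2 isT.
have g3 := top k (m := m) (m' := i); rewrite (ltnW mi) iT in g3; have {}g3 := g3 isT.
have g4 := edotp (orb F x0 m - iter m F k).
move: g4 x2; rewrite !dotpBr ler_norml => /andP[g4 _] x2'.
by lfin g2 g3 g4 x2' nk.
Qed.

End XGate.

(** The chain is kept only up to the last point c j0 before the winding of x first vanishes. This
    point is at the x gate at time i, about nn above z and with nearly the same transverse
    coordinate, so the sliding gate never comes near it, while it winds once around b. On the
    shortened chain the sliding gate replaces x, being separated from y transversally after time i +
    nu. *)
Lemma gates_contradiction : False.
Proof.
have M0' := M0; have rg0' := rg0; have ib := inner_b; have [_ sb _] := ib.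
have eps0' := eps0; have iT' := iT; have er0' := er0; have Q00 : 0 <= Q := ltW Q0.
have n1T : (i + nu <= Tm)%N := leq_trans inuT TTm.
have rgQ : 0 <= Q * rg by rewrite mulr_ge0.
have [||x0 [ux [[lux ux5 xb] wx [m0 m0i nx] /andP[x1 x2] fx]]] :=
  @up_gate b i nn Cb sb iT.
- have h := normr_ge0 (e z).
  by move: z_nn er0 er_la la_big la_D; lfin h M0'.
- exact: B8.
have sub k : C k -> windF (orb F x0) ux 0 i k != 0 ->
    inner k /\ e (iter i F k) <= e z + nn + 12 + 3 * rho + 2 * er.
  by apply: crossed_inner m0i nx.
have bn1 := top b (m := i) (m' := i + nu); rewrite leq_addr n1T in bn1.
have {}bn1 := bn1 isT; rewrite natrD (addrC (i%:R : R)) addrK in bn1.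
have bn2 := bot b (m := i) (m' := i + nu); rewrite leq_addr n1T in bn2.
have {}bn2 := bn2 isT; rewrite natrD (addrC (i%:R : R)) addrK in bn2.
have nnbig : 3 * (6 * M + 12) <= nn.
  have h := normr_ge0 (e z).
  by move: z_nn er0 er_la la_big la_D; lfin h M0'.
have [|||y0 [uy [[luy uy5 yb] wy [my /andP[n1my myT] ny] /andP[y1 y2] fy]]] :=
  @down_gate b (i + nu) T (2 * nn) Cb sb.
- by rewrite inuT.
- by lfin nnbig M0'.
- by move: B7; lfin bn1.
have uxF := lattice_shift Fper lux; have uyF := lattice_shift Fper luy.
have gF := lattice_shift Fper lg.
have [l Cl lfar] := unbounded_far_orbit FF (orb F x0) Tm (gradF ux) uC.
pose P k k' := gate_tame 0 M F (orb F x0) ux 0 i k k' /\ forall n, (n <= T)%N ->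
  (i + nu <= n)%N -> gate_tame 0 M F r g n0 n k k' /\ gate_tame 0 M F (orb F y0) uy n T k k'.
have n0n n : (i + nu <= n)%N -> (n0 <= n)%N.
  by apply: leq_trans; apply: leq_trans n0i (leq_addr _ _).
have [k Ck|L [c [c0 cL cC cQ]]] := @connected_chain _ C P b l Cc Cb Cl.
  have h1' := @near_gate_tame _ _ _ _ FF (orb F x0) ux 0 i k (orb_orbit _ _) uxF (leq0n _).
  have h2' : \forall k' \near k, forall n, (n <= T)%N -> (i + nu <= n)%N ->
     gate_tame 0 M F r g n0 n k k' /\ gate_tame 0 M F (orb F y0) uy n T k k'.
    apply: (@near_forall_leq _ (nbhs k) _ (fun n k' => (i + nu <= n)%N ->
     gate_tame 0 M F r g n0 n k k' /\ gate_tame 0 M F (orb F y0) uy n T k k')) => n nT.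
    apply: (@near_imp _ (nbhs k) _ (is_true (i + nu <= n)%N) (fun k' =>
      gate_tame 0 M F r g n0 n k k' /\ gate_tame 0 M F (orb F y0) uy n T k k')) => nn1.
    have g1 := @near_gate_tame _ _ _ _ FF r g n0 n k (orb_orbit _ _) gF (n0n _ nn1).
    have g2 := @near_gate_tame _ _ _ _ FF (orb F y0) uy n T k (orb_orbit _ _) uyF nT.
    by near=> k'; split; near: k'.
  by near=> k'; split; near: k'.
pose w j := windF (orb F x0) ux 0 i (c j).
have w0 : w 0%N != 0 by rewrite /w c0.
have wL : w L = 0.
  rewrite /w cL; apply: (wind_far FF (orb_orbit _ _)) => // m /andP[_ mi].
  by apply: lfar; exact: leq_trans (ltnW mi) iT.
have [j0 [j0L wj0 wj]] := first_zero w0 wL.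
(* If it were far, tameness would make the windings at j0 and j0 + 1 equal. *)
have kLx : ~ farF (orb F x0) ux (c j0) i.
  move=> fk; have wne := wj j0 (leqnn _).
  have [[[t1 t2 t3] _]|[[t1 t2 t3] _]] := cQ j0 j0L.
    have h := t1 (fx _ (cC _ (ltnW j0L))) fk.
    by move: wne; rewrite /w -h -/(w j0.+1) wj0 eqxx.
  have [fk'|fk'] := pselect (farF (orb F x0) ux (c j0.+1) i); last exact: t3 fk' fk.
  have h := t1 (fx _ (cC _ j0L)) fk'.
  by move: wne; rewrite /w h -/(w j0.+1) wj0 eqxx.
have kLn : `|orb F x0 i - iter i F (c j0)| < rho.
  apply: lt_le_trans (grad_rho ux5); rewrite ltNge; apply/negP => h; exact: kLx.
have [ikL _] := sub _ (cC _ (ltnW j0L)) (wj j0 (leqnn _)).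
have Qrho : Q * rho <= eps1.
  by apply: le_trans eps_big; rewrite ler_pM2l //; lfin M0'.
(* The drift of b from m0 to i costs 8 eps1, the drift of x and its proximity to b at m0 and to c j0
   at i one each. *)
have kLq : `|q (iter i F (c j0)) - q z| <= 11 * eps1.
  have g1 := crossing_time xb x2 Cb sb (ltnW m0i) nx.
  have n0m0 : (n0 <= m0)%N by rewrite -(ler_nat R); move: Wn_i; lfin g1.
  have g2 := inner_drift ib n0m0 (ltnW m0i) (leq_trans (leq_addr nu i) inuT).
  have m0iT : (m0 <= i <= Tm)%N by rewrite (ltnW m0i) iT.
  have g3 : `|q (orb F x0 i) - q (orb F x0 m0) - kq * (i%:R - m0%:R)| <= eps1.
    apply: expo_top => //; have h := xb _ _ m0iT; rewrite /orb in h.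
    by move: er0 er_la; lfin h.
  have g4 : `|q (orb F x0 m0 - iter m0 F b)| <= eps1.
    by apply: le_trans (qdotp _) _; apply: le_trans Qrho; rewrite ler_pM2l // ltW.
  have g5 : `|q (orb F x0 i - iter i F (c j0))| <= eps1.
    by apply: le_trans (qdotp _) _; apply: le_trans Qrho; rewrite ler_pM2l // ltW.
  move: g2 g3 g4 g5; rewrite !dotpBr !ler_norml.
  move=> /andP[a1 a2] /andP[a3 a4] /andP[a5 a6] /andP[a7 a8].
  by apply/andP; split; lfin a1 a2 a3 a4 a5 a6 a7 a8.
have kLe : nn - 3 * rho <= e (iter i F (c j0)) - e z.
  have g4 := edotp (orb F x0 i - iter i F (c j0)).
  move: g4 x1; rewrite !dotpBr ler_norml => /andP[_ g4] x1'.
  by lfin g4 x1' kLn.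
move: kLq; rewrite ler_norml => /andP[kLq1 kLq2].
have nN (x y : R) : x <= - y -> y <= `|x|.
  by move=> h; rewrite -normrN; apply: le_trans (ler_norm _); rewrite lerNr.
have nP (x y : R) : y <= x -> y <= `|x|.
  by move=> h; apply: le_trans (ler_norm _).
have om_le (m m' : nat) : (m <= m')%N -> m%:R * om <= m'%:R * om.
  by move=> mm; rewrite ler_wpM2r // ler_nat.
(* At least nu steps away from i the transverse coordinates differ by more than the gate radius;
   closer to i there is no time to cover the height nn. *)
have kLfar m : (n0 <= m <= T)%N -> farF r g (c j0) m.
  move=> /andP[n0m mT].
  have [m1|m1] := leqP (m + nu)%N i.
    apply: far_r; apply: nN; have mi := leq_trans (leq_addr _ _) m1.
    have hq : q z - q (iter i F (c j0)) <= 11 * eps1 by lfin kLq1.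
    have h := @r_behind _ m _ ikL hq; rewrite n0m mi in h; have {}h := h isT.
    have h' : nu%:R * om <= (i%:R - m%:R) * om.
      by rewrite ler_wpM2r // lerBrDl -natrD ler_nat.
    by move: B3; lfin h h'.
  have [m2|m2] := leqP (i + nu)%N m.
    apply: far_r; apply: nP; have im := leq_trans (leq_addr _ _) m2.
    have hq : q (iter i F (c j0)) - q z <= 11 * eps1 by lfin kLq2.
    have h := @r_ahead _ m _ ikL hq; rewrite im mT in h; have {}h := h isT.
    have h' : nu%:R * om <= (m%:R - i%:R) * om.
      by rewrite ler_wpM2r // lerBrDl -natrD ler_nat.
    by move: B3; lfin h h'.
  rewrite /far_gate; apply: le_trans grg _.
  have dr : `|(r m - iter m F (c j0)) - (r i - iter i F (c j0))| <= 2 * M * nu%:R.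
    have [mi2|im2] := leqP m i.
      rewrite distrC; apply: le_trans (rel_drift r0 (c j0) mi2) _.
      by rewrite ler_wpM2l ?mulr_ge0 // lerBlDr -natrD ler_nat addnC ltnW.
    apply: le_trans (rel_drift r0 (c j0) (ltnW im2)) _.
    by rewrite ler_wpM2l ?mulr_ge0 // lerBlDl -natrD ler_nat ltnW.
  have g1 := edotp (r i - iter i F (c j0)); have g2 := edotp (r i - z).
  have g3 := ler_normB ((r m - iter m F (c j0)) - (r i - iter i F (c j0))) (r m - iter m F (c j0)).
  have e1 : r m - iter m F (c j0) - (r i - iter i F (c j0)) - (r m - iter m F (c j0)) =
    - (r i - iter i F (c j0)) by rewrite addrAC subrr add0r.
  rewrite e1 normrN in g3; move: r_gr B4 g1 g2.
  rewrite !dotpBr !ler_norml => b1 b4 /andP[g1 _] /andP[_ g2].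
  by lfin b1 b4 g1 g2 g3 dr kLe.
have bfar m : (i + nu <= m <= T)%N -> farF r g b m.
  move=> /andP[m2 mT]; apply: far_r; apply: nP; have im := leq_trans (leq_addr _ _) m2.
  have hq : q z - q z <= 0 by rewrite subrr.
  have h := @r_ahead _ m _ ib hq; rewrite im mT in h; have {}h := h isT.
  have h' : nu%:R * om <= (m%:R - i%:R) * om.
    by rewrite ler_wpM2r // lerBrDl -natrD ler_nat.
  by move: B3; lfin h h' eps0'.
have wrb := r_wind_b.
(* The orbits of y and b meet at time my and share the drift kq, which is at most 0: this costs 8
   eps1 for b and one each for the meeting and for y. *)
have yq n : (i + nu <= n <= T)%N -> q (orb F y0 n) <= q z + 10 * eps1.
  move=> /andP[n1n nT]; have im : (i <= n)%N := leq_trans (leq_addr _ _) n1n.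
  have imy : (i <= my)%N := leq_trans (leq_addr _ _) n1my.
  have g1 := inner_drift ib n0i imy (ltnW myT).
  have g2 : `|q (orb F y0 my - iter my F b)| <= eps1.
    by apply: le_trans (qdotp _) _; apply: le_trans Qrho; rewrite ler_pM2l // ltW.
  have kqn : kq * (n%:R - i%:R) <= 0 by rewrite mulr_le0_ge0 // subr_ge0 ler_nat.
  move: g1 g2; rewrite !dotpBr !ler_norml => /andP[a1 a2] /andP[a3 a4].
  have [myn|nmy] := leqP my n.
    have mm : (my <= n <= Tm)%N by rewrite myn (leq_trans nT).
    have g3 : `|q (orb F y0 n) - q (orb F y0 my) - kq * (n%:R - my%:R)| <= eps1.
      apply: expo_bot => //; have h := yb _ _ mm; rewrite /orb in h.
      by move: er0 er_la; lfin h.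
    move: g3; rewrite ler_norml => /andP[a5 a6].
    by lfin a1 a2 a3 a4 a5 a6 kqn.
  have mm : (n <= my <= Tm)%N by rewrite (ltnW nmy) (leq_trans (ltnW myT)).
  have g3 : `|q (orb F y0 my) - q (orb F y0 n) - kq * (my%:R - n%:R)| <= eps1.
    apply: expo_bot => //; have h := yb _ _ mm; rewrite /orb in h.
    by move: er0 er_la; lfin h.
  move: g3; rewrite ler_norml => /andP[a5 a6].
  by lfin a1 a2 a3 a4 a5 a6 kqn.
have gy5 := grad_rho uy5.
have n0n1 : (n0 <= i + nu <= T)%N by rewrite inuT andbT; exact: n0n.
have := @gate_obstruction R 0 M F FF r g n0 (orb F y0) uy T (i + nu) j0 c
  (orb_orbit _ _) (orb_orbit _ _) gF uyF n0n1.
have subc j : (j <= j0)%N -> C (c j) /\ inner (c j) /\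
    e (iter i F (c j)) <= e z + nn + 12 + 3 * rho + 2 * er.
  move=> jj; have Cj : C (c j) by apply: cC; exact: leq_trans jj (ltnW j0L).
  by split => //; exact: sub Cj (wj j jj).
rewrite c0 wrb => H; move: wy; apply/negP; rewrite negbK.
suff : windF (orb F y0) uy (i + nu) T b * (2 * pi) == 0.
  rewrite mulf_eq0 => /orP[//|/eqP pi0]; have := @pi_gt0 R; lra.
apply/eqP; apply: H.
- move=> j jj; have [Cj [[_ sj zj] _]] := subc j jj; have [_ [ij _]] := subc j jj.
  have hq : q z - q (iter i F (c j)) <= Q * PP.
    have h := qdotp (iter i F (c j) - z).
    have h' : Q * `|iter i F (c j) - z| <= Q * PP by rewrite ler_pM2l.
    move: h; rewrite dotpBr ler_norml => /andP[h _]; lfin h h'.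
  have h := @r_behind _ n0 _ ij hq; rewrite leqnn n0i in h; have {}h := h isT.
  by apply: far_r; apply: nN; move: B5; lfin h.
- by move=> j jj; apply: fy; have [] := subc j jj.
- move=> j jj; have jL : (j < L)%N by apply: ltn_trans jj j0L.
  have [[_ t]|[_ t]] := cQ j jL; [left|right] => n /andP[n1n nT]; exact: t.
- move=> n /andP[n1n nT]; have im : (i <= n)%N := leq_trans (leq_addr _ _) n1n.
  have h1' := yq n; rewrite n1n nT in h1'; have {}h1' := h1' isT.
  have h2' := rb (m := i) (m' := n); rewrite im (leq_trans nT TTm) in h2'.
  have {}h2' := h2' isT.
  have h3' : nu%:R * om <= (n%:R - i%:R) * om.
    by rewrite ler_wpM2r // lerBrDl -natrD ler_nat.
  have h4' := qdotp (r n - orb F y0 n).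
  have sr : Q * sradF g uy <= Q * rg + eps1.
    apply: (@le_trans _ _ (Q * (rg + (rho + 2 * M)))).
      rewrite ler_pM2l // /sep_rad normr0 addr0 mul1r.
      by have g' := grg; lfin g' gy5.
    by rewrite mulrDr lerD2l; apply: le_trans eps_big; rewrite ler_pM2l //; lfin M0'.
  rewrite -(ler_pM2l Q0); apply: le_trans sr _; apply: le_trans h4'.
  apply: nP; rewrite dotpBr.
  have rq := r_q; rewrite dotpBr ler_norml in rq; move: rq => /andP[rq _].
  by move: B3; lfin h1' h2' h3' rq eps0'.
- move=> n /andP[n1n nT]; split; first by apply: bfar; rewrite n1n ltnW.
  by apply: kLfar; rewrite (ltnW nT) andbT n0n.
- apply: (wind_far FF (orb_orbit _ _)) => //; first by case/andP: n0n1.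
  move=> m /andP[n0m mn1]; apply: kLfar; rewrite n0m /=.
  exact: leq_trans (ltnW mn1) inuT.
move=> j jj; have [Cj [ij ej]] := subc j jj; case; rewrite /far_gate.
apply: le_trans gy5 _.
have h1' := top (c j) (m := i) (m' := i + nu); rewrite leq_addr n1T in h1'.
have {}h1' := h1' isT; rewrite natrD (addrC (i%:R : R)) addrK in h1'.
have h2' := edotp (orb F y0 (i + nu) - iter (i + nu) F (c j)).
move: h2' y1; rewrite !dotpBr ler_norml => /andP[_ h2'] y1'.
move: B6 er_la la_big; rewrite mulrDr; lfin h1' h2' y1' ej bn2 M0' er0'.
Unshelve. all: by end_near. Qed.

End SlidingGate.

End LatticeGates.

(** * The climbing direction and its frame *)

Section Combine.
Context {R : realType}.
Variables (T : Type) (F : T -> T) (z0 : T).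

Lemma growth_combine (phi phi1 phi2 : T -> R) (B B1 B2 c : R) :
  (forall z, `|phi (F z) - phi z| <= B) ->
  (forall z, `|phi1 (F z) - phi1 z| <= B1) ->
  (forall z, `|phi2 (F z) - phi2 z| <= B2) ->
  (forall n z, c * gain F phi n z <= gain F phi1 n z + gain F phi2 n z) -> 0 < c ->
  c * growth F phi <= growth F phi1 + growth F phi2.
Proof.
move=> hB hB1 hB2 hc c0; apply/ler_addgt0Pr => e e0.
have e4 : 0 < e / 4 by lra.
have [C1 C10 h1] := gain_le z0 hB1 e4.
have [C2 C20 h2] := gain_le z0 hB2 e4.
near \oo => n.
have n1 : 1 <= n%:R :> R by rewrite -[n%:R]mul1r; near: n; exact: near_linear.
have hC : C1 + C2 + c <= e / 4 * n%:R by near: n; exact: near_linear.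
have [z hz] := max_gain_attained z0 hB n ltr01.
have h3 := growth_le_max z0 hB n.
have h4 : c * (n%:R * growth F phi - 1) <= c * gain F phi n z.
  by rewrite ler_pM2l //; lra.
have h5 := hc n z; have h6 := h1 n z; have h7 := h2 n z.
have n0 : 0 < n%:R :> R by lra.
have h8 : 0 <= e / 4 * n%:R by rewrite mulr_ge0 ?ltW.
rewrite -(ler_pM2l n0).
clear - h4 h5 h6 h7 h8 hC; lra.
Unshelve. all: by end_near. Qed.

Lemma growth_le_step (phi : T -> R) (B : R) :
  (forall z, `|phi (F z) - phi z| <= B) -> growth F phi <= B.
Proof.
move=> hB; have := growth_le_max z0 hB 1; rewrite mul1r => h.
by have := max_gain_norm z0 hB 1; rewrite mul1r => h2; have := ler_norm (max_gain F phi 1); lra.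
Qed.

End Combine.

(** Otherwise the first difference would grow by more than n kap, hence by more than 2 L, from a
    value at least - L to one at most L. *)
Lemma pigeonhole_diff (R : realFieldType) (a : nat -> R) (L kap : R) n :
  (0 < n)%N -> a n.+1 - a n <= L -> - L <= a 1%N - a 0%N -> 2 * L <= n%:R * kap ->
  exists2 j, (j < n)%N & a j.+2 + a j - 2 * a j.+1 <= kap.
Proof.
move=> n0 h1 h2 hL; apply: contrapT => hn.
have hj j : (j < n)%N -> kap < a j.+2 + a j - 2 * a j.+1.
  by move=> jn; rewrite ltNge; apply/negP => h; apply: hn; exists j.
have key m : (0 < m <= n)%N -> m%:R * kap < (a m.+1 - a m) - (a 1%N - a 0%N).
  elim: m => // m IH /andP[_ mn].
  have h := hj m mn; case: m IH mn h => [|m] IH mn h; first by rewrite mul1r; lra.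
  by have := IH (ltnW mn); rewrite -[m.+2%:R]natr1; lra.
have := key n; rewrite n0 leqnn => /(_ isT); lra.
Qed.

Section Directions.
Context {R : realType}.
Variables (M : R) (F : R * R -> R * R).
Hypothesis FF : near_shear 0 M F.
Implicit Types (w v p : R * R).

(** As a function of w this is the support function of the rotation set. *)
Definition hgrowth w : R := growth F (dotp w).

Lemma dotp_step w z : `|dotp w (F z) - dotp w z| <= norm1 w * M.
Proof.
rewrite -dotpBr; apply: le_trans (dotp_norm1 _ _) _; rewrite ler_wpM2l ?norm1_ge0 //.
have h := displ_norm FF z; rewrite /displ in h.
have e1 : shear 0 z = z by rewrite /shear mul0r addr0 -surjective_pairing.
by rewrite e1 in h.
Qed.

Lemma hgrowth_le w : hgrowth w <= norm1 w * M.
Proof. by rewrite /hgrowth; apply: (growth_le_step (0 : R * R)); exact: dotp_step. Qed.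

Lemma hgrowth_add w v : hgrowth (w + v) <= hgrowth w + hgrowth v.
Proof.
rewrite -[X in X <= _]mul1r.
apply: (growth_combine (0 : R * R) (dotp_step _) (dotp_step _) (dotp_step _)) => // n z.
by rewrite /gain /dotp /=; lra.
Qed.

Lemma hgrowth_mid w v : 2 * hgrowth w <= hgrowth (w + v) + hgrowth (w - v).
Proof.
apply: (growth_combine (0 : R * R) (dotp_step _) (dotp_step _) (dotp_step _)) => // n z.
by rewrite /gain /dotp /=; lra.
Qed.

Lemma norm1N w : norm1 (- w) = norm1 w. Proof. by rewrite /norm1 /= !normrN. Qed.

Lemma norm1Z (a : R) w : norm1 (a *: w) = `|a| * norm1 w.
Proof.
change (`|a * w.1| + `|a * w.2| = `|a| * (`|w.1| + `|w.2|)).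
by rewrite !normrM; ring.
Qed.

Lemma hgrowth_lip w v : hgrowth (w + v) - hgrowth w <= norm1 v * M.
Proof. by have := hgrowth_add w v; have := hgrowth_le v; lra. Qed.

(* The growth rate is convex and Lipschitz, so on a fine grid of directions the second
   difference is small somewhere, simultaneously for both orientations. *)
Lemma direction_exists v p (de kap : R) : 0 < de -> 0 < kap ->
  exists tau t : R, [/\ 0 < tau, `|t| <= de,
    hgrowth (v + t *: p + tau *: p) + hgrowth (v + t *: p - tau *: p)
      - 2 * hgrowth (v + t *: p) <= kap * tau &
    hgrowth (- (v + t *: p) + tau *: p) + hgrowth (- (v + t *: p) - tau *: p)
      - 2 * hgrowth (- (v + t *: p)) <= kap * tau].
Proof.
move=> de0 kap0; have M0 := M_ge0 FF; have p0 := norm1_ge0 p.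
near \oo => J.
have hJ : 4 * (norm1 p * M) <= kap * J%:R by near: J; exact: near_linear.
have J0 : (0 < J)%N by near: J; exact: near_geq.
have J0' : 0 < J%:R :> R by rewrite ltr0n.
pose tau := de / J%:R; have tau0 : 0 < tau by rewrite divr_gt0.
pose t (j : nat) : R := (j%:R - J%:R) * tau.
pose w j := v + t j *: p.
have wS j : w j.+1 = w j + tau *: p.
  have tS : t j.+1 = t j + tau by rewrite /t -natr1; ring.
  by rewrite /w tS scalerDl addrA.
(* Second differences of each summand are nonnegative by [hgrowth_mid], so a small second difference
   of the sum makes both small. *)
pose a j := hgrowth (w j) + hgrowth (- w j).
have ntau : norm1 (tau *: p) = tau * norm1 p by rewrite norm1Z gtr0_norm.
have a1 j : a j.+1 - a j <= 2 * (tau * norm1 p * M) /\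
    - (2 * (tau * norm1 p * M)) <= a j.+1 - a j.
  have l1 := hgrowth_lip (w j) (tau *: p).
  have l2 := hgrowth_lip (w j.+1) (- (tau *: p)).
  have l3 := hgrowth_lip (- w j) (- (tau *: p)).
  have l4 := hgrowth_lip (- w j.+1) (tau *: p).
  rewrite ?norm1N ntau in l1 l2 l3 l4.
  have e1 : w j.+1 - tau *: p = w j by rewrite wS addrK.
  have e2 : - w j - tau *: p = - w j.+1 by rewrite wS [RHS]opprD.
  have e3 : - w j.+1 + tau *: p = - w j by rewrite wS opprD addrNK.
  rewrite -wS in l1; rewrite e1 in l2; rewrite e2 in l3; rewrite e3 in l4.
  rewrite /a; move: (hgrowth (w j)) (hgrowth (w j.+1)) (hgrowth (- w j))
    (hgrowth (- w j.+1)) l1 l2 l3 l4 => x1 x2 x3 x4; clear.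
  by move=> l1 l2 l3 l4; split; lra.
have [n [n0 Jn nJ]] : exists n, [/\ (0 < n)%N, (J <= n)%N & (n <= 2 * J)%N].
  by exists J; split => //; rewrite leq_pmull.
have [|||j jJ hj] := @pigeonhole_diff R a (2 * (tau * norm1 p * M)) (kap * tau) n n0.
- exact: (a1 n).1.
- exact: (a1 0%N).2.
- have h : J%:R <= n%:R :> R by rewrite ler_nat.
  have h1 : kap * J%:R <= kap * n%:R by rewrite ler_pM2l.
  have h2 : tau * (4 * (norm1 p * M)) <= tau * (kap * n%:R).
    by rewrite ler_pM2l //; exact: le_trans hJ h1.
  by clear - h2; lra.
have m1 := hgrowth_mid (w j.+1) (tau *: p); have m2 := hgrowth_mid (- w j.+1) (tau *: p).
have e1 : w j.+1 - tau *: p = w j by rewrite wS addrK.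
have e2 : - w j.+1 - tau *: p = - w j.+2 by rewrite [w j.+2]wS [RHS]opprD.
have e3 : - w j.+1 + tau *: p = - w j by rewrite wS opprD addrNK.
exists tau, (t j.+1); split => //.
- rewrite /t normrM (gtr0_norm tau0) /tau mulrA ler_pdivrMr // mulrC ler_pM2l //.
  have j1 : j.+1%:R <= 2 * J%:R :> R.
    by rewrite -natrM ler_nat (leq_trans jJ).
  have j2 : 0 <= j.+1%:R :> R by [].
  by rewrite ler_norml; apply/andP; split; clear - j1 j2; lra.
- rewrite -/(w j.+1) -wS e1; rewrite -wS e1 in m1; rewrite e2 e3 in m2.
  rewrite /a in hj; move: (hgrowth (w j)) (hgrowth (w j.+1)) (hgrowth (w j.+2))
    (hgrowth (- w j)) (hgrowth (- w j.+1)) (hgrowth (- w j.+2)) m1 m2 hj.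
  by clear=> *; lra.
rewrite -/(w j.+1) e2 e3; rewrite -wS e1 in m1; rewrite e2 e3 in m2.
rewrite /a in hj; move: (hgrowth (w j)) (hgrowth (w j.+1)) (hgrowth (w j.+2))
    (hgrowth (- w j)) (hgrowth (- w j.+1)) (hgrowth (- w j.+2)) m1 m2 hj.
by clear=> *; lra.
Unshelve. all: by end_near. Qed.

End Directions.

(* [a], [b], [hp], [hm] stand for a displacement along [ev] and [p] and for the growth
   rates in the two nearby directions [ev + tau p] and [ev - tau p]. *)
Lemma exposed (R : realFieldType) (a b h hp hm tau kap er la n : R) :
  0 < tau -> 0 <= n -> hp + hm - 2 * h <= kap * tau ->
  a + tau * b <= n * hp + er -> a - tau * b <= n * hm + er ->
  n * h - 10 * la <= a ->
  `|b - n * ((hp - hm) / (2 * tau))| <= n * (kap / 2) + (er + 10 * la) / tau.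
Proof.
move=> t0 n0 sd h1 h2 ha.
have sd' := ler_wpM2l n0 sd.
rewrite -(ler_pM2l t0) -[X in X * `|_|](gtr0_norm t0) -normrM.
have -> : tau * (b - n * ((hp - hm) / (2 * tau))) = tau * b - n * (hp - hm) / 2.
  by field; rewrite gt_eqF.
have -> : tau * (n * (kap / 2) + (er + 10 * la) / tau) = n * (kap * tau) / 2 + (er + 10 * la).
  by field; rewrite gt_eqF.
rewrite ler_norml; apply/andP; split; clear - sd' h1 h2 ha; lra.
Qed.

(** Half of zeta N pays for the second difference over n steps. The other half pays for the slack 10
    la, divided by tau and multiplied by the tilt sl; this is the condition on lam. *)
Lemma exposed_pair (R : realFieldType)
    (h1 h2 hp hm gp gm tau zeta K lam sl kq B a b n N la er : R) :
  0 < tau -> 0 < K -> 0 <= zeta ->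
  hp + hm - 2 * h1 <= zeta / K * tau -> gp + gm - 2 * h2 <= zeta / K * tau ->
  kq = (hp - hm) / (2 * tau) - sl * h1 -> kq = - ((gm - gp) / (2 * tau)) + sl * h2 ->
  `|sl| <= B -> lam * (11 / tau + 10 * B) <= zeta / 2 ->
  0 <= n <= K * N -> 0 < N -> la = lam * N -> 0 <= er -> 10 * er <= la ->
  a <= n * h1 + er -> - a <= n * h2 + er ->
  a + tau * b <= n * hp + er -> a - tau * b <= n * hm + er ->
  - a + tau * b <= n * gp + er -> - a - tau * b <= n * gm + er ->
  (n * h1 - 10 * la <= a -> `|b - sl * a - kq * n| <= zeta * N) /\
  (n * h2 - 10 * la <= - a -> `|b - sl * a - kq * n| <= zeta * N).
Proof.
move=> tau0 K0 z0 sd1 sd2 kq1 kq2 sB lam2 /andP[n0 nK] N0 laE er0 erla ha hNa hw1 hw2 hw3 hw4.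
have la0 : 0 <= la by clear - er0 erla; lra.
have bnd : n * (zeta / K / 2) + (er + 10 * la) / tau + `|sl| * (10 * la) <= zeta * N.
  have b1 : n * (zeta / K / 2) <= zeta * N / 2.
    have -> : zeta * N / 2 = K * N * (zeta / K / 2) by field; rewrite gt_eqF.
    by rewrite ler_wpM2r // !divr_ge0 // ltW.
  have b2 : (er + 10 * la) / tau <= la * (11 / tau).
    rewrite mulrA ler_pM2r ?invr_gt0 //; clear - erla la0; lra.
  have b3 : `|sl| * (10 * la) <= B * (10 * la) by rewrite ler_wpM2r // mulr_ge0.
  have b4 : lam * (11 / tau + 10 * B) * N <= zeta / 2 * N by rewrite ler_pM2r.
  rewrite laE in b3 b2 *; clear - b1 b2 b3 b4; lra.
split=> hx.
  have e1 := exposed tau0 n0 sd1 hw1 hw2 hx.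
  have -> : b - sl * a - kq * n = (b - n * ((hp - hm) / (2 * tau))) - sl * (a - n * h1).
    by rewrite kq1; ring.
  apply: le_trans (ler_normB _ _) _; rewrite normrM.
  have e2 : `|sl| * `|a - n * h1| <= `|sl| * (10 * la).
    rewrite ler_wpM2l // ler_norml; apply/andP; split; clear - hx ha erla la0; lra.
  by clear - e1 e2 bnd; lra.
have sd2' : gm + gp - 2 * h2 <= zeta / K * tau by rewrite [gm + gp]addrC.
have hw3' : - a + tau * - b <= n * gm + er by clear - hw4; lra.
have hw4' : - a - tau * - b <= n * gp + er by clear - hw3; lra.
have e1 := exposed tau0 n0 sd2' hw3' hw4' hx.
have -> : b - sl * a - kq * n =
    - (- b - n * ((gm - gp) / (2 * tau))) + sl * (- a - n * h2) by rewrite kq2; ring.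
apply: le_trans (ler_normD _ _) _; rewrite normrN normrM.
have e2 : `|sl| * `|- a - n * h2| <= `|sl| * (10 * la).
  rewrite ler_wpM2l // ler_norml; apply/andP; split; clear - hx hNa erla la0; lra.
by clear - e1 e2 bnd; lra.
Qed.

(** * A direction of almost differentiable growth and its tilted transverse vector *)

Section Frame.
Context {R : realType}.
Variables (M : R) (F : R * R -> R * R).
Hypothesis FF : near_shear 0 M F.
Implicit Types (w v p d : R * R).
Local Notation hg := (hgrowth F).

Lemma norm1D w v : norm1 (w + v) <= norm1 w + norm1 v.
Proof.
rewrite /norm1 /=; have := ler_normD w.1 v.1; have := ler_normD w.2 v.2; lra.
Qed.

Lemma norm1_sqr w : dotp w w <= norm1 w ^+ 2.
Proof.
rewrite /norm1 /dotp -!expr2 -(real_normK (num_real w.1)) -(real_normK (num_real w.2)).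
have : 0 <= `|w.1| * `|w.2| by rewrite mulr_ge0.
by rewrite sqrrD; lra.
Qed.

Lemma norm1_ge w (a : R) : 0 <= a -> a ^+ 2 <= dotp w w -> a <= norm1 w.
Proof.
move=> a0 h; have := le_trans h (norm1_sqr w).
by rewrite ler_sqr ?nnegrE ?norm1_ge0.
Qed.

Lemma dotpDl w v d : dotp (w + v) d = dotp w d + dotp v d.
Proof. by rewrite /dotp /=; ring. Qed.

Lemma dotpZl (a : R) w d : dotp (a *: w) d = a * dotp w d.
Proof. by rewrite dotpC dotpZr dotpC. Qed.

Lemma frame_exists v (E de zeta K : R) : dotp v v = 1 -> 1 <= M ->
  0 < E -> (forall w, E * norm1 w <= hg w) ->
  0 < de <= 1 / 2 -> 0 < zeta -> 0 < K ->
  exists ev qv w1 w2 w3 w4 (kq lam : R),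
  [/\ [/\ norm1 ev <= 3, 0 < dotp ev ev, E <= hg ev <= 3 * M, E <= hg (- ev) <= 3 * M &
        forall d, `|dotp v d - dotp ev d| <= 2 * de * `|d|],
      [/\ norm1 qv <= 2 + 6 * M / E, 1 / 4 <= dotp qv qv, E / 2 <= hg qv & kq <= 0],
      0 < lam <= 1 / 10 &
      forall d (n N la er : R), 0 <= n <= K * N -> 0 < N -> la = lam * N -> 0 <= er ->
        10 * er <= la ->
        dotp ev d <= n * hg ev + er -> dotp (- ev) d <= n * hg (- ev) + er ->
        dotp w1 d <= n * hg w1 + er -> dotp w2 d <= n * hg w2 + er ->
        dotp w3 d <= n * hg w3 + er -> dotp w4 d <= n * hg w4 + er ->
        (n * hg ev - 10 * la <= dotp ev d -> `|dotp qv d - kq * n| <= zeta * N) /\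
        (n * hg (- ev) - 10 * la <= - dotp ev d -> `|dotp qv d - kq * n| <= zeta * N)].
Proof.
move=> v1 M1 E0 hE /andP[de0 de1] z0 K0.
pose p := quarter v.
have vp : dotp v p = 0 by rewrite /p /quarter /dotp /=; ring.
have pp : dotp p p = 1 by rewrite -v1 /p /quarter /dotp /=; ring.
have v2 : norm1 v <= 2.
  have s1 : `|v.1| <= 1.
    rewrite -[_ <= _](@ler_sqr R) ?nnegrE // expr1n real_normK ?num_real // -v1 /dotp -!expr2.
    by rewrite lerDl sqr_ge0.
  have s2 : `|v.2| <= 1.
    rewrite -[_ <= _](@ler_sqr R) ?nnegrE // expr1n real_normK ?num_real // -v1 /dotp -!expr2.
    by rewrite lerDr sqr_ge0.
  by rewrite /norm1; lra.
have p2 : norm1 p <= 2 by rewrite /norm1 /p /quarter /= normrN addrC.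
have kap0 : 0 < zeta / K by rewrite divr_gt0.
have [tau [t [tau0 tde sd1 sd2]]] := direction_exists FF v p de0 kap0.
set ev := v + t *: p in sd1 sd2.
have ev3 : norm1 ev <= 3.
  apply: le_trans (norm1D _ _) _; rewrite norm1Z.
  have h : `|t| * norm1 p <= 1 / 2 * 2 by apply: ler_pM => //; [exact: norm1_ge0|exact: le_trans de1].
  by clear - h v2; lra.
have evev : dotp ev ev = 1 + t ^+ 2.
  have pv : dotp p v = 0 by rewrite dotpC.
  by rewrite /ev !dotpDl !dotpDr !dotpZl !dotpZr vp pv v1 pp; ring.
have ev1 : 1 <= norm1 ev.
  by apply: norm1_ge => //; rewrite expr1n evev lerDl sqr_ge0.
have M0 : 0 <= M := le_trans ler01 M1.
have hle w : hg w <= norm1 w * M := hgrowth_le FF w.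
have h3 w : norm1 w <= 3 -> 1 <= norm1 w -> E <= hg w <= 3 * M.
  move=> w3 w1; apply/andP; split.
    by apply: le_trans (hE w); rewrite -[X in X <= _]mulr1 ler_pM2l.
  by apply: le_trans (hle w) _; rewrite ler_wpM2r // M0.
have h1b := h3 ev ev3 ev1.
have h2b : E <= hg (- ev) <= 3 * M by apply: h3; rewrite norm1N.
have taup : norm1 (tau *: p) <= 2 * tau.
  by rewrite norm1Z gtr0_norm // mulrC ler_wpM2r // ltW.
have lip w : `|hg (w + tau *: p) - hg (w - tau *: p)| <= 4 * tau * M.
  have b1 : norm1 (tau *: p) * M <= 2 * tau * M by rewrite ler_wpM2r.
  have b2 : norm1 (- (tau *: p)) * M <= 2 * tau * M by rewrite norm1N.
  have a1 := hgrowth_lip FF w (tau *: p); have a2 := hgrowth_lip FF w (- (tau *: p)).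
  have a3 := hgrowth_lip FF (w - tau *: p) (tau *: p); rewrite subrK in a3.
  have a4 := hgrowth_lip FF (w + tau *: p) (- (tau *: p)); rewrite addrK in a4.
  move: (hg w) (hg (w + tau *: p)) (hg (w - tau *: p)) a1 a2 a3 a4 b1 b2.
  move: (norm1 (tau *: p) * M) (norm1 (- (tau *: p)) * M) => n1 n2 x1 x2 x3; clear=> *.
  by rewrite ler_norml; apply/andP; split; lra.
have l1 := lip ev; have l2 := lip (- ev).
exists ev.
have [h1 h1E] : exists x, hg ev = x by eexists.
have [h2 h2E] : exists x, hg (- ev) = x by eexists.
have [hp hpE] : exists x, hg (ev + tau *: p) = x by eexists.
have [hm hmE] : exists x, hg (ev - tau *: p) = x by eexists.
have [gp gpE] : exists x, hg (- ev + tau *: p) = x by eexists.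
have [gm gmE] : exists x, hg (- ev - tau *: p) = x by eexists.
rewrite h1E h2E hpE hmE gpE gmE in h1b h2b l1 l2 sd1 sd2 *.
case/andP: h1b => h1a h1b; case/andP: h2b => h2a h2b.
pose c1 := (hp - hm) / (2 * tau); pose c2 := (gm - gp) / (2 * tau).
have tau2 : 0 < 2 * tau by rewrite mulr_gt0.
have c1M : `|c1| <= 2 * M.
  rewrite /c1 normrM normfV (gtr0_norm tau2) ler_pdivrMr //.
  by apply: le_trans l1 _; clear; lra.
have c2M : `|c2| <= 2 * M.
  rewrite /c2 normrM normfV (gtr0_norm tau2) ler_pdivrMr // distrC.
  by apply: le_trans l2 _; clear; lra.
have hh : 0 < h1 + h2 by rewrite addr_gt0 //; [exact: lt_le_trans h1a|exact: lt_le_trans h2a].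
(* Rising extremal orbits drift along p at rate c1, falling ones at rate - c2. Along p - s ev the
   rates become c1 - s h1 and - c2 + s h2, and this s makes them equal. *)
pose s := (c1 + c2) / (h1 + h2).
have sM : `|s| <= 2 * M / E.
  rewrite /s normrM normfV (gtr0_norm hh) ler_pdivrMr //.
  have h : `|c1 + c2| <= 4 * M by apply: le_trans (ler_normD _ _) _; clear - c1M c2M; lra.
  apply: le_trans h _; have -> : 4 * M = 2 * M / E * (2 * E) by field; rewrite gt_eqF.
  apply: ler_wpM2l; first by rewrite divr_ge0 ?mulr_ge0 // ltW.
  by clear - h1a h2a; lra.
have sE : s * (h1 + h2) = c1 + c2 by rewrite /s mulfVK // gt_eqF.
pose q0 := p - s *: ev; pose kq0 := c1 - s * h1.
have kqE : kq0 = - c2 + s * h2 by rewrite /kq0; move: sE; clear; lra.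
have q0Q : norm1 q0 <= 2 + 6 * M / E.
  apply: le_trans (norm1D _ _) _; rewrite norm1N norm1Z.
  have h : `|s| * norm1 ev <= 2 * M / E * 3 by apply: ler_pM => //; exact: norm1_ge0.
  by clear - h p2; lra.
have q0q0 : 1 / 4 <= dotp q0 q0.
  have pv : dotp p v = 0 by rewrite dotpC.
  have -> : dotp q0 q0 = (1 - s * t) ^+ 2 + s ^+ 2.
    have pe : dotp p ev = t by rewrite /ev dotpDr dotpZr pv pp; ring.
    have ep : dotp ev p = t by rewrite dotpC.
    have -> : dotp q0 q0 = dotp p p - s * dotp p ev - s * dotp ev p + s ^+ 2 * dotp ev ev.
      rewrite /q0 dotpDl dotpNl dotpZl !dotpBr !dotpZr; ring.
    by rewrite pe ep evev pp; ring.
  have t1 : `|t| <= 1 / 2 := le_trans tde de1.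
  have [s1|s1] := leP (1 / 2) `|s|.
    have h : (1 / 2) ^+ 2 <= `|s| ^+ 2 by rewrite ler_sqr ?nnegrE // divr_ge0.
    rewrite real_normK ?num_real // in h; have h' := sqr_ge0 (1 - s * t).
    by clear - h h'; rewrite !expr2 in h h' *; lra.
  have st : `|s * t| <= 1 / 2 * (1 / 2) by rewrite normrM; apply: ler_pM => //; exact: ltW.
  have h : (1 / 2) ^+ 2 <= (1 - s * t) ^+ 2.
    by move: st; rewrite ler_norml => /andP[_ st]; clear - st; rewrite ler_sqr ?nnegrE; lra.
  by have h' := sqr_ge0 s; clear - h h'; rewrite !expr2 in h h' *; lra.
have q0h w : 1 / 4 <= dotp w w -> E / 2 <= hg w.
  move=> hw; have w1 : 1 / 2 <= norm1 w.
    by apply: norm1_ge; [rewrite divr_ge0|clear - hw; rewrite expr2; lra].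
  by apply: le_trans (hE w); have h := ler_wpM2l (ltW E0) w1; rewrite mulrA mulr1 in h.
have X0 : 0 < 11 / tau + 10 * (2 * M / E).
  have M00 : 0 < M := lt_le_trans ltr01 M1.
  by apply: addr_gt0; [|apply: mulr_gt0 => //]; apply: divr_gt0 => //; apply: mulr_gt0.
pose lam := Num.min (1 / 10) (zeta / (2 * (11 / tau + 10 * (2 * M / E)))).
have lam0 : 0 < lam by rewrite lt_min; apply/andP; split; rewrite divr_gt0 // mulr_gt0.
have lam1 : lam <= 1 / 10 by rewrite ge_min lexx.
have lam2 : lam * (11 / tau + 10 * (2 * M / E)) <= zeta / 2.
  have : lam <= zeta / (2 * (11 / tau + 10 * (2 * M / E))) by rewrite ge_min lexx orbT.
  by rewrite ler_pdivlMr ?mulr_gt0 // => h; clear - h; lra.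
have main d (n N la er : R) : 0 <= n <= K * N -> 0 < N -> la = lam * N -> 0 <= er ->
    10 * er <= la ->
    dotp ev d <= n * h1 + er -> - dotp ev d <= n * h2 + er ->
    dotp ev d + tau * dotp p d <= n * hp + er -> dotp ev d - tau * dotp p d <= n * hm + er ->
    - dotp ev d + tau * dotp p d <= n * gp + er -> - dotp ev d - tau * dotp p d <= n * gm + er ->
    (n * h1 - 10 * la <= dotp ev d -> `|dotp q0 d - kq0 * n| <= zeta * N) /\
    (n * h2 - 10 * la <= - dotp ev d -> `|dotp q0 d - kq0 * n| <= zeta * N).
  have -> : dotp q0 d = dotp p d - s * dotp ev d.
    by rewrite /q0 dotpDl dotpNl dotpZl.
  exact: (exposed_pair tau0 K0 (ltW z0) sd1 sd2 (erefl kq0) kqE sM lam2).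
have q0N : dotp (- q0) (- q0) = dotp q0 q0 by rewrite dotpNl dotpC dotpNl opprK.
have vev d : `|dotp v d - dotp ev d| <= 2 * de * `|d|.
  have -> : dotp v d - dotp ev d = - (t * dotp p d) by rewrite /ev dotpDl dotpZl; ring.
  rewrite normrN normrM; apply: (@le_trans _ _ (de * (2 * `|d|))); last by clear; lra.
  apply: ler_pM => //; apply: le_trans (dotp_norm1 _ _) _.
  by rewrite ler_wpM2r.
have wE d : [/\ dotp (ev + tau *: p) d = dotp ev d + tau * dotp p d,
   dotp (ev - tau *: p) d = dotp ev d - tau * dotp p d,
   dotp (- ev + tau *: p) d = - dotp ev d + tau * dotp p d &
   dotp (- ev - tau *: p) d = - dotp ev d - tau * dotp p d].
  by split; rewrite dotpDl ?dotpNl dotpZl.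
(* Either sign of q0 is admissible; the one with nonpositive drift is kept, so that an orbit growing
   along qv overtakes the extremal ones. *)
have [kq0le|kq0gt] := leP kq0 0.
  exists q0, (ev + tau *: p), (ev - tau *: p), (- ev + tau *: p), (- ev - tau *: p), kq0, lam.
  split => //.
  - by split => //; rewrite ?h1a ?h2a // evev; apply: ltr_wpDr => //; exact: sqr_ge0.
  - by split => //; exact: q0h.
  - by rewrite lam0.
  move=> d n N la er nn N0 laE er0 erla; have [-> -> -> ->] := wE d.
  by rewrite dotpNl hpE hmE gpE gmE; exact: main.
exists (- q0), (ev + tau *: p), (ev - tau *: p), (- ev + tau *: p), (- ev - tau *: p), (- kq0), lam.
split => //.
- by split => //; rewrite ?h1a ?h2a // evev; apply: ltr_wpDr => //; exact: sqr_ge0.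
- by split; rewrite ?norm1N ?q0N //; [apply: q0h; rewrite q0N|rewrite oppr_le0 ltW].
- by rewrite lam0.
move=> d n N la er nn N0 laE er0 erla; have [-> -> -> ->] := wE d.
have -> : dotp (- q0) d - - kq0 * n = - (dotp q0 d - kq0 * n) by rewrite dotpNl; ring.
by rewrite dotpNl normrN hpE hmE gpE gmE; exact: main.
Qed.

End Frame.

(** * The case of a periodic displacement *)

Section Periodic.
Context {R : realType}.
Variables (M : R) (F : R * R -> R * R).
Hypothesis FF : near_shear 0 M F.
Hypothesis Fper : periodic_lift F.
Implicit Types (w v p d z : R * R).
Local Notation hg := (hgrowth F).

Lemma gains_bound w (tol K : R) : 0 < tol -> 0 < K -> \forall N \near \oo,
  forall Tm : nat, Tm%:R <= K * N%:R -> forall k m m', (m <= m' <= Tm)%N ->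
  dotp w (iter m' F k) - dotp w (iter m F k) <= (m'%:R - m%:R) * hg w + tol * N%:R.
Proof.
move=> t0 K0; have t1 : 0 < tol / (2 * K) by rewrite divr_gt0 // mulr_gt0.
have [C C0 hC] := gain_le (0 : R * R) (dotp_step FF w) t1.
near=> N => Tm TK k m m' /andP[mm mT].
have CN : C <= tol / 2 * N%:R by near: N; apply: near_linear; apply: divr_gt0; rewrite ?ltr0n.
have := hC (m' - m)%N (iter m F k); rewrite /gain -iterD subnK // natrB // => h.
have h1 : tol / (2 * K) * (m'%:R - m%:R) <= tol / (2 * K) * (K * N%:R).
  rewrite ler_pM2l //; apply: le_trans TK.
  by rewrite lerBlDr ler_wpDr // ler_nat.
have h2 : tol / (2 * K) * (K * N%:R) = tol / 2 * N%:R by field; rewrite gt_eqF.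
rewrite h2 in h1; rewrite -/(hgrowth F w) in h; move: (hg w) h => x h.
clear - h h1 CN; lra.
Unshelve. all: by end_near. Qed.

Lemma straight_bound w (tol K : R) : 0 < tol -> 0 < K -> \forall N \near \oo,
  forall Tm : nat, (N <= Tm)%N -> Tm%:R <= K * N%:R ->
  exists xs, forall m m', (m <= m' <= Tm)%N ->
  (m'%:R - m%:R) * hg w - tol * N%:R <= dotp w (iter m' F xs) - dotp w (iter m F xs).
Proof.
move=> t0 K0; have t1 : 0 < tol / K by rewrite divr_gt0.
have [N0 hN0] := growth_straight (0 : R * R) (dotp_step FF w) t1.
near=> N => Tm NT TK.
have N0N : (N0 <= N)%N by near: N; exact: near_geq.
have [xs hxs] := hN0 Tm (leq_trans N0N NT).
exists xs => m m' mm; have := hxs m m' mm; rewrite ler_norml => /andP[h _].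
have h1 : tol / K * Tm%:R <= tol * N%:R.
  have -> : tol * N%:R = tol / K * (K * N%:R) by field; rewrite gt_eqF.
  by rewrite ler_pM2l.
rewrite -/(hgrowth F w) in h; move: (hg w) h => x h.
clear - h h1; lra.
Unshelve. all: by end_near. Qed.

Lemma iter_near z k m i : iter i F k = z -> `|iter m F k - z| <= M * (m%:R + i%:R).
Proof.
have M0 := M_ge0 FF.
have step x : `|F x - x| <= M.
  have h := displ_norm FF x; rewrite /displ in h.
  have e1 : shear 0 x = x by rewrite /shear mul0r addr0 -surjective_pairing.
  by rewrite e1 in h.
have from0 n : `|iter n F k - k| <= M * n%:R.
  elim: n => [|n IH]; first by rewrite /= subrr normr0 mulr0.
  have -> : iter n.+1 F k - k = (F (iter n F k) - iter n F k) + (iter n F k - k).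
    by rewrite addrA subrK.
  apply: le_trans (ler_normD _ _) _.
  by rewrite -[n.+1%:R]natr1 mulrDr mulr1 addrC lerD.
move=> <-; have -> : iter m F k - iter i F k = (iter m F k - k) - (iter i F k - k).
  by rewrite opprB addrA subrK.
by apply: le_trans (ler_normB _ _) _; rewrite mulrDr lerD.
Qed.

Lemma no_trapped_point_periodic v (E : R) z : 1 <= M -> dotp v v = 1 -> norm1 v <= 3 -> 0 < E ->
  (forall w, E * norm1 w <= hg w) ->
  (forall i, exists C b, [/\ connected C, unbounded C, C b, iter i F b = z &
    forall k m, C k -> 0 <= dotp v (iter m F k)]) -> False.
Proof.
move=> M1 v1 v3 E0 hE H.
have M0 : 0 < M := lt_le_trans ltr01 M1.
pose Q := 2 + 6 * M / E.
have Q2 : 2 <= Q by rewrite lerDl divr_ge0 // ltW // mulr_gt0.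
have Q0 : 0 < Q := lt_le_trans (ltr0Sn R 1) Q2.
have MQ0 : 0 < M * Q by exact: mulr_gt0.
pose ME := M / E; have ME0 : 0 < ME by exact: divr_gt0.
pose EM := E / M; have EM0 : 0 < EM by exact: divr_gt0.
(* The sliding gate will extend about al N [nv] to either side of z; al is so small that its radius
   times Q, about EM N / 200, is outrun within nu steps, which yield at least about EM N / 24. *)
pose al := EM / (800 * Q ^+ 2).
have al0 : 0 < al by apply: divr_gt0; [exact: EM0|apply: mulr_gt0; [rewrite ltr0n|exact: exprn_gt0]].
(* Transverse errors are multiples of ze N and must stay below mu om, which is at least about al EM
   N / (32 Q). *)
pose ze := al * EM / (4000 * Q).
have ze0 : 0 < ze.
  by apply: divr_gt0; [exact: mulr_gt0|apply: mulr_gt0; [rewrite ltr0n|exact: Q0]].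
pose cst (x : R) := (Num.truncn x).+1.
have cstP x : x <= (cst x)%:R by apply: ltW; exact: truncnS_gt.
(* Phases, in units of N: A before n0, C2 from n0 to i, Cr from i + nu to T, A2 after T. C2 lets the
   sliding gate start behind all inner orbits ([B5]), Cr lets y come down ([B7]), A and A2 leave
   room for climbing and descending ([in1], [in2]). *)
pose C2 := cst (2 / E * (9 * Q * ME + 3)).
pose Cr := cst (8 / E).
pose A := cst ((27 * ME + 3 * M * C2%:R + 6) / E).
pose A2 := cst ((27 * ME + 3 * M * (Cr%:R + 1) + 6) / E).
have C2P : 9 * Q * ME + 3 <= C2%:R * (E / 2).
  have h := cstP (2 / E * (9 * Q * ME + 3)); rewrite -/C2 in h.
  have := ler_wpM2r (ltW (divr_gt0 E0 (ltr0Sn R 1))) h.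
  have -> : 2 / E * (9 * Q * ME + 3) * (E / 2) = 9 * Q * ME + 3 by field; rewrite gt_eqF.
  exact.
have CrP : 8 <= Cr%:R * E by rewrite -ler_pdivrMr //; exact: cstP.
have AP : 27 * ME + 3 * M * C2%:R + 6 <= A%:R * E by rewrite -ler_pdivrMr //; exact: cstP.
have A2P : 27 * ME + 3 * M * (Cr%:R + 1) + 6 <= A2%:R * E.
  by rewrite -ler_pdivrMr //; exact: cstP.
pose Ct := (A + C2 + Cr + A2 + 1)%N.
have CtE : Ct%:R = A%:R + C2%:R + Cr%:R + A2%:R + 1 :> R by rewrite !natrD.
have Ct0 : 0 < Ct%:R :> R by rewrite ltr0n /Ct addn1.
have MCt : 0 < 8 * M * Ct%:R + 1 by rewrite addr_gt0 // !mulr_gt0.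
(* Up to the distance S2, at most (8 M Ct + 1) N, levels along v and ev then differ by at most N /
   2, which is D / 4 for D = 2 N. *)
pose de := 1 / (4 * (8 * M * Ct%:R + 1)).
have deE : de * (8 * M * Ct%:R + 1) = 1 / 4 by rewrite /de; field; rewrite gt_eqF.
have de0 : 0 < de <= 1 / 2.
  have h : 0 < de by rewrite divr_gt0 // mulr_gt0.
  rewrite h /=; have h2 : 0 <= de * (8 * M * Ct%:R) :=
    mulr_ge0 (ltW h) (mulr_ge0 (mulr_ge0 (ler0n _ 8) (ltW M0)) (ltW Ct0)).
  by move: deE; clear - h2; lra.
have [ev [qv [w1 [w2 [w3 [w4 [kq [lam [F1 F2 /andP[lam0 lam1] expo]]]]]]]]] :=
  frame_exists FF v1 M1 E0 hE de0 ze0 Ct0.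
case: F1 => ev3 evev /andP[h1a h1b] /andP[h2a h2b] vev.
case: F2; rewrite (_ : 2 + 6 * M / E = Q) // => qQ qq om1 kq0.
pose tol := Num.min (lam / 10) ze.
have tol0 : 0 < tol by rewrite lt_min divr_gt0.
have tol1 : tol <= lam / 10 by rewrite ge_min lexx.
have tol2 : tol <= ze by rewrite ge_min lexx orbT.
have EM3 : EM <= 3.
  by rewrite ler_pdivrMr //; exact: le_trans h1a h1b.
have aQ2 : al * Q ^+ 2 = EM / 800 by rewrite /al; field; rewrite gt_eqF.
have aQ : al * Q * 1600 <= EM.
  have h : al * Q * 2 <= al * Q * Q by rewrite ler_wpM2l // ltW // mulr_gt0.
  by move: aQ2; rewrite expr2 mulrA; clear - h; lra.
have al1 : al * 3200 <= EM.
  have h : al * 2 <= al * Q by rewrite ler_wpM2l // ltW.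
  by clear - h aQ; lra.
have zeQ : ze * Q = al * EM / 4000 by rewrite /ze; field; rewrite gt_eqF.
have zeE : 8000 * ze <= al * EM.
  have h : ze * 2 <= ze * Q by rewrite ler_wpM2l // ltW.
  by move: zeQ; clear - h; lra.
have zeE2 : 20 * ze <= EM / 1000.
  have h : al * EM <= 1 / 10 * EM by rewrite ler_pM2r //; clear - al1 EM3; lra.
  by clear - h zeE EM0; lra.
have nv2 : dotp (quarter qv) (quarter qv) = dotp qv qv by rewrite /quarter /dotp /=; ring.
have nvQ : norm1 (quarter qv) <= Q by rewrite /quarter /norm1 /= normrN addrC.
have qnv : dotp qv (quarter qv) = 0 by rewrite /quarter /dotp /=; ring.
near \oo => N.
have g1 : forall Tm : nat, Tm%:R <= Ct%:R * N%:R :> R -> forall k m m', (m <= m' <= Tm)%N ->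
  forall w, w \in [:: ev; - ev; w1; w2; w3; w4] ->
  dotp w (iter m' F k) - dotp w (iter m F k) <= (m'%:R - m%:R) * hg w + tol * N%:R.
  move=> Tm TK k m m' mm w.
    rewrite !in_cons in_nil orbF => /or4P[|||/or3P[||]] /eqP ->; move: Tm TK k m m' mm; near: N;
    exact: gains_bound.
have g2 : forall Tm : nat, (N <= Tm)%N -> Tm%:R <= Ct%:R * N%:R :> R ->
  forall w, w \in [:: ev; - ev; qv] -> exists xs, forall m m', (m <= m' <= Tm)%N ->
  (m'%:R - m%:R) * hg w - tol * N%:R <= dotp w (iter m' F xs) - dotp w (iter m F xs).
  move=> Tm NT TK w.
  by rewrite !in_cons in_nil orbF => /or3P[] /eqP ->; move: Tm NT TK; near: N; exact: straight_bound.
have n1 : 1 <= 1 * N%:R :> R by near: N; exact: near_linear.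
rewrite mul1r in n1.
pose rho := 6 * M + 11.
have b_la : 100 * (rho + 2 * M + 2) <= lam * N%:R by near: N; exact: near_linear.
have b_eps : Q * (3 * rho + 2 * M) <= ze * N%:R by near: N; exact: near_linear.
have b_z : `|dotp ev z| + 12 <= 1 / 10 * N%:R by near: N; apply: near_linear; apply: divr_gt0; rewrite ?ltr0n.
have b_S : `|z| + 3 * rho <= 1 * N%:R by near: N; exact: near_linear.
have b_P : 2 * rho <= ME * N%:R by near: N; exact: near_linear.
have b_4 : 18 * M + 12 + 3 * rho <= 1 / 4 * N%:R by near: N; apply: near_linear; apply: divr_gt0; rewrite ?ltr0n.
have b_3 : Q * (6 * M + 5) + E / 2 <= EM / 100 * N%:R by near: N; apply: near_linear; apply: divr_gt0; rewrite ?ltr0n.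
have b_1 : Q * (4 * M + 3) <= al / 8 * N%:R by near: N; apply: near_linear; apply: divr_gt0; rewrite ?ltr0n.
have b_2 : 4 * Q + E / 2 <= al * EM / (100 * Q) * N%:R.
  by near: N; apply: near_linear; apply: divr_gt0; apply: mulr_gt0; rewrite ?ltr0n.
have b_5 : Q * (6 * M + 5) <= 1 * N%:R by near: N; exact: near_linear.
have n0 : 0 < N%:R :> R := lt_le_trans ltr01 n1.
(* In nu steps an orbit moves by at most N / 12; in mu steps the ends of the sliding gate move
   across it by at most al N / 8, half of the available al N / 4. *)
pose nu := Num.truncn (N%:R / (12 * M)).
pose mu := Num.truncn (al * N%:R / (16 * M * Q)).
have M12 : 0 < 12 * M by apply: mulr_gt0; rewrite ?ltr0n.
have M16 : 0 < 16 * M * Q by do 2?[apply: mulr_gt0]; rewrite ?ltr0n.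
have nu_le : nu%:R <= N%:R / (12 * M) by rewrite truncn_le divr_ge0 // ltW.
have nu_ge : N%:R / (12 * M) < nu%:R + 1 by rewrite natr1 truncnS_gt.
have mu_le : mu%:R <= al * N%:R / (16 * M * Q).
  by rewrite truncn_le; apply: divr_ge0; apply: ltW => //; exact: mulr_gt0.
have mu_ge : al * N%:R / (16 * M * Q) < mu%:R + 1 by rewrite natr1 truncnS_gt.
have Mnu : M * nu%:R <= N%:R / 12.
  have h := ler_wpM2l (ltW M0) nu_le.
  have e1 : M * (N%:R / (12 * M)) = N%:R / 12 by field; rewrite gt_eqF.
  by rewrite e1 in h.
have nu1 : nu%:R <= N%:R / 12 :> R.
  apply: le_trans Mnu; exact: ler_peMl.
have QMmu : Q * (2 * M * mu%:R) <= al / 8 * N%:R.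
  have h := ler_wpM2l (ltW MQ0) mu_le.
  have e1 : M * Q * (al * N%:R / (16 * M * Q)) = al * N%:R / 16.
    by field; rewrite !gt_eqF.
  by rewrite e1 in h; clear - h; lra.
have [om omE] : exists x, hg qv = x by eexists.
have [h1 h1E] : exists x, hg ev = x by eexists.
have [h2 h2E] : exists x, hg (- ev) = x by eexists.
rewrite omE in om1; rewrite h1E in h1a h1b; rewrite h2E in h2a h2b.
rewrite h1E h2E in expo.
have nuom : EM * N%:R / 24 - E / 2 <= nu%:R * om.
  have a1 : (N%:R / (12 * M) - 1) * (E / 2) <= nu%:R * (E / 2).
    rewrite ler_pM2r; first by rewrite lerBlDr ltW.
    by apply: divr_gt0; rewrite ?ltr0n.
  have a2 : nu%:R * (E / 2) <= nu%:R * om by rewrite ler_wpM2l.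
  apply: le_trans a2; apply: le_trans a1; rewrite le_eqVlt; apply/orP; left.
  by apply/eqP; rewrite /EM; field; rewrite gt_eqF.
have muom : al * EM * N%:R / (32 * Q) - E / 2 <= mu%:R * om.
  have a1 : (al * N%:R / (16 * M * Q) - 1) * (E / 2) <= mu%:R * (E / 2).
    rewrite ler_pM2r; first by rewrite lerBlDr ltW.
    by apply: divr_gt0; rewrite ?ltr0n.
  have a2 : mu%:R * (E / 2) <= mu%:R * om by rewrite ler_wpM2l.
  apply: le_trans a2; apply: le_trans a1; rewrite le_eqVlt; apply/orP; left.
  by apply/eqP; rewrite /EM; field; rewrite !gt_eqF.
pose s0 := (A * N)%N; pose i := (s0 + C2 * N)%N.
pose T := (i + nu + Cr * N)%N; pose Tm := (T + A2 * N)%N.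
have iE : i%:R = s0%:R + C2%:R * N%:R :> R.
  by rewrite [i%:R](natrD R s0 (C2 * N)) natrM.
have TE : T%:R = i%:R + nu%:R + Cr%:R * N%:R :> R.
  by rewrite [T%:R](natrD R (i + nu) (Cr * N)) natrM (natrD R i nu).
have TmE : Tm%:R = T%:R + A2%:R * N%:R :> R.
  by rewrite [Tm%:R](natrD R T (A2 * N)) natrM.
have s0E : s0%:R = A%:R * N%:R :> R by rewrite natrM.
have TmK : Tm%:R <= Ct%:R * N%:R :> R.
  by move: TmE TE iE s0E CtE nu1 n0 => -> -> -> -> ->; clear; lra.
have leA : (N <= s0)%N by rewrite leq_pmull.
have iTm : (i <= Tm)%N.
  exact: leq_trans (leq_addr _ _) (leq_trans (leq_addr _ _) (leq_addr _ _)).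
have NT : (N <= Tm)%N := leq_trans leA (leq_trans (leq_addr _ _) iTm).
have [C [b [Cc uC Cb bz free]]] := H i.
have [xs xsP] := g2 Tm NT TmK ev ltac:(by rewrite !in_cons eqxx).
have [ys ysP] := g2 Tm NT TmK (- ev) ltac:(by rewrite !in_cons eqxx orbT).
have [rs rsP] := g2 Tm NT TmK qv ltac:(by rewrite !in_cons eqxx !orbT).
rewrite h1E in xsP; rewrite h2E in ysP; rewrite omE in rsP.
have {}g1 := g1 Tm TmK.
pose la := lam * N%:R; pose er := tol * N%:R; pose eps1 := ze * N%:R.
pose S := `|z| + 2 * rho + 6 * M * (Ct%:R * N%:R).
pose S2 := `|z| + 3 * rho + 8 * M * (Ct%:R * N%:R).
pose Wn := 2 * N%:R / E.
have er0 : 0 <= er by rewrite mulr_ge0 // ltW.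
have er_la : 10 * er <= la.
  have h : tol * N%:R <= lam / 10 * N%:R by rewrite ler_pM2r.
  by rewrite /er /la; clear - h; lra.
have er_eps : er <= eps1 by rewrite ler_pM2r.
have eps_EM : 20 * eps1 <= EM / 1000 * N%:R.
  have h := ler_wpM2r (ltW n0) zeE2.
  by rewrite /eps1 mulrA.
have eps_aEM : 400 * Q * eps1 <= al * EM / 10 * N%:R.
  have e1 : Q * eps1 = al * EM / 4000 * N%:R by rewrite /eps1 mulrA [Q * ze]mulrC zeQ.
  by rewrite -mulrA e1; clear; lra.
have la_N : la <= N%:R / 10.
  have h : lam * N%:R <= 1 / 10 * N%:R by rewrite ler_pM2r.
  by rewrite /la; clear - h; lra.
have la0 : 0 < la by exact: mulr_gt0.
have expoP k m m' : (m <= m' <= Tm)%N ->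
  (((m'%:R - m%:R) * h1 - 10 * la <= dotp ev (iter m' F k) - dotp ev (iter m F k) ->
  `|dotp qv (iter m' F k) - dotp qv (iter m F k) - kq * (m'%:R - m%:R)| <= eps1) *
  ((m'%:R - m%:R) * h2 - 10 * la <= dotp ev (iter m F k) - dotp ev (iter m' F k) ->
  `|dotp qv (iter m' F k) - dotp qv (iter m F k) - kq * (m'%:R - m%:R)| <= eps1))%type.
  move=> mm; have nn : 0 <= (m'%:R - m%:R : R) <= Ct%:R * N%:R.
    have /andP[mm1 mm2] := mm; apply/andP; split; first by rewrite subr_ge0 ler_nat.
    by apply: le_trans _ TmK; rewrite lerBlDr ler_wpDr // ler_nat.
  have g w := g1 k m m' mm w.
  have [] := expo (iter m' F k - iter m F k) (m'%:R - m%:R) N%:R la er nn n0 erefl er0 er_la.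
  - by rewrite dotpBr -h1E; apply: g; rewrite !in_cons eqxx ?orbT.
  - by rewrite dotpBr -h2E; apply: g; rewrite !in_cons eqxx ?orbT.
  - by rewrite dotpBr; apply: g; rewrite !in_cons eqxx ?orbT.
  - by rewrite dotpBr; apply: g; rewrite !in_cons eqxx ?orbT.
  - by rewrite dotpBr; apply: g; rewrite !in_cons eqxx ?orbT.
  - by rewrite dotpBr; apply: g; rewrite !in_cons eqxx ?orbT.
  by rewrite !dotpBr opprB => a1 a2; split.
pose nv := quarter qv.
(* At time i the two ends lie on opposite sides of z along [nv], which is orthogonal to [qv]; up to
   rounding they have the transverse coordinate of z. *)
pose r0 := rs + floor_pt (z + (al * N%:R) *: nv - orb F rs i).
pose g := floor_pt ((- (2 * (al * N%:R))) *: nv).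
have aN : 0 < al * N%:R by exact: mulr_gt0.
have [er1 [er1P er1E]] : exists d, `|d| <= 1 /\ orb F r0 i - z = (al * N%:R) *: nv + d.
  exists (floor_pt (z + (al * N%:R) *: nv - orb F rs i) - (z + (al * N%:R) *: nv - orb F rs i)).
  split; first exact: floor_pt_near.
  rewrite /r0 (orb_lattice Fper); last exact: floor_pt_lattice.
  set x := floor_pt _; set y := orb F rs i; set w := _ *: nv.
  by rewrite !opprD opprK -!addrA; apply/eqP; rewrite -subr_eq0; apply/eqP;
    rewrite !opprD !opprK; ring.
have [er2 [er2P er2E]] : exists d, `|d| <= 1 /\ g = (- (2 * (al * N%:R))) *: nv + d.
  exists (g - (- (2 * (al * N%:R))) *: nv); split; first exact: floor_pt_near.
  by rewrite addrC subrK.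
have nvN : `|nv| <= Q.
  apply: le_trans nvQ; apply: norm_le; rewrite /norm1; first by rewrite lerDl.
  by rewrite lerDr.
have qd d : `|d| <= 1 -> `|dotp qv d| <= Q.
  move=> h; apply: le_trans (dotp_norm1 _ _) _.
  by rewrite -[Q]mulr1; apply: ler_pM => //; exact: norm1_ge0.
have nd d : `|d| <= 1 -> `|dotp nv d| <= Q.
  move=> h; apply: le_trans (dotp_norm1 _ _) _.
  by rewrite -[Q]mulr1; apply: ler_pM => //; exact: norm1_ge0.
have nvnv : 1 / 4 <= dotp nv nv by rewrite nv2.
have aNnv : al * N%:R / 4 <= al * N%:R * dotp nv nv.
  by have h := ler_wpM2l (ltW aN) nvnv; clear - h; lra.
have gn : `|g| <= 2 * (al * N%:R) * Q + 1.
  rewrite er2E; apply: le_trans (ler_normD _ _) _; apply: lerD => //.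
  rewrite normrZ normrN ger0_norm; last by rewrite mulr_ge0 // ltW.
  by rewrite ler_wpM2l // mulr_ge0 // ltW.
have aQN : al * Q * N%:R * 1600 <= EM * N%:R.
  by have h := ler_wpM2r (ltW n0) aQ; clear - h; lra.
have EMN : EM * N%:R <= 3 * N%:R by rewrite ler_pM2r.
have Qrg : Q * (4 * al * Q * N%:R + 6 * M + 3) = EM / 200 * N%:R + Q * (6 * M + 3).
  have e1 : EM = 800 * (al * Q ^+ 2) by rewrite aQ2; field.
  by rewrite e1; field.
have PPE : 4 * M * Wn = 8 * ME * N%:R by rewrite /Wn /ME; field; rewrite gt_eqF.
have EiN (X : R) j : X <= j%:R * E -> X * N%:R <= j%:R * N%:R * E.
  by move=> h; have := ler_wpM2r (ltW n0) h; rewrite mulrAC.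
have up1 (j : nat) : j%:R * N%:R * h1 <= j%:R * N%:R * (3 * M) by rewrite ler_wpM2l.
have up2 (j : nat) : j%:R * N%:R * h2 <= j%:R * N%:R * (3 * M) by rewrite ler_wpM2l.
have lo1 (j : nat) : j%:R * N%:R * E <= j%:R * N%:R * h1 by rewrite ler_wpM2l.
have lo2 (j : nat) : j%:R * N%:R * E <= j%:R * N%:R * h2 by rewrite ler_wpM2l.
have nh1 : nu%:R * h1 <= N%:R / 4.
  have h : nu%:R * h1 <= nu%:R * (3 * M) by rewrite ler_wpM2l.
  by clear - h Mnu; lra.
have nh2 : nu%:R * h2 <= N%:R / 4.
  have h : nu%:R * h2 <= nu%:R * (3 * M) by rewrite ler_wpM2l.
  by clear - h Mnu; lra.
have ezN := ler_norm (dotp ev z).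
have MN : N%:R <= M * N%:R by rewrite ler_pMl.
have AN := EiN _ _ AP; have A2N := EiN _ _ A2P; have CrN := EiN _ _ CrP.
have rho0 : 0 <= rho := addr_ge0 (mulr_ge0 (ler0n _ 6) (ltW M0)) (ler0n _ 11).
have MEN : 0 <= ME * N%:R by rewrite mulr_ge0 // ltW.
have MC2 : 0 <= M * C2%:R * N%:R by rewrite !mulr_ge0 // ltW.
have MCr : 0 <= M * (Cr%:R + 1) * N%:R by rewrite !mulr_ge0 ?addr_ge0 // ltW.
have iS : i%:R - s0%:R = C2%:R * N%:R :> R by rewrite iE addrAC subrr add0r.
have TiS : T%:R - i%:R = nu%:R + Cr%:R * N%:R :> R by rewrite TE; ring.
have TnS : T%:R - (i + nu)%:R = Cr%:R * N%:R :> R.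
  by rewrite TE (natrD R i nu) addrAC subrr add0r.
have TmS : Tm%:R - T%:R = A2%:R * N%:R :> R by rewrite TmE addrAC subrr add0r.
apply: (@gates_contradiction _ M F FF Fper C v ev qv h1 h2 kq la er eps1 (2 * N%:R) S S2 Q Tm xs ys
  Cc uC free v3 ev3 evev qQ _ _ xsP _ _ _ _ _ er0 er_la _ _ Q0 _ b i s0 T mu nu N%:R Wn
  (al * N%:R / 4 - 2 * Q) (4 * al * Q * N%:R + 6 * M + 3) (al * N%:R * Q + 1) om r0 g Cb).
- by move=> k m m' mm; rewrite -h1E; apply: g1 => //; rewrite !in_cons eqxx ?orbT.
- move=> k m m' mm; have := g1 k m m' mm (- ev).
  by rewrite !in_cons eqxx !orbT h2E !dotpNl opprK addrC; apply.
- by move=> m m' mm; have := ysP m m' mm; rewrite !dotpNl opprK [- _ + _]addrC.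
- by move=> k m m' mm h; apply: (expoP k m m' mm).1.
- by move=> k m m' mm h; apply: (expoP k m m' mm).2.
- move=> d dS; apply: le_trans (vev d) _.
  have /andP[de1 _] := de0.
  have hS : S2 <= (8 * M * Ct%:R + 1) * N%:R.
    by move: b_S; rewrite /S2; clear; lra.
  have h := ler_wpM2l (ltW de1) (le_trans dS hS).
  by move: h; rewrite mulrA deE; clear; lra.
- rewrite /S /S2; have h := ler_wpM2l (ltW M0) TmK.
  by move: h; rewrite /rho; clear; lra.
- by move: b_la; rewrite /rho.
- by clear - la_N n0; lra.
- by move: b_eps; rewrite /rho.
- move=> m mT; have h := iter_near m bz.
  have t1 : m%:R <= Tm%:R :> R by rewrite ler_nat.
  have t2 : i%:R <= Tm%:R :> R by rewrite ler_nat.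
  have h2' := ler_wpM2l (ltW M0) (lerD t1 t2).
  have h3 := ler_wpM2l (ltW M0) TmK.
  have h4 := ler_normD (iter m F b - z) z; rewrite subrK in h4.
  by rewrite /S; move: h h2' h3 h4; rewrite /rho; clear; lra.
- exact: leq_addr.
- exact: leq_addr.
- exact: leq_addr.
- apply: le_truncn; rewrite ler_pdivrMr // [leRHS]mulrAC ler_pdivlMr //.
  have h : al * 12 <= 16 * Q by clear - al1 EM3 Q2; lra.
  have h' := ler_wpM2l (ltW (mulr_gt0 n0 M0)) h.
  by move: h'; clear; lra.
- rewrite /i leq_add2l; apply: leq_trans (leq_pmull N _) => //.
  rewrite -(ler_nat R); apply: le_trans mu_le _; rewrite ler_pdivrMr //.
  have h : al <= 16 * M * Q.
    have hh : 1 * 2 <= M * Q by apply: ler_pM.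
    by clear - al1 EM3 hh; lra.
  have h' := ler_wpM2l (ltW n0) h.
  by move: h'; clear; lra.
- exact: kq0.
- exact: le_trans (ltW E0) h1a.
- exact: le_trans (ltW E0) h2a.
- by apply: le_trans om1; apply: divr_ge0; [exact: ltW|exact: ler0n].
- by rewrite bz; move: b_z la_N n0; clear; lra.
- by rewrite divr_ge0 ?mulr_ge0 // ltW.
- move=> t ht; rewrite /Wn ler_pdivlMr //.
  have [t0|t0] := lerP t 0.
    have a1 := mulr_le0_ge0 t0 (ltW E0).
    by clear - a1 n0; lra.
  by apply: le_trans ht; rewrite ler_pM2l.
- rewrite iS /Wn ler_pdivrMr // mulrAC.
  rewrite ler_pM2r //; have h : 0 <= Q * ME by rewrite mulr_ge0 // ltW.
  by move: C2P h; clear; lra.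
- rewrite bz iS PPE s0E; move: (up2 C2) (lo1 A) AN b_P b_z la_N er_la.
  by move: ezN MN MEN MC2 n0; rewrite -/rho; clear; lra.
- rewrite bz TiS TmS PPE.
  move: (up1 Cr) nh1 (lo2 A2) A2N b_P b_z la_N er_la.
  by move: ezN MN MEN MCr n0; rewrite -/rho; clear; lra.
- move=> m m' mm; have := rsP m m' mm.
  set fp := floor_pt (z + (al * N%:R) *: nv - orb F rs i).
  have rE j : orb F r0 j = iter j F rs + fp := orb_lattice Fper rs j (floor_pt_lattice _).
  by rewrite !rE !dotpDr /er; clear; lra.
- exact: floor_pt_lattice.
- by rewrite gate_radE; move: gn; clear; lra.
- rewrite bz er1E dotpDr dotpZr; have := nd _ er1P; rewrite ler_norml => /andP[t1 _].
  by move: t1 aNnv (Q0); clear; lra.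
- rewrite bz addrAC er1E er2E !dotpDr !dotpZr.
  have := nd _ er1P; rewrite ler_norml => /andP[_ t1].
  have := nd _ er2P; rewrite ler_norml => /andP[_ t2].
  by move: t1 t2 aNnv; rewrite -/nv; clear; lra.
- rewrite bz er1E dotpDr dotpZr qnv mulr0 add0r.
  by have := qd _ er1P; move: (Q0); clear; lra.
- rewrite er2E dotpDr dotpZr qnv mulr0 add0r.
  by have := qd _ er2P; move: (Q0); clear; lra.
- rewrite bz er1E; apply: le_trans (ler_normD _ _) _; apply: lerD => //.
  by rewrite normrZ gtr0_norm // ler_pM2l.
- by move: QMmu b_1; clear; lra.
- have h : 10 * eps1 <= al * EM / (400 * Q) * N%:R.
    have Q400 : 0 < 400 * Q by apply: mulr_gt0; rewrite ?ltr0n.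
    by rewrite mulrAC ler_pdivlMr //; move: eps_aEM; clear; lra.
  have h' : al * EM / (400 * Q) * N%:R = (al * EM * N%:R / Q) / 400 by field; rewrite gt_eqF.
  have h3 : al * EM / (100 * Q) * N%:R = (al * EM * N%:R / Q) / 100 by field; rewrite gt_eqF.
  have h4 : al * EM * N%:R / (32 * Q) = (al * EM * N%:R / Q) / 32 by field; rewrite gt_eqF.
  have h5 : 0 < al * EM * N%:R / Q by apply: divr_gt0 => //; apply: mulr_gt0 => //; exact: mulr_gt0.
  move: b_2 muom h er_eps; rewrite h' h3 h4; move: h5.
  by move: (al * EM * N%:R / Q) (mu%:R * om) => x y; clear; lra.
- rewrite Qrg; move: b_3 nuom eps_EM er_eps (mulr_gt0 EM0 n0).
  by move: (nu%:R * om) => y; clear; lra.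
- move: b_4 Mnu aQN EMN n0; rewrite -/rho; clear; lra.
- have h : (9 * Q * ME + 3) * N%:R <= C2%:R * om * N%:R.
    rewrite ler_pM2r //; apply: le_trans C2P _; exact: ler_wpM2l.
  have h' := ler_wpM2l (ltW Q0) b_P.
  rewrite iS PPE Qrg; move: h h' b_5 eps_EM er_eps EMN n0.
  by rewrite -/rho; clear; lra.
- by move: nh1 nh2 la_N n0; clear; lra.
- rewrite bz TnS.
  by move: (lo2 Cr) CrN nh1 b_z la_N er_la ezN n0; clear; lra.
- rewrite bz iE mulrDl s0E.
  have h3 : 0 <= C2%:R * N%:R * h1 by rewrite !mulr_ge0 // (le_trans (ltW E0)).
  by move: (lo1 A) AN b_z ezN h3 MEN MC2 n0; clear; lra.
Unshelve. all: by end_near. Qed.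

End Periodic.

(** * Lifts of torus maps and rotation sets *)

Section Circle.
Context {R : realType}.
Implicit Types (a b : R).

Definition circ a : R * R := (cos a, sin a).

Lemma circ_neq0 a : circ a != 0.
Proof.
apply/eqP => -[c0 s0]; have := cos2Dsin2 a.
by rewrite c0 s0 !expr0n addr0 => /eqP; rewrite eq_sym oner_eq0.
Qed.

Lemma turns_circ a b : turns (circ a) (circ b) (b - a).
Proof.
exists 1 => //=; rewrite !mul1r -cosD [a + _]addrC subrK.
by rewrite [cos a * _ + _]addrC -sinD [a + _]addrC subrK.
Qed.

Lemma circ_cvg (T : Type) (G : set_system T) {GF : Filter G} (x : T -> R) a :
  x @ G --> a -> circ (x t) @[t --> G] --> circ a.
Proof.
move=> xa; apply: (@cvg_pair _ _ _ G (nbhs (cos a)) (nbhs (sin a))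
   _ _ _ (fun t => cos (x t)) (fun t => sin (x t))).
- exact: (cvg_app (@continuous_cos R a) xa).
- exact: (cvg_app (@continuous_sin R a) xa).
Qed.

(** Multiply the angle function by t: the difference of the two sides is continuous in t, a multiple
    of 2 pi, and 0 at t = 0. *)
Lemma turning_circ (x : R -> R) : continuous x ->
  turning (fun s => circ (x s)) = x 1 - x 0.
Proof.
move=> xc; pose f t := turning (fun s => circ (t * x s)) - t * (x 1 - x 0).
have cc t s : {for (t, s), continuous (fun p : R * R => circ (p.1 * x p.2))}.
  have ii : id @ (t, s) --> (t, s) by exact: cvg_id.
  pose proof (cvg_proj1 ii) as i1; pose proof (cvg_proj2 ii) as i2.
  apply: circ_cvg; apply: cvgM => //.
  exact: (cvg_app (xc s) i2).
have c0 t s : circ (t * x s) != 0 by exact: circ_neq0.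
have [f0 f1] : f 0 = 0 /\ (forall t, {for t, continuous f}).
  split.
    rewrite /f turning_dot; first by rewrite !mul0r rotxx subr0.
    by move=> s t _ _; rewrite !mul0r; apply: dotp_gt0; exact: circ_neq0.
  move=> t; rewrite /f /prop_for /continuous_at.
  have h := @turning_continuous R R t (fun t s => circ (t * x s)) (fun s _ => c0 t s)
    (fun s _ => cc t s).
  apply: (@cvgB _ _ _ (nbhs t)); first exact: h.
  by apply: cvgM => //; exact: cvg_cst.
have : f 1 = 0.
  apply: cos_eq1_path f0 => // t _.
  have [N /nbhs_singleton fN] := @near_fine R R t (fun t s => circ (t * x s))
    (fun s _ => c0 t s) (fun s _ => cc t s).
  apply: (turns_uniq _ (turns_turning fN)); first exact: circ_neq0.
  by rewrite mulrBr; exact: turns_circ.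
rewrite /f mul1r => /eqP; rewrite subr_eq0 => /eqP <-.
by congr turning; apply/funext => s; rewrite mul1r.
Qed.

End Circle.

Section Lifts.
Context {R : realType}.
Implicit Types (z u w : R * R) (F G : R * R -> R * R) (f g : torus R -> torus R).

Lemma latticeP z w : reflect (lattice (z - w)) (int_translate z w).
Proof.
apply: (iffP andP) => [[/intrP[a ha] /intrP[c hc]]|[a [c h]]].
  by exists a, c; rewrite -ha -hc.
have h1 : z.1 - w.1 = a%:~R by rewrite -[LHS]/((z - w).1) h.
have h2 : z.2 - w.2 = c%:~R by rewrite -[LHS]/((z - w).2) h.
by rewrite h1 h2; split; exact: intr_int.
Qed.

Lemma torus_pi_lattice z u : lattice u -> torus_pi (z + u) = torus_pi z.
Proof. by move=> lu; apply/torus_piP/latticeP; rewrite addrC addKr. Qed.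

Lemma torus_pi_eq z w : torus_pi z = torus_pi w -> lattice (z - w).
Proof. by move/torus_piP/latticeP. Qed.

Lemma cos_sin_intr (a : R) (k : int) :
  cos (2 * pi * (a + k%:~R)) = cos (2 * pi * a) /\ sin (2 * pi * (a + k%:~R)) = sin (2 * pi * a).
Proof.
have n b (m : nat) : cos (2 * pi * (b + m%:R)) = cos (2 * pi * b) :> R /\
    sin (2 * pi * (b + m%:R)) = sin (2 * pi * b) :> R.
  elim: m => [|m [IH1 IH2]]; first by rewrite addr0.
  have -> : 2 * pi * (b + m.+1%:R) = 2 * pi * (b + m%:R) + pi *+ 2 :> R.
    by rewrite -natr1; ring.
  by split; [rewrite cosD|rewrite sinD]; rewrite cos2pi sin2pi !mulr1 !mulr0 ?subr0 ?addr0.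
case: k => k; first exact: (n a k).
have [h1 h2] := n (a + (Negz k)%:~R) k.+1.
by rewrite -h1 -h2 NegzE mulrNz -[k.+1%:~R]/(k.+1%:R : R) subrK.
Qed.

Definition circ_coord (c : R * R -> R) (p : torus R) : R * R :=
  circ (2 * pi * c (torus_repr p)).

Lemma circ_intr (a b : R) : a - b \is a Num.int -> circ (2 * pi * a) = circ (2 * pi * b).
Proof.
move=> /intrP[k h]; have -> : a = b + k%:~R by rewrite -h addrC subrK.
by rewrite /circ; have [-> ->] := cos_sin_intr b k.
Qed.

Lemma circ_coord_pi c z : c = fst \/ c = snd ->
  circ_coord c (torus_pi z) = circ (2 * pi * c z).
Proof.
move=> hc; apply: circ_intr.
have /torus_piP/andP[h1 h2] := torus_reprK (torus_pi z).
by case: hc => ->.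
Qed.

Lemma circ_coord_continuous c : c = fst \/ c = snd -> continuous (circ_coord c).
Proof.
move=> hc; apply/quotient_continuous.
change (continuous (circ_coord c \o torus_pi)).
have -> : circ_coord c \o torus_pi = (fun z => circ (2 * pi * c z)).
  by apply/funext => z; exact: circ_coord_pi.
move=> z; apply: circ_cvg; apply: cvgM; first exact: cvg_cst.
by case: hc => ->; [exact: cvg_fst|exact: cvg_snd].
Qed.

(* Along the homotopy, the circle-valued coordinates of the image of the loop [z + s u]
   have a turning that is a multiple of [2 pi] and continuous in time, hence constant. *)
Lemma homotopic_lifts f g F G z u : homotopic f g -> is_lift F f -> is_lift G g ->
  lattice u -> F (z + u) - F z = G (z + u) - G z.
Proof.
move=> [H [Hc H0 H1]] [Fc Ff] [Gc Gg] lu.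
(* The homotopy is continuous only within the unit time interval; clipped time gives a map
   continuous on the whole plane. *)
pose clip (t : R) := Num.max 0 (Num.min t 1).
have clip01 t : 0 <= clip t <= 1.
  by rewrite /clip le_max lexx ge_max ler01 /= ge_min lexx orbT.
pose K (p : R * R) : R * torus R := (clip p.1, torus_pi (z + p.2 *: u)).
have line (s : R) : z + t *: u @[t --> s] --> z + s *: u.
  by apply: cvgD; [exact: cvg_cst|apply: cvgZr_tmp; exact: cvg_id].
have Kc p : K @ p --> K p.
  have ii : id @ p --> p by exact: cvg_id.
  pose proof (cvg_proj1 ii) as i1; pose proof (cvg_proj2 ii) as i2.
  apply: (@cvg_pair _ _ _ (nbhs p) (nbhs (clip p.1)) (nbhs (torus_pi (z + p.2 *: u)))
    _ _ _ (fun p => clip p.1) (fun p => torus_pi (z + p.2 *: u))).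
    apply: cvg_maxr; first exact: cvg_cst.
    by apply: cvg_minr => //; exact: cvg_cst.
  apply: (cvg_app (h := torus_pi)); first exact: pi_continuous.
  exact: (cvg_app (h := fun s : R => z + s *: u) (line p.2) i2).
have HK : continuous (H \o K).
  move=> p; have A : (`[0, 1]%classic `*` [set: torus R]) (K p).
    by split => //=; rewrite in_itv /=; exact: clip01.
  have h := (subspace_continuousP _ _).1 Hc (K p) A.
  apply: (@cvg_comp _ _ _ K H _ (within (`[0, 1]%classic `*` [set: torus R]) (nbhs (K p))) _ _ h).
  move=> B hB; have {}hB : nbhs p (K @^-1` [set y | (`[0, 1]%classic `*` [set: torus R]) y -> B y]).
    exact: (Kc p).
  apply: filterS hB => q; apply; split => //=; rewrite in_itv /=; exact: clip01.
suff key c : c = fst \/ c = snd -> c (F (z + u)) - c (F z) = c (G (z + u)) - c (G z).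
  have k1 := key fst (or_introl erefl); have k2 := key snd (or_intror erefl).
  by apply: (@pair_equal_spec R R _ _ _ _).2.
move=> hc; pose x t s := circ_coord c (H (K (t, s))).
have xc t s : {for (t, s), continuous (fun p : R * R => x p.1 p.2)}.
  have -> : (fun p : R * R => x p.1 p.2) = circ_coord c \o (H \o K).
    by apply/funext => -[].
  apply: continuous_comp; first exact: HK.
  exact: circ_coord_continuous.
have x0 t s : x t s != 0 by exact: circ_neq0.
have xE (E : R * R -> R * R) (h : torus R -> torus R) t : continuous E ->
    (forall w, torus_pi (E w) = h (torus_pi w)) -> (forall p, H (clip t, p) = h p) ->
    turning (x t) = 2 * pi * (c (E (z + u)) - c (E z)).
  move=> Ec Eh Hh.
  have -> : x t = (fun s => circ (2 * pi * c (E (z + s *: u)))).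
    by apply/funext => s; rewrite /x /K /= Hh -Eh circ_coord_pi.
  rewrite (@turning_circ R (fun s => 2 * pi * c (E (z + s *: u)))).
    by rewrite scale1r scale0r addr0; ring.
  move=> s; apply: cvgM; first exact: cvg_cst.
  pose proof (cvg_app (h := E) (Ec (z + s *: u)) (line s)) as h1.
  pose proof (cvg_proj1 h1) as i1; pose proof (cvg_proj2 h1) as i2.
  by case: hc => ->.
have tc t : {for t, continuous (fun t => turning (x t))}.
  by apply: turning_continuous => // s _; exact: xc.
have cos1 t : cos (turning (x t)) = 1.
  have [N /nbhs_singleton fN] := @near_fine R R t x (fun s _ => x0 t s) (fun s _ => xc t s).
  have h := turns_turning fN.
  have e1 : x t 1 = x t 0.
    by rewrite /x /K /= scale1r scale0r addr0 torus_pi_lattice.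
  by rewrite e1 in h; exact: turns_id h.
have : turning (x 1) - turning (x 0) = 0.
  apply: (@cos_eq1_path R (fun t => turning (x t) - turning (x 0))).
  - by move=> t _; apply: (@cvgB _ _ _ (nbhs t)); [exact: tc|exact: cvg_cst].
  - by move=> t _; exact: cos_eq1B.
  - exact: subrr.
have c0 : clip 0 = 0 by rewrite /clip (min_idPl ler01) maxxx.
have c1 : clip 1 = 1 by rewrite /clip minxx (max_idPr ler01).
rewrite (xE F f 0) ?c0 // (xE G g 1) ?c1 //.
have pi0 := @pi_gt0 R.
have pi1 : 2 * pi != 0 :> R by rewrite mulf_neq0 ?pnatr_eq0 // gt_eqF.
by rewrite -mulrBr => /eqP; rewrite mulf_eq0 (negPf pi1) subr_eq0 => /eqP ->.
Qed.

End Lifts.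

(** * From torus maps to near shears, and from rotation sets to growth rates *)

Section TorusLifts.
Context {R : realType}.
Implicit Types (z u w : R * R) (F : R * R -> R * R) (f : torus R -> torus R) (B : set (R * R)).

Lemma shearD (ka : R) z w : shear ka (z + w) = shear ka z + shear ka w.
Proof.
rewrite /shear /=; congr pair.
by rewrite mulrDr addrACA.
Qed.

Lemma lift_dehn f F (k : int) z u : homotopic f (dehn_twist k) -> is_lift F f ->
  lattice u -> F (z + u) = F z + shear k%:~R u.
Proof.
move=> fk Ff lu; have sl : is_lift (@shear R k%:~R) (dehn_twist k).
  split; first exact: shear_continuous.
  by case=> x y; rewrite dehn_twist_pi.
have := homotopic_lifts z fk Ff sl lu; rewrite shearD [_ + shear _ u]addrC addrK.
by move=> <-; rewrite [RHS]addrC subrK.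
Qed.

Lemma lift_id f F z u : homotopic f id -> is_lift F f -> lattice u -> F (z + u) = F z + u.
Proof.
move=> fk Ff lu; have sl : is_lift (@idfun (R * R)) (@idfun (torus R)).
  by split => // x; exact: cvg_id.
have h : F (z + u) - F z = z + u - z := homotopic_lifts z fk Ff sl lu.
by rewrite -[LHS](subrK (F z)) h [z + u - z]addrAC subrr add0r addrC.
Qed.

Lemma shear0 z : shear 0 z = z :> R * R.
Proof. by rewrite /shear mul0r addr0 -surjective_pairing. Qed.

(** F minus the shear is lattice periodic, hence bounded by its values on the unit square. Points
    with equal images under F differ by a lattice vector because f is injective, and the shear of
    that vector is then 0. *)
Lemma lift_near_shear (ka : R) f F : is_lift F f -> injective f ->
  (forall z u, lattice u -> F (z + u) = F z + shear ka u) ->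
  exists2 M, 1 <= M & near_shear ka M F.
Proof.
move=> [Fc Ff] fi Fs; pose D z := F z - shear ka z.
have Dc : continuous D.
  by move=> z; apply: (@cvgB _ _ _ (nbhs z)); [exact: Fc|exact: shear_continuous].
have Dp z u : lattice u -> D (z + u) = D z.
  by move=> lu; rewrite /D Fs // shearD opprD addrACA subrr addr0.
pose I := (`[0, 1]%classic `*` `[0, 1]%classic : set (R * R)).
have cI : compact I by apply: compact_setX; exact: segment_compact.
have /compact_bounded[M0 [_ hM]] : compact (D @` I).
  by apply: continuous_compact => //; exact: continuous_subspaceT.
pose M := Num.max 1 (M0 + 1).
have DM z : `|D z| <= M.
  have fl : lattice (- floor_pt z).
    by exists (- Num.floor z.1), (- Num.floor z.2); rewrite !mulrNz.
  rewrite -(Dp z _ fl); apply: (hM M).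
    by rewrite /M lt_max; apply/orP; right; rewrite ltrDl.
  exists (z - floor_pt z) => //; split; rewrite /= in_itv /=.
    by have /andP[h1 h2] := floor_itv z.1; rewrite subr_ge0 h1 lerBlDl ltW // -intrD1.
  by have /andP[h1 h2] := floor_itv z.2; rewrite subr_ge0 h1 lerBlDl ltW // -intrD1.
exists M; first by rewrite le_max lexx.
split=> //.
- move=> x y xy; have lu : lattice (x - y).
    by apply: torus_pi_eq; apply: fi; rewrite -!Ff xy.
  have h : shear ka (x - y) = 0.
    by apply: (addrI (F y)); rewrite addr0 -Fs // addrC subrK.
  have h2 : (x - y).2 = 0 by exact: (congr1 snd h).
  have h1 : (x - y).1 = 0.
    have h1 : (x - y).1 + ka * (x - y).2 = 0 := congr1 fst h.
    by move: h1; rewrite h2 mulr0 addr0.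
  by apply/eqP; rewrite -subr_eq0; case: (x - y) h1 h2 => a c /= -> ->.
- by move=> z; apply: le_trans (norm1_le _) (DM z).
- by move=> z; apply: le_trans (norm2_le _) (DM z).
Qed.

(** The corner of a small square whose signs match those of w lies in the rotation set, and its
    product with w is a multiple of [norm1 w]. *)
Lemma rotation_growth (M : R) F : near_shear 0 M F -> interior (rotation_set F) (0, 0) ->
  exists2 E, 0 < E & forall w, E * norm1 w <= hgrowth F w.
Proof.
move=> FF /nbhs_ballP[e /= e0 he]; exists (e / 2); first exact: divr_gt0.
move=> w; pose p := (e / 2 * Num.sg w.1, e / 2 * Num.sg w.2).
have sgb (a : R) : `|0 - e / 2 * Num.sg a| < e.
  rewrite sub0r normrN normrM gtr0_norm ?divr_gt0 // normr_sg.
  have h : ((a != 0)%:R : R) <= 1 by case: (a != 0).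
  have h' := ler_wpM2l (ltW (divr_gt0 e0 (ltr0Sn R 1))) h.
  by clear - e0 h'; lra.
have pr : rotation_set F p by apply: he; split; exact: sgb.
have wp : dotp w p = e / 2 * norm1 w.
  by rewrite /dotp /norm1 /= (normrEsg w.1) (normrEsg w.2); ring.
apply: (growth_ge (0 : R * R) (dotp_step FF w)) => t t0 i.
have w1 : 0 < norm1 w + 1 by rewrite ltr_wpDl // norm1_ge0.
pose de := t / (norm1 w + 1); have de0 : 0 < de by exact: divr_gt0.
(* The index [i.+1] makes n positive, so that division by n can be undone. *)
have [y [[n /= ni [z _ yE]] yb]] := pr i.+1 isT _ (nbhsx_ballx p de de0).
exists n, z; split; first exact: ltnW.
have n0 : n%:R != 0 :> R by rewrite pnatr_eq0 -lt0n (leq_trans _ ni).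
have gE : gain F (dotp w) n z = n%:R * dotp w y.
  by rewrite /gain -dotpBr -yE dotpZr mulrA mulfV // mul1r.
rewrite gE ler_wpM2l // -wp.
have dN : `|p - y| <= de.
  by case: yb => y1 y2; apply: norm_le; apply: ltW; [exact: y1|exact: y2].
have h := dotp_norm1 w (p - y); rewrite dotpBr in h.
have h1 := ler_wpM2l (norm1_ge0 w) dN.
have h2 : norm1 w * de <= t.
  rewrite /de mulrA ler_pdivrMr // mulrC ler_pM2l //.
  by rewrite lerDl.
have h3 := ler_norm (dotp w p - dotp w y).
by clear - h h1 h2 h3; lra.
Qed.

Lemma vertical_growth (ka M : R) (e : int) F : (e == 1) || (e == -1) ->
  near_shear ka M F -> interior (vertical_rotation_set F) 0 -> 0 < growth F (height e).
Proof.
move=> e1 FF /nbhs_ballP[r /= r0 hr].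
have ee : e%:~R * e%:~R = 1 :> R by exact: sgz_sqr.
have en : `|e%:~R| = 1 :> R.
  by case/orP: e1 => /eqP ->; rewrite ?mulrN1z ?normrN normr1.
pose p : R := e%:~R * (r / 2).
have pr : vertical_rotation_set F p.
  apply: hr; rewrite /ball /= sub0r normrN normrM en mul1r gtr0_norm ?divr_gt0 //.
  by clear - r0; lra.
have hs z : `|height e (F z) - height e z : R| <= M.
  rewrite /height -mulrBr normrM en mul1r; exact: (ns_bound2 FF z).
apply: (@lt_le_trans _ _ (r / 2)); first exact: divr_gt0.
apply: (growth_ge (0 : R * R) hs) => t t0 i.
have [y [[n /= ni [z _ yE]] yb]] := pr i.+1 isT _ (nbhsx_ballx p t t0).
exists n, z; split; first exact: ltnW.
have n0 : n%:R != 0 :> R by rewrite pnatr_eq0 -lt0n (leq_trans _ ni).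
have gE : gain F (height e) n z = n%:R * (e%:~R * y) :> R.
  by rewrite /gain /height -mulrBr -yE mulrCA [n%:R * _]mulrC mulfVK.
rewrite gE ler_wpM2l //.
have -> : r / 2 - t = e%:~R * p - t by rewrite /p mulrA ee mul1r.
rewrite lerBlDl -lerBlDr -mulrBr; apply: le_trans (ler_norm _) _.
by rewrite normrM en mul1r; exact: ltW yb.
Qed.

Lemma omega_chain F B z : omega F (unbounded_components B) z -> forall i,
  exists C b, [/\ connected C, unbounded C, C b, iter i F b = z & C `<=` B].
Proof.
move=> h i; have [b [C [[x Bx CE] Cu] Cb] bz] := h i I.
exists C, b; split => //.
- by rewrite -CE; exact: component_connected.
- move=> r; apply: contrapT => hn; apply: Cu => /=.
  exists (Num.max r 0); split; first exact: num_real.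
  move=> x' hx l Cl; apply: ltW; apply: le_lt_trans hx.
  rewrite le_max; apply/orP; left; apply: ltW; rewrite ltNge; apply/negP => rl.
  by apply: hn; exists l.
- by rewrite -CE; exact: connected_component_sub.
Qed.

Lemma diffeo_inj f : C1eps_diffeo f -> injective f.
Proof. by move=> [g [fg _ _]]; exact: can_inj fg. Qed.

End TorusLifts.

Theorem theorem9 (R : realType) (f : torus R -> torus R) (F : R * R -> R * R)
    (F_lift : is_lift F f) :
  (Diff_0 f -> interior (rotation_set F) (0, 0) ->
     forall theta : R, 0 <= theta <= 2 * pi ->
       omega F (unbounded_components (B_theta F theta)) = set0) /\
  ((exists k : int, k != 0 /\ Diff_ k f) ->
     interior (vertical_rotation_set F) 0 ->
       omega F (unbounded_components (B_S F)) = set0 /\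
       omega F (unbounded_components (B_N F)) = set0).
Proof.
split.
  move=> [fd _ fh] rho0 th _; rewrite -subset0 => z zo.
  have Fp : periodic_lift F by move=> x u; exact: lift_id fh F_lift.
  have [|M M1 FF] := @lift_near_shear R 0 f F F_lift (diffeo_inj fd).
    by move=> x u lu; rewrite shear0; exact: Fp.
  have [E E0 hE] := rotation_growth FF rho0.
  apply: (@no_trapped_point_periodic R M F FF Fp (cos th, sin th) E z M1 _ _ E0 hE).
  - by rewrite /dotp /= -!expr2 cos2Dsin2.
  - have h1 := cos_max th; have h2 := sin_max th.
    by rewrite /norm1 /=; clear - h1 h2; lra.
  move=> i; have [C [b [Cc Cu Cb bz CB]]] := omega_chain zo i.
  exists C, b; split => // k m /CB /(_ m).
  by rewrite /dotp /= [cos th * _]mulrC [sin th * _]mulrC.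
move=> [k [k0 [fd _ fh]]] rho0.
have Fs x u : lattice u -> F (x + u) = F x + shear k%:~R u.
  by move=> lu; exact: lift_dehn fh F_lift lu.
have [M _ FF] := @lift_near_shear R k%:~R f F F_lift (diffeo_inj fd) Fs.
have Feq : equivariant k F.
  by move=> x a c; rewrite Fs //; exists a, c.
(* The orientation e exchanges the two half-planes: e = -1 serves [B_S] and e = 1 serves [B_N]. *)
suff key (e : int) (B : set (R * R)) : (e == 1) || (e == -1) ->
    (forall x, B x -> forall m, 0 <= height e (iter m F x)) ->
    omega F (unbounded_components B) = set0.
  split; [apply: (key (-1))|apply: (key 1)] => // x Bx m; have := Bx m.
    by rewrite /height mulrN1z mulN1r oppr_ge0.
  by rewrite /height mul1r.
move=> e1 hB; rewrite -subset0 => z zo.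
apply: (@no_trapped_point_dehn R k M F FF Feq k0 e e1 z).
- exact: vertical_growth e1 FF rho0.
- have e1' : (- e == 1) || (- e == -1) by rewrite eqr_opp orbC eqr_oppLR.
  have -> : (fun x : R * R => - height e x) = height (- e).
    by apply/funext => x; rewrite /height mulrNz mulNr.
  exact: vertical_growth e1' FF rho0.
move=> i; have [C [b [Cc Cu Cb bz CB]]] := omega_chain zo i.
by exists C, b; split => // x m /CB /hB.
Qed.
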